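(* Let $n\ge 1$, let $A=(A_1,\dots,A_n)\in\mathbb{R}^n$ be a nonnegative vector (i.e. $A_i\ge 0$ for all $i$), and let $D=n+A_1+\cdots+A_n$. For any $f\in H^1_0(\mathbb{R}^n,x^A\,dx)$ such that $\int_{\mathbb{R}^n_A}|f|^2x^A\,dx=1$, the inequality $$\int_{\mathbb{R}^n_A}|f|^2\log|f|^2\,x^A\,dx\le\frac D2\log\left(\frac{2}{\Pi(A)\,e\,D}\int_{\mathbb{R}^n_A}|\nabla f|^2x^A\,dx\right)$$ holds true, where $$\Pi(A)=\left[\frac{\prod_{i=1}^n\Gamma\left(\frac{A_i+1}{2}\right)}{2^k}\right]^{2/D},\qquad k=\sharp\{i: A_i>0\}.$$ Equality holds if $f(x)=\dfrac{e^{-|x|^2/4}}{(2\Pi(A))^{D/4}}$, and this function satisfies $\int_{\mathbb{R}^n_A}|f|^2x^A\,dx=1$ and $\int_{\mathbb{R}^n_A}|x|^2|f|^2x^A\,dx=D$.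
   Context: Notation: $\mathbb{R}^n_A=\{x\in\mathbb{R}^n: x_i>0\text{ if }A_i>0\}$ and $x^A=|x_1|^{A_1}\cdots|x_n|^{A_n}$. $\Gamma$ is the Gamma function. $H^1_0(\mathbb{R}^n,x^A\,dx)=W^{1,2}_0(\mathbb{R}^n,x^A\,dx)$ is the closure of $C_c^1(\mathbb{R}^n)$ with respect to the norm $\left(\int_{\mathbb{R}^n}(|f|^2+|\nabla f|^2)\,x^A\,dx\right)^{1/2}$. Convention: $0\log 0=0$, and the left-hand integral is understood in the extended sense (value $-\infty$ allowed). *)

(* Defs.v *)
From HB Require Import structures.
From mathcomp Require Import all_boot all_order all_algebra.
From mathcomp Require Import all_classical all_reals all_analysis.

Set Implicit Arguments.
Unset Strict Implicit.
Unset Printing Implicit Defensive.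
Import Order.TTheory GRing.Theory Num.Theory.
Import numFieldNormedType.Exports.
Local Open Scope classical_set_scope.
Local Open Scope ring_scope.

Section pushforward_additive.
Context d d' (T : measurableType d) (T' : measurableType d').

Lemma semi_sigma_additive_pushforward (R : realType)
    (mu : {measure set T -> \bar R}) (f : T -> T') :
  measurable_fun setT f -> semi_sigma_additive (pushforward mu f).
Proof.
move=> mf F mF tF mUF; rewrite /pushforward preimage_bigcup.
apply: measure_semi_sigma_additive.
- by move=> n; rewrite -[X in measurable X]setTI; exact: mf.
- apply/trivIsetP => /= i j _ _ ij; rewrite -preimage_setI.
  by move/trivIsetP : tF => /(_ _ _ _ _ ij) ->//; rewrite preimage_set0.
- by rewrite -preimage_bigcup -[X in measurable X]setTI; exact: mf.
Qed.
End pushforward_additive.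

(* MathComp-Analysis has only the one-dimensional Lebesgue measure. We iterate
   its binary product over tuples and transport the result to row vectors;
   [lebesgue_rV_box] computes the measure of boxes. *)
Section lebesgue_tuple.
Variable R : realType.
Local Notation mR := (measurableTypeR R).
Local Open Scope ereal_scope.

Definition cons_pair n (p : mR * n.-tuple mR) : n.+1.-tuple mR :=
  [the n.+1.-tuple mR of p.1 :: p.2].

Lemma measurable_cons_pair n : measurable_fun setT (@cons_pair n).
Proof. by apply: measurable_cons; [exact: measurable_fst|exact: measurable_snd]. Qed.

Section lebesgue_cons.
Variables (n : nat) (mu : {sigma_finite_measure set (n.-tuple mR) -> \bar R}).

Definition lebesgue_cons : set (n.+1.-tuple mR) -> \bar R :=
  pushforward ((@lebesgue_measure R) \x mu) (@cons_pair n).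

Let lebesgue_cons0 : lebesgue_cons set0 = 0.
Proof. by rewrite /lebesgue_cons /pushforward preimage_set0 measure0. Qed.

Let lebesgue_cons_ge0 A : 0 <= lebesgue_cons A.
Proof. by rewrite /lebesgue_cons /pushforward measure_ge0. Qed.

Let lebesgue_cons_additive : semi_sigma_additive lebesgue_cons.
Proof.
by have := semi_sigma_additive_pushforward (mu := (@lebesgue_measure R) \x mu)
  (@measurable_cons_pair n).
Qed.

HB.instance Definition _ := isMeasure.Build _ _ _ lebesgue_cons
  lebesgue_cons0 lebesgue_cons_ge0 lebesgue_cons_additive.

Let lebesgue_cons_sigma_finite : sigma_finite setT lebesgue_cons.
Proof.
have /sigma_finiteP[F [TF ndF Foo]] := sigma_finiteT (@lebesgue_measure R).
have /sigma_finiteP[G [TG ndG Goo]] := sigma_finiteT mu.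
pose g (t : n.+1.-tuple mR) : mR * n.-tuple mR :=
  (tnth t ord0, [tuple of behead t]).
have mg : measurable_fun setT g.
  apply: measurable_fun_pair; first exact: measurable_tnth.
  exact: measurable_behead.
have gK : cancel (@cons_pair n) g.
  by move=> [x t]; congr pair => //; apply/val_inj.
exists (fun k => g @^-1` (F k `*` G k)).
  apply/esym/seteqP; split => // t _.
  have : setT (g t).1 by []. rewrite TF => -[i _ Fi].
  have : setT (g t).2 by []. rewrite TG => -[j _ Gj].
  exists (maxn i j) => //; split.
    by move: Fi; apply/subsetPset/ndF/leq_maxl.
  by move: Gj; apply/subsetPset/ndG/leq_maxr.
move=> k; have [mFk Fk] := Foo k; have [mGk Gk] := Goo k; split.
  by rewrite -[X in measurable X]setTI; apply: mg => //; exact: measurableX.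
rewrite /lebesgue_cons /pushforward -comp_preimage.
rewrite (_ : _ \o _ = id) ?preimage_id; last by apply/funext => p; exact: gK.
by rewrite product_measure1E// lte_mul_pinfty// ge0_fin_numE.
Qed.

HB.instance Definition _ := Measure_isSigmaFinite.Build _ _ _ lebesgue_cons
  lebesgue_cons_sigma_finite.
End lebesgue_cons.

Fixpoint lebesgue_tuple n : {sigma_finite_measure set (n.-tuple mR) -> \bar R} :=
  if n is n'.+1 then lebesgue_cons (lebesgue_tuple n')
  else \d_([tuple] : 0.-tuple mR).

Lemma lebesgue_tuple_box n (B : 'I_n -> set mR) :
  (forall i, measurable (B i)) ->
  lebesgue_tuple n [set t | forall i, B i (tnth t i)] =
  \prod_(i < n) lebesgue_measure (B i).
Proof.
elim: n B => [|n IH] B mB.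
  rewrite big_ord0 /= diracE (_ : [set _ | _] = setT) ?in_setT//.
  by apply/seteqP; split => // t _ [].
rewrite big_ord_recl /= /lebesgue_cons /pushforward.
rewrite (_ : _ @^-1` _ =
    B ord0 `*` [set t | forall i, B (lift ord0 i) (tnth t i)]); last first.
  apply/seteqP; split => [[x t] /= Bt|[x t] /= [Bx Bt] i].
    split; first by have := Bt ord0; rewrite (tnth_nth x).
    by move=> i; have := Bt (lift ord0 i); rewrite !(tnth_nth x).
  case: (unliftP ord0 i) => [j|] ->; last by rewrite (tnth_nth x).
  by have := Bt j; rewrite !(tnth_nth x).
rewrite product_measure1E; last 2 first.
- exact: mB.
- rewrite (_ : [set _ | _] = \bigcap_(i in [set: 'I_n])
      ((fun t : n.-tuple mR => tnth t i) @^-1` B (lift ord0 i))).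
    apply: fin_bigcap_measurable => // i _.
    by rewrite -[X in measurable X]setTI; apply: measurable_tnth.
  by apply/seteqP; split => [t h i _|t h i]; exact: h.
by congr mule; apply: IH => i; exact: mB.
Qed.
End lebesgue_tuple.

Section lebesgue_rV.
Variables (R : realType) (n : nat).
Local Notation mR := (measurableTypeR R).
Local Notation coors := (fun (i : 'I_n) (x : 'rV[R]_n) => x 0 i : mR).

HB.instance Definition _ := @isMeasurable.Build default_measure_display
  'rV[R]_n (g_sigma_preimage coors)
  (@sigma_algebra0 _ _ _) (@sigma_algebraC _ _) (@sigma_algebra_bigcup _ _ _).

Local Open Scope ereal_scope.
Definition rV_of_tuple (t : n.-tuple mR) : 'rV[R]_n := \row_i tnth t i.

Lemma measurable_rV_of_tuple : measurable_fun setT rV_of_tuple.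
Proof.
move=> _ Y mY; rewrite setTI.
have := g_sigma_preimage_comp coors rV_of_tuple.
set g := (fun i => _); rewrite (_ : g = fun i t => tnth t i); last first.
  by apply/funext => i; apply/funext => t; rewrite /g /= mxE.
move=> gE; suff : g_sigma_preimage (fun i (t : n.-tuple mR) => tnth t i)
  (rV_of_tuple @^-1` Y) by [].
by rewrite gE; exists Y => //; rewrite setTI.
Qed.

Definition lebesgue_rV : set 'rV[R]_n -> \bar R :=
  pushforward (@lebesgue_tuple R n) rV_of_tuple.

Let lebesgue_rV0 : lebesgue_rV set0 = 0.
Proof. by rewrite /lebesgue_rV /pushforward preimage_set0 measure0. Qed.

Let lebesgue_rV_ge0 A : 0 <= lebesgue_rV A.
Proof. by rewrite /lebesgue_rV /pushforward measure_ge0. Qed.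

Let lebesgue_rV_additive : semi_sigma_additive lebesgue_rV.
Proof.
by have := semi_sigma_additive_pushforward (mu := @lebesgue_tuple R n)
  measurable_rV_of_tuple.
Qed.

HB.instance Definition _ := isMeasure.Build _ _ _ lebesgue_rV
  lebesgue_rV0 lebesgue_rV_ge0 lebesgue_rV_additive.

Lemma lebesgue_rV_box (B : 'I_n -> set mR) :
  (forall i, measurable (B i)) ->
  lebesgue_rV [set x | forall i, B i (x 0%R i)] =
  \prod_(i < n) lebesgue_measure (B i).
Proof.
move=> mB; rewrite -lebesgue_tuple_box// /lebesgue_rV /pushforward.
congr (_ _); apply/seteqP.
by split => t /= h i; have := h i; rewrite mxE.
Qed.
End lebesgue_rV.

Section monomial_weight.
Context {R : realType} {n : nat}.
Implicit Types (A x : 'rV[R]_n) (f : 'rV[R]_n -> R) (g : 'rV[R]_n -> 'rV[R]_n).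

Definition sqnorm x : R := \sum_(i < n) x 0 i ^+ 2.

(* With [0 `^ 0 = 1], the coordinates with [A_i = 0] contribute a factor 1. *)
Definition monomial A x : R := \prod_(i < n) `|x 0 i| `^ A 0 i.

Definition orthant A : set 'rV[R]_n := [set x | forall i, 0 < A 0 i -> 0 < x 0 i].

Definition hdim A : R := n%:R + \sum_(i < n) A 0 i.

Definition grad f x : 'rV[R]_n := \row_i 'D_('e_i) f x.

Definition Cc1 f : Prop :=
  [/\ forall x, differentiable f x, continuous (grad f) &
      compact (closure [set x | f x != 0])].

Definition H1_sqdist A f g (u : 'rV[R]_n -> R) : \bar R :=
  \int[@lebesgue_rV R n]_x
    ((`|u x - f x| ^+ 2 + sqnorm (grad u x - g x)) * monomial A x)%:E.

(* [H10 A f g]: [f] belongs to the closure of C^1_c in the weighted H^1 norm,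
   and [g] is its gradient, i.e. the limit of the gradients of approximants.
   As the weight is locally bounded above and below off the hyperplanes
   [x_i = 0] with [A_i > 0], [f] determines [g] almost everywhere. *)
Definition H10 A f g : Prop :=
  [/\ measurable_fun setT f,
      forall i, measurable_fun setT (fun x => g x 0 i) &
      exists u : nat -> 'rV[R]_n -> R,
        (forall k, Cc1 (u k)) /\ H1_sqdist A f g (u k) @[k --> \oo] --> 0%E].

Definition wint A (h : 'rV[R]_n -> R) : \bar R :=
  \int[@lebesgue_rV R n]_(x in orthant A) (h x * monomial A x)%:E.

(* The convention [0 log 0 = 0] is automatic, [ln 0] being 0. *)
Definition xlnx (t : R) : R := t * ln t.

Definition Gamma (s : R) : R :=
  \int[@lebesgue_measure R]_(t in `]0, +oo[) (t `^ (s - 1) * expR (- t)).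

Definition PiA A : R :=
  ((\prod_(i < n) Gamma ((A 0 i + 1) / 2)) / 2 ^+ #|[set i | 0 < A 0 i]%SET|)
    `^ (2 / hdim A).

Definition logsob_rhs A g : \bar R :=
  (hdim A / 2)%:E * lne ((2 / (PiA A * expR 1 * hdim A))%:E *
                         wint A (fun x => sqnorm (g x))).

Definition extremal A x : R :=
  expR (- sqnorm x / 4) / (2 * PiA A) `^ (hdim A / 4).
End monomial_weight.

(* Main.v *)
Require Import Defs.
From mathcomp Require Import all_boot all_order all_algebra.
From mathcomp Require Import all_classical all_reals all_analysis.
From mathcomp Require Import measurable_realfun ring lra.
Import Order.TTheory GRing.Theory Num.Theory.
Import numFieldNormedType.Exports.
Set Implicit Arguments.
Unset Strict Implicit.
Unset Printing Implicit Defensive.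
Local Open Scope classical_set_scope.
Local Open Scope ring_scope.

(** The inequality is a consequence of optimal transport in dimension one, and
    the product structure of the weight lifts it to dimension n.

    On the line, let w be |x|^a, on the half-line if a > 0, and let r be a
    density of finite w-mass m. The increasing map T that sends r w to the
    multiple k exp(-s y^2/2) w(y) of the weighted Gaussian solves
    k exp(-s T^2/2) |T|^a T' = r |x|^a. Taking logarithms, and using
    ln T' <= T' - 1 and a ln(T/x) <= a (T/x - 1), the terms in T' and T/x are
    those of the derivative of T r |x|^a up to T r' |x|^a; completing the square
    with - s T^2 r/2 leaves r'^2/(2 s r). Since T r |x|^a has no positive boundary
    contribution, integration yields
      int r ln r w <= m ln m - (ln Z + 1 + a) m + (1/(2s)) int (r'^2/r) w,
    with Z the mass of the weighted Gaussian ([transport_pointwise],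
    [transport_entropy], [logsob_line]). Equality holds for Gaussians of
    variance 1/s, which is why the result is sharp.

    The left side and the Fisher information are compatible with integrating
    out one variable: the entropy splits into the entropy of the slices plus
    that of the marginal, and the Fisher information of the marginal is at
    most the integral of the Fisher information of the slices, because
    q^2/p is the supremum over l of the affine expressions 2 l q - l^2 p
    ([fisher_marginal]). Induction on the dimension gives [logsob_tensor].

    For u continuously differentiable with compact support, this is applied to
    h(u)^2 with h(v) = sqrt(v^2 + e^2) - e rather than to u^2. As |h'| <= 1 the
    Fisher information is at most 4 |grad u|^2, and h^2 ln h^2 >= - v^2/e
    provides an integrable lower bound, so that the inequality survives Fatou's
    lemma along a sequence that converges to f in the weighted Sobolev
    space ([H10_soft_bound]). The truncation is then removed by dominated
    convergence ([logsob_integrable]). The bound with e = 1 already shows that the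
    positive part of f^2 ln f^2 is integrable ([xlnx_pos_integrable]), and a
    divergent negative part makes the inequality trivial ([logsob_H10]).

    The masses of the one-variable Gaussians are Gamma integrals by the
    substitution t = s x^2/2, and their product is (2 Pi/s)^(D/2)
    ([log_massE]). The best scale s then gives the stated right side
    ([logsob_sharp]).

    The normalisation of the extremal function is the same product of
    masses. Its second moment follows from the dependence of that product on s,
    and its gradient is - x/2 times itself, so that entropy and energy are both
    explicit ([extremal_entropy]). It lies in the Sobolev space because its
    products with the cutoffs max(0, 1 - |x|^2/k)^2 converge to it
    ([extremal_H10]). *)

(** * Primitives and the pointwise transport inequality *)

Section calculus.
Context {R : realType}.
Local Notation mu := (@lebesgue_measure R).
Implicit Types (f g h : R -> R) (a b c : R).

(** The base point [c] keeps the integrals proper; the derivative is claimed only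
    to the right of it, which covers every interval that starts after [c]. *)
Lemma continuous_exists_primitive h c : continuous h ->
  exists H : R -> R, forall x, c < x -> is_derive x (1:R) H (h x).
Proof.
move=> ch; exists (fun x => \int[mu]_(t in `[c, x]) h t) => x cx.
have [] := @continuous_FTC1_closed R h c x (x + 1).
- by rewrite ltrDl.
- apply: continuous_compact_integrable; first exact: segment_compact.
  exact: continuous_subspaceT.
- exact: cx.
- exact: ch.
move=> dH <-; rewrite derive1E; exact: derivableP.
Qed.

Lemma Rintegral_primitive h H a b : a < b -> {within `[a, b], continuous h} ->
  (forall x, a <= x <= b -> is_derive x (1:R) H (h x)) ->
  \int[mu]_(x in `[a, b]) h x = H b - H a.
Proof.
move=> ab ch dH.
have cH x : a <= x <= b -> {for x, continuous H}.
  move=> xab; apply: differentiable_continuous; apply/derivable1_diffP.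
  by have := dH x xab => -[].
rewrite /Rintegral (@continuous_FTC2 R h H a b)//.
- split.
  + move=> x; rewrite in_itv/= => /andP[ax xb].
    by have [] := dH x; rewrite ?(ltW ax) ?(ltW xb).
  + apply: cvg_at_right_filter; apply: cH; rewrite lexx ltW//.
  + apply: cvg_at_left_filter; apply: cH; rewrite lexx andbT ltW//.
- move=> x; rewrite in_itv/= => /andP[ax xb].
  by rewrite derive1E; have [] := dH x; rewrite ?(ltW ax) ?(ltW xb).
Qed.

Lemma ln_le_subr1 (x : R) : 0 < x -> ln x <= x - 1.
Proof.
move=> x0; have := @le_ln1Dx R (x - 1); rewrite (_ : 1 + (x - 1) = x); last by ring.
by apply; lra.
Qed.

(** The pointwise heart of the argument: with [y = T x] and [y' = T' x], the
    Jacobian equation turns the logarithm of [r] into terms that are either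
    constant, part of the derivative of [T r |x|^a], or absorbed by a square.
    When [a = 0] the points [x] and [y] are arbitrary; when [a > 0] they must be
    on the open half-line, where [ln |y| - ln |x| <= y / x - 1]. *)
Lemma transport_pointwise (a s k x y r r' y' : R) : 0 <= a -> 0 < s -> 0 < k ->
  (0 < a -> 0 < x /\ 0 < y) -> 0 <= r -> (r = 0 -> r' = 0) ->
  k * expR (- s / 2 * y ^+ 2) * `|y| `^ a * y' = r * `|x| `^ a ->
  xlnx r * `|x| `^ a <= (ln k - (1 + a)) * (r * `|x| `^ a) +
    (y' * `|x| `^ a * r + y * (a * x^-1 * `|x| `^ a) * r + y * `|x| `^ a * r')
    + (2 * s)^-1 * (r' ^+ 2 / r * `|x| `^ a).
Proof.
move=> a0 s0 k0 axy r0 r'0 E.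
(* where the density vanishes so does its derivative, and both sides are 0 *)
have [r00|rn0] := eqVneq r 0.
  by rewrite /xlnx r'0// r00 !(mul0r,mulr0,expr0n,addr0,invr0)/=.
have rp : 0 < r by rewrite lt_def rn0.
have wp z : (0 < a -> 0 < z) -> 0 < `|z| `^ a.
  move: a0; rewrite le_eqVlt => /predU1P[<-|a0]; first by rewrite powRr0.
  by move=> /(_ a0) z0; rewrite powR_gt0// normr_gt0 gt_eqF.
have wx : 0 < `|x| `^ a by apply: wp => /axy[].
have wy : 0 < `|y| `^ a by apply: wp => /axy[].
have y'p : 0 < y'.
  have : 0 < r * `|x| `^ a by rewrite mulr_gt0.
  by rewrite -E pmulr_rgt0// !mulr_gt0 ?expR_gt0.
have lnr : ln r = ln k - s / 2 * y ^+ 2 + a * ln `|y| + ln y' - a * ln `|x|.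
  have := congr1 (@ln R) E.
  rewrite !lnM ?posrE ?mulr_gt0 ?expR_gt0// !ln_powR expRK => ?; lra.
have ay : a * ln `|y| - a * ln `|x| <= a * (y * x^-1 - 1).
  move: a0 axy; rewrite le_eqVlt => /predU1P[<-|a0 /(_ a0)[x0 y0]].
    by rewrite !mul0r subr0.
  rewrite -mulrBr ler_pM2l// !gtr0_norm// -ln_div ?posrE//.
  by apply: ln_le_subr1; rewrite divr_gt0.
have yr : ln r <= ln k - (1 + a) + y' + a * y * x^-1 - s / 2 * y ^+ 2.
  have := ln_le_subr1 y'p; lra.
(* the Gaussian exponent and [y r'] complete the square [(r' + s y r)^2] *)
have q : - (s / 2 * y ^+ 2) * r <= y * r' + (2 * s)^-1 * (r' ^+ 2 / r).
  rewrite -subr_ge0 (_ : _ - _ = (2 * s * r)^-1 * (r' + s * y * r) ^+ 2); last first.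
    by field; rewrite !gt_eqF.
  by rewrite mulr_ge0 ?sqr_ge0// invr_ge0 !mulr_ge0// ltW.
rewrite /xlnx.
have -> : (ln k - (1 + a)) * (r * `|x| `^ a) +
    (y' * `|x| `^ a * r + y * (a * x^-1 * `|x| `^ a) * r + y * `|x| `^ a * r')
    + (2 * s)^-1 * (r' ^+ 2 / r * `|x| `^ a)
  = ((ln k - (1 + a) + y' + a * y * x^-1) * r + y * r' +
     (2 * s)^-1 * (r' ^+ 2 / r)) * `|x| `^ a by ring.
rewrite ler_pM2r//.
have := ler_wpM2l (ltW rp) yr; lra.
Qed.

End calculus.

(** * Monotone transport maps and powers of the absolute value *)

Section transport.
Context {R : realType}.
Local Notation mu := (@lebesgue_measure R).

Lemma is_derive_continuous (f : R -> R) (x d : R) :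
  is_derive x (1:R) f d -> {for x, continuous f}.
Proof.
move=> df; apply: differentiable_continuous; apply/derivable1_diffP.
by have [] := df.
Qed.

(** The transport map is [N^-1 \o F]; [N] is known to be
    strictly increasing between [L] and [U], whence the requirement that the values of [F] stay
    strictly between [N L] and [N U]. *)
Lemma transport_map_exists (N n F f : R -> R) (c L U al b : R) :
  c < L -> L < U ->
  (forall y, c < y -> is_derive y (1:R) N (n y)) ->
  (forall y, L < y < U -> 0 < n y) ->
  (forall x, al <= x <= b -> N L < F x < N U) ->
  (forall x, al <= x <= b -> is_derive x (1:R) F (f x)) ->
  exists T : R -> R, forall x, al <= x <= b ->
    L < T x < U /\ is_derive x (1:R) T (f x / n (T x)).
Proof.
move=> cL LU dN n0 FN dF.
have cN : {within `[L, U], continuous N}.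
  apply: continuous_in_subspaceT => y; rewrite inE/= in_itv/= => /andP[Ly _].
  apply: is_derive_continuous; apply: dN; exact: lt_le_trans Ly.
have incN : {in `[L, U] &, {homo N : x y / x < y}}.
  apply: gtr0_derive1_lt_cc => // y; rewrite in_itv/= => /andP[Ly yU].
  - by have [] := dN y (lt_trans cL Ly).
  - have dy := dN y (lt_trans cL Ly).
    by rewrite derive1E derive_val n0// Ly.
have injN x y : L < x < U -> L < y < U -> N x = N y -> x = y.
  move=> /andP[Lx xU] /andP[Ly yU] Nxy; apply/eqP; rewrite eq_le !leNgt.
  apply/andP; split; apply/negP => xy.
    have := incN y x; rewrite !in_itv/= !ltW// => /(_ isT isT xy).
    by rewrite Nxy ltxx.
  have := incN x y; rewrite !in_itv/= !ltW// => /(_ isT isT xy).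
  by rewrite Nxy ltxx.
pose g v := xget L [set y | L < y < U /\ N y = v].
have gP v : N L < v < N U -> L < g v < U /\ N (g v) = v.
  move=> /andP[Lv vU]; rewrite /g; case: xgetP => [y _ //|/= no].
  have [|y] := @IVT R N L U v (ltW LU) cN.
    by rewrite ge_min le_max (ltW Lv) (ltW vU) orbT.
  rewrite in_itv/= => /andP[Ly yU] Nyv; exfalso; apply: (no y); split=> //.
  rewrite !lt_neqAle Ly yU !andbT; apply/andP; split; apply/eqP => E.
    by move: Lv; rewrite E Nyv ltxx.
  by move: vU; rewrite -E Nyv ltxx.
have gK y : L < y < U -> g (N y) = y.
  move=> /andP[Ly yU]; have [|gLU NgN] := gP (N y).
    by apply/andP; split; apply: incN; rewrite ?in_itv/= ?lexx ?ltW.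
  by apply: injN => //; rewrite Ly yU.
exists (g \o F) => x xab; have [gLU Ng] := gP _ (FN x xab); split=> //=.
have dg : is_derive (F x) (1:R) g (n (g (F x)))^-1.
  rewrite -{1}Ng; apply: is_derive_inverse.
  - have : \forall y \near g (F x), y \in `]L, U[ by apply: near_in_itvoo; rewrite in_itv.
    by apply: filterS => y; rewrite in_itv => /gK.
  - have : \forall y \near g (F x), y \in `]L, U[ by apply: near_in_itvoo; rewrite in_itv.
    apply: filterS => y; rewrite in_itv/= => /andP[Ly _].
    by apply: is_derive_continuous; apply: dN; apply: lt_trans Ly.
  - by apply: dN; case/andP: gLU => + _; apply: lt_trans.
  - by rewrite gt_eqF// n0.
have dFx := dF x xab.
apply: (is_derive_eq (is_derive1_comp dg dFx)); by rewrite mulrC.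
Qed.

Lemma continuous_normr_powR (a : R) : 0 <= a -> continuous (fun x : R => `|x| `^ a).
Proof.
rewrite le_eqVlt => /predU1P[<-|a0] x.
  by under [X in continuous_at _ X]eq_fun do rewrite powRr0; exact: cst_continuous.
have [->|x0] := eqVneq x 0; last first.
  apply: (@continuous_comp _ _ _ (@Num.norm _ R) (fun y => y `^ a)).
    exact: norm_continuous.
  by apply: is_derive_continuous; apply: is_derive1_powR; rewrite normr_gt0.
apply/cvgrPdist_lt => /= e e0; rewrite normr0 powR0 ?gt_eqF//.
near=> y; rewrite sub0r normrN ger0_norm ?powR_ge0//.
have [->|y0] := eqVneq y 0; first by rewrite normr0 powR0 ?gt_eqF.
have <- : (e `^ a^-1) `^ a = e by rewrite -powRrM mulVf ?gt_eqF// powRr1 ?ltW.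
apply: gt0_ltr_powR => //; rewrite ?nnegrE ?powR_ge0//.
near: y; apply: cvgr0_norm_lt => //; rewrite powR_gt0//.
Unshelve. all: by end_near. Qed.

(** The form [a / x * |x| ^ a] of the derivative also covers the constant case
    [a = 0] on the whole line. *)
Lemma is_derive_normr_powR (a x : R) : 0 <= a -> (0 < a -> 0 < x) ->
  is_derive x (1:R) (fun x : R => `|x| `^ a) (a * x^-1 * `|x| `^ a).
Proof.
rewrite le_eqVlt => /predU1P[<- _|a0 /(_ a0) x0].
  rewrite (_ : (fun _ => _) = cst 1); last by apply/funext => y; rewrite powRr0.
  by rewrite !mul0r; exact: is_derive_cst.
have dx := is_derive1_powR a x0.
have -> : a * x^-1 * `|x| `^ a = a * x `^ (a - 1).
  rewrite gtr0_norm// -mulrA; congr (_ * _).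
  by rewrite powRB ?powRr1 ?(ltW x0) 1?mulrC// (gt_eqF x0) implybT.
apply: near_eq_is_derive dx.
near=> y; rewrite gtr0_norm//; near: y; exact: lt_nbhsr.
Unshelve. all: by end_near. Qed.

Lemma xlnx_bounds (r : R) : 0 <= r -> - 1 <= xlnx r <= r ^+ 2.
Proof.
rewrite le_eqVlt /xlnx => /predU1P[<-|r0]; first by rewrite mul0r expr0n/= lerN10 lexx.
apply/andP; split.
  have : ln r^-1 <= r^-1 - 1 by apply: ln_le_subr1; rewrite invr_gt0.
  rewrite lnV ?posrE// => /(ler_wpM2l (ltW r0)).
  by rewrite mulrBr mulr1 divff ?gt_eqF//; lra.
by rewrite expr2 ler_wpM2l ?(ltW r0) ?ltW ?ln_sublinear.
Qed.

Lemma measurable_xlnx : measurable_fun setT (@xlnx R).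
Proof. by apply: measurable_funM; [exact: measurable_id|exact: measurable_ln]. Qed.

(** The inverse is written with a real power, which is measurable; multiplying
    it by [x] restores the sign and the convention [0^-1 = 0]. *)
Lemma measurable_inv : measurable_fun setT (@GRing.inv R).
Proof.
rewrite (_ : GRing.inv = fun x : R => x * (x ^+ 2) `^ (-1)).
  apply: measurable_funM => //.
  exact: (measurableT_comp (@measurable_powR R (-1)) (@exprn_measurable R setT 2)).
apply/funext => x; rewrite powR_inv1 ?sqr_ge0//.
have [->|x0] := eqVneq x 0; first by rewrite invr0 mul0r.
by rewrite expr2 invfM mulrA divff// mul1r.
Qed.

End transport.

(** * The transport inequality on an interval *)

Section core.
Context {R : realType}.
Local Notation mu := (@lebesgue_measure R).

Lemma continuous_itv_integrable (f : R -> R) (a b : R) :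
  {in `[a, b], forall x, {for x, continuous f}} ->
  mu.-integrable `[a, b] (EFin \o f).
Proof.
move=> cf; apply: continuous_compact_integrable; first exact: segment_compact.
by apply: continuous_in_subspaceT => x; rewrite inE/= => /cf.
Qed.

Lemma integrable_xlnx_itv (r w : R -> R) (a b : R) :
  (forall x, 0 <= r x) -> (forall x, 0 <= w x) ->
  continuous r -> continuous w ->
  mu.-integrable `[a, b] (EFin \o (fun x => xlnx (r x) * w x)).
Proof.
move=> r0 w0 cr cw.
apply: (@le_integrable _ _ R mu _ (measurable_itv _) _ (EFin \o (fun x => (1 + r x ^+ 2) * w x))) => //.
- apply/measurable_EFinP; apply: measurable_funTS.
  apply: measurable_funM; last exact: continuous_measurable_fun.
  by apply: measurableT_comp; [exact: measurable_xlnx|exact: continuous_measurable_fun].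
- move=> x _ /=; rewrite lee_fin !normrM (ger0_norm (w0 x)) ler_wpM2r//.
  have /andP[l1 l2] := xlnx_bounds (r0 x).
  rewrite (@ger0_norm _ (1 + _)) ?addr_ge0 ?sqr_ge0// -normrM -/(xlnx _) ler_norml.
  by have := sqr_ge0 (r x); lra.
- apply: continuous_itv_integrable => x _; apply: cvgM; last exact: cw.
  apply: cvgD; first exact: cvg_cst.
  exact: (cvgM (cr x) (cr x)).
Qed.

(** The source mass is strictly smaller than the target mass, so that the
    transport map stays in the interior of [[L, U]] and is differentiable up to
    the end points. For [a > 0] the source interval starts at a positive point,
    since the weight need not be differentiable at 0; the boundary term
    [- T r |x|^a] at [al] is then nonpositive because [T >= L >= 0]. *)
Lemma transport_entropy (a s k al b L U : R) (r r' : R -> R) :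
  0 <= a -> 0 < s -> 0 < k -> al < b -> (0 < a -> 0 <= L /\ 0 < al) -> L < U ->
  (forall x, 0 <= r x) -> (forall x, is_derive x (1:R) r (r' x)) ->
  continuous r' -> (forall x, r x = 0 -> r' x = 0) ->
  r b = 0 -> r al = 0 \/ 0 <= L ->
  mu.-integrable `[al, b] (EFin \o (fun x => r' x ^+ 2 / r x * `|x| `^ a)) ->
  \int[mu]_(x in `[al, b]) (r x * `|x| `^ a) <
    k * \int[mu]_(y in `[L, U]) (expR (- s / 2 * y ^+ 2) * `|y| `^ a) ->
  \int[mu]_(x in `[al, b]) (xlnx (r x) * `|x| `^ a) <=
  (ln k - (1 + a)) * \int[mu]_(x in `[al, b]) (r x * `|x| `^ a) +
  (2 * s)^-1 * \int[mu]_(x in `[al, b]) (r' x ^+ 2 / r x * `|x| `^ a).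
Proof.
move=> a0 s0 k0 alb La LU r0 dr cr' rr' rb ral ifi Hk.
have cW := continuous_normr_powR a0.
have cr : continuous r by move=> x; apply: is_derive_continuous (dr x).
have crW : continuous (fun x => r x * `|x| `^ a).
  by move=> x; apply: cvgM; [exact: cr|exact: cW].
have cM : continuous (fun y : R => expR (- s / 2 * y ^+ 2) * `|y| `^ a).
  move=> x; apply: cvgM; last exact: cW.
  apply: (@continuous_comp _ _ _ (fun y : R => - s / 2 * y ^+ 2) expR); last exact: continuous_expR.
  apply: cvgM; first exact: cvg_cst.
  exact: exprn_continuous.
pose n y := k * (expR (- s / 2 * y ^+ 2) * `|y| `^ a).
have cn : continuous n by move=> x; apply: cvgM; [exact: cvg_cst|exact: cM].
have [N dN] := continuous_exists_primitive (L - 1) cn.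
have [F0 dF0] := continuous_exists_primitive (al - 1) crW.
have {}dN' y : L <= y -> is_derive y (1:R) N (n y).
  by move=> Ly; apply: dN; rewrite ltrBlDr (le_lt_trans Ly)// ltrDl.
have {}dF0 y : al <= y -> is_derive y (1:R) F0 (r y * `|y| `^ a).
  by move=> Ly; apply: dF0; rewrite ltrBlDr (le_lt_trans Ly)// ltrDl.
have NE : k * \int[mu]_(y in `[L, U]) (expR (- s / 2 * y ^+ 2) * `|y| `^ a) = N U - N L.
  rewrite -RintegralZl//; last by apply: continuous_itv_integrable => x _; exact: cM.
  apply: Rintegral_primitive => //; first exact: continuous_subspaceT.
  by move=> x /andP[Lx _]; exact: dN'.
have FE x y : al <= x -> x < y -> \int[mu]_(x in `[x, y]) (r x * `|x| `^ a) = F0 y - F0 x.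
  move=> alx xy.
  apply: Rintegral_primitive => //; first exact: continuous_subspaceT.
  by move=> z /andP[xz _]; apply: dF0; exact: le_trans xz.
have Fnd x y : al <= x -> x <= y -> F0 x <= F0 y.
  move=> alx; rewrite le_eqVlt => /predU1P[->//|xy].
  rewrite -subr_ge0 -FE//; apply: Rintegral_ge0 => z _.
  by rewrite mulr_ge0// powR_ge0.
rewrite NE FE// in Hk.
(* half of the excess of the target mass: it is left free at each end of [[L, U]] *)
pose e := (N U - N L - (F0 b - F0 al)) / 2.
have e0 : 0 < e by rewrite /e; lra.
pose F x := F0 x + (N L - F0 al + e).
have [T TP] : exists T : R -> R, forall x, al <= x <= b ->
    L < T x < U /\ is_derive x (1:R) T ((r x * `|x| `^ a) / n (T x)).
  apply: (@transport_map_exists R N n F _ (L - 1)) => //.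
  - by rewrite ltrBlDr ltrDl.
  - move=> y /andP[Ly _]; rewrite /n !mulr_gt0 ?expR_gt0//.
    have [a00|an0] := eqVneq a 0; first by rewrite a00 powRr0.
    have [|L0 _] := La; first by rewrite lt_def an0.
    by rewrite powR_gt0// normr_gt0 gt_eqF// (le_lt_trans L0).
  - move=> x /andP[alx xb]; rewrite /F.
    have := Fnd al x (lexx _) alx; have := Fnd x b alx xb.
    have : N U = N L + (F0 b - F0 al) + 2 * e by rewrite /e; field.
    by move: e0; clear; lra.
  - move=> x /andP[alx xb]; have dx := dF0 x alx.
    by apply: is_derive_eq; rewrite addr0.
have Wx x : al <= x <= b -> (0 < a -> 0 < x).
  by move=> /andP[alx _] /La[_ al0]; exact: lt_le_trans alx.
pose T' x := (r x * `|x| `^ a) / n (T x).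
pose W' x := a * x^-1 * `|x| `^ a.
pose G x := T x * `|x| `^ a * r x.
pose G' x := T' x * `|x| `^ a * r x + T x * W' x * r x + T x * `|x| `^ a * r' x.
have cT x : al <= x <= b -> {for x, continuous T}.
  by move=> /TP[_]; exact: is_derive_continuous.
have dG x : al <= x <= b -> is_derive x (1:R) G (G' x).
  move=> xab; have [_ dT] := TP x xab.
  have dW := is_derive_normr_powR a0 (Wx x xab).
  have drx := dr x.
  have -> : G = (T * (fun x => `|x| `^ a)) * r by apply/funext.
  apply: is_derive_eq; rewrite /G' /T' /W'/GRing.scale/=.
  have -> : (T * (fun x => `|x| `^ a)) x = T x * `|x| `^ a by [].
  ring.
have n0 x : al <= x <= b -> n (T x) != 0.
  move=> xab; have [/andP[LT _] _] := TP x xab.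
  have [a00|an0] := eqVneq a 0; first by rewrite /n a00 powRr0 mulr1 gt_eqF// mulr_gt0 ?expR_gt0.
  have [|L0 _] := La; first by rewrite lt_def an0.
  rewrite gt_eqF// /n !mulr_gt0 ?expR_gt0//.
  by rewrite powR_gt0// normr_gt0 gt_eqF// (le_lt_trans L0).
have cG' x : al <= x <= b -> {for x, continuous G'}.
  move=> xab; apply: cvgD; first apply: cvgD.
  - apply: cvgM; last exact: cr.
    apply: cvgM; last exact: cW.
    apply: cvgM; first exact: crW.
    apply: cvgV; first exact: n0.
    by apply: (@continuous_comp _ _ _ T n); [exact: cT|exact: cn].
  - apply: cvgM; last exact: cr.
    apply: cvgM; first exact: cT.
    rewrite /W'; have [->|an0] := eqVneq a 0.
      under eq_fun do rewrite !mul0r; rewrite !mul0r; exact: cvg_cst.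
    have xp : 0 < x by apply: (Wx x xab); rewrite lt_def an0.
    apply: cvgM; last exact: cW.
    apply: cvgM; first exact: cvg_cst.
    by apply: cvgV; [rewrite gt_eqF|exact: cvg_id].
  - apply: cvgM; last exact: cr'.
    by apply: cvgM; [exact: cT|exact: cW].
(* [r] vanishes at [b], and at [al] either it vanishes or [T] is nonnegative *)
have GE : \int[mu]_(x in `[al, b]) G' x <= 0.
  rewrite (@Rintegral_primitive R G' G)//.
    rewrite /G rb mulr0 sub0r oppr_le0.
    case: ral => [->|L0]; first by rewrite mulr0.
    rewrite !mulr_ge0 ?powR_ge0//.
    have [|/andP[LT _] _] := TP al; first by rewrite lexx ltW.
    by rewrite ltW// (le_lt_trans L0).
  apply: continuous_in_subspaceT => x; rewrite inE/= in_itv/=; exact: cG'.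
have iG' : mu.-integrable `[al, b] (EFin \o G').
  by apply: continuous_itv_integrable => x; rewrite in_itv/=; exact: cG'.
have irW : mu.-integrable `[al, b] (EFin \o (fun x => r x * `|x| `^ a)).
  by apply: continuous_itv_integrable => x _; exact: crW.
have iZ c (f : R -> R) : mu.-integrable `[al, b] (EFin \o f) ->
    mu.-integrable `[al, b] (EFin \o (fun x => c * f x)).
  by move=> fi; have := @integrableZl _ _ _ mu `[al, b] _ c _ fi; exact.
have iD (f g : R -> R) : mu.-integrable `[al, b] (EFin \o f) ->
    mu.-integrable `[al, b] (EFin \o g) ->
    mu.-integrable `[al, b] (EFin \o (fun x => f x + g x)).
  by move=> fi gi; have := @integrableD _ _ _ mu `[al, b] _ _ _ fi gi; exact.
apply: (@le_trans _ _ (\int[mu]_(x in `[al, b])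
   ((ln k - (1 + a)) * (r x * `|x| `^ a) + G' x +
     (2 * s)^-1 * (r' x ^+ 2 / r x * `|x| `^ a)))).
  apply: le_Rintegral => //.
  - by apply: integrable_xlnx_itv => // x; rewrite powR_ge0.
  - by apply: (iD); [apply: (iD) => //; exact: iZ|exact: iZ].
  move=> x; rewrite /= in_itv/= => xab; apply: transport_pointwise => //.
  - move=> ap; split; first exact: Wx.
    have [L0 _] := La ap; have [/andP[LT _] _] := TP x xab.
    exact: le_lt_trans LT.
  - exact: rr'.
  - rewrite /T' -[X in X * _ = _]mulrA -/(n (T x)) mulrC divfK//; exact: n0.
rewrite RintegralD//; [|by apply: (iD) => //; exact: iZ|exact: iZ].
rewrite RintegralD//; [|exact: iZ].
rewrite !RintegralZl//; lra.
Qed.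

End core.

(** * Gaussian masses of the one-variable weights *)

Section half_weight.
Context {R : realType}.
Local Notation mu := (@lebesgue_measure R).
Implicit Types a s x : R.

(** The monomial weight restricted to the orthant is the product of these
    one-variable weights: the line is cut to a half-line exactly when [a > 0]. *)
Definition half_weight a x : R := if (0 < a) && (x <= 0) then 0 else `|x| `^ a.

Definition gauss_mass a s : R :=
  \int[mu]_x (expR (- s / 2 * x ^+ 2) * half_weight a x).

Lemma half_weight_ge0 a x : 0 <= half_weight a x.
Proof. by rewrite /half_weight; case: ifP => // _; exact: powR_ge0. Qed.

Lemma half_weight_le a x : half_weight a x <= `|x| `^ a.
Proof. by rewrite /half_weight; case: ifP => // _; exact: powR_ge0. Qed.

Lemma measurable_normr_powR a : measurable_fun setT (fun x => `|x| `^ a).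
Proof. exact: (measurableT_comp (@measurable_powR R a) (@normr_measurable R setT)). Qed.

Lemma measurable_half_weight a : measurable_fun setT (half_weight a).
Proof.
apply: measurable_fun_ifT => //; last exact: measurable_normr_powR.
apply: measurable_and => //.
exact: measurable_fun_ler.
Qed.

Lemma measurable_gauss s : measurable_fun setT (fun x => expR (- s / 2 * x ^+ 2)).
Proof.
apply: measurableT_comp; first exact: measurable_expR.
by apply: measurable_funM => //; exact: measurable_funX.
Qed.

Lemma integrable_gauss s : 0 < s ->
  mu.-integrable setT (EFin \o (fun x => expR (- s / 2 * x ^+ 2))).
Proof.
move=> s0.
(* the Gaussian is a multiple of the normal density of variance [1 / s] *)
pose g := Num.sqrt s^-1; have g0 : 0 < g by rewrite sqrtr_gt0 invr_gt0.
have gn : g != 0 by rewrite gt_eqF.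
have /(integrableZl measurableT (normal_peak g)^-1) := integrable_normal_pdf 0 g.
apply: eq_integrable => //= x _; rewrite normal_pdfE// -EFinM; congr EFin.
rewrite /normal_fun mulrA mulVf ?gt_eqF ?normal_peak_gt0// mul1r subr0.
congr expR; rewrite sqr_sqrtr ?invr_ge0 ?ltW//.
rewrite -mulr_natr invfM invrK; ring.
Qed.

(** Half of the Gaussian decay pays for the power, through
    [|x|^a <= exp (a |x|)] and a square. *)
Lemma powR_gauss_le a s x : 0 <= a -> 0 < s ->
  `|x| `^ a * expR (- s / 2 * x ^+ 2) <=
  expR (a ^+ 2 / s) * expR (- (s / 2) / 2 * x ^+ 2).
Proof.
move=> a0 s0.
have : `|x| `^ a <= expR (a * `|x|).
  have [->|x0] := eqVneq x 0.
    rewrite normr0 mulr0 expR0; case: (eqVneq a 0) => [->|an]; first by rewrite powRr0.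
    by rewrite powR0.
  rewrite /powR normr_eq0 (negbTE x0) ler_expR ler_wpM2l// ltW// ln_sublinear//.
  by rewrite normr_gt0.
move=> /(@ler_wpM2r _ (expR (- s / 2 * x ^+ 2)) (expR_ge0 _)) /le_trans; apply.
rewrite -!expRD ler_expR -[x ^+ 2]real_normK ?num_real// -subr_ge0.
rewrite (_ : _ - _ = s / 4 * (`|x| - 2 * a / s) ^+ 2); last by field; rewrite gt_eqF.
by rewrite mulr_ge0 ?sqr_ge0// divr_ge0// ltW.
Qed.

Lemma integrable_powR_gauss a s : 0 <= a -> 0 < s ->
  mu.-integrable setT (EFin \o (fun x => `|x| `^ a * expR (- s / 2 * x ^+ 2))).
Proof.
move=> a0 s0; have s20 : 0 < s / 2 by rewrite divr_gt0.
have /(integrableZl measurableT (expR (a ^+ 2 / s))) := integrable_gauss s20.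
apply: le_integrable => //.
  apply/measurable_EFinP; apply: measurable_funM.
    exact: measurable_normr_powR.
  exact: measurable_gauss.
move=> x _ /=; rewrite lee_fin !normrM !(ger0_norm (expR_ge0 _)) (ger0_norm (powR_ge0 _ _)).
exact: powR_gauss_le.
Qed.

Lemma integrable_half_weight_gauss a s : 0 <= a -> 0 < s ->
  mu.-integrable setT (EFin \o (fun x => expR (- s / 2 * x ^+ 2) * half_weight a x)).
Proof.
move=> a0 s0; have := integrable_powR_gauss a0 s0.
apply: le_integrable => //.
  apply/measurable_EFinP; apply: measurable_funM.
    exact: measurable_gauss.
  exact: measurable_half_weight.
move=> x _ /=; rewrite lee_fin !normrM !(ger0_norm (expR_ge0 _)) (ger0_norm (powR_ge0 _ _)).
rewrite (ger0_norm (half_weight_ge0 _ _)).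
by rewrite mulrC ler_wpM2r ?expR_ge0// half_weight_le.
Qed.

Lemma gauss_mass_gt0 a s : 0 <= a -> 0 < s -> 0 < gauss_mass a s.
Proof.
move=> a0 s0.
have -> : gauss_mass a s = \int[mu]_(x in setT) (expR (- s / 2 * x ^+ 2) * half_weight a x) by [].
apply: (@lt_le_trans _ _ (\int[mu]_(x in setT) (expR (- s * 2) * \1_(`[1, 2]) x))).
  rewrite RintegralZl//; last exact: integrable_indic_itv.
  rewrite mulr_gt0 ?expR_gt0// /Rintegral.
  rewrite integral_indic// setIT; have := @lebesgue_measure_itv R `[1:R, 2:R]; rewrite /= lte_fin ltr1n -EFinB => ->/=.
  by rewrite subr_gt0 ltr1n.
apply: le_Rintegral => //.
- have := @integrableZl _ _ R mu setT measurableT (expR (- s * 2)) _ (integrable_indic_itv 1 2 true false).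
  exact.
- exact: integrable_half_weight_gauss.
move=> x _; rewrite indicE; case: (boolP (x \in _)) => [|_]; last first.
  by rewrite mulr0 mulr_ge0 ?expR_ge0 ?half_weight_ge0.
rewrite inE/= in_itv/= => /andP[x1 x2]; rewrite mulr1.
have x0 : 0 < x by apply: lt_le_trans x1.
rewrite -[leLHS]mulr1 ler_pM ?expR_ge0//.
  rewrite ler_expR; have : s * x ^+ 2 <= s * 4 by rewrite ler_pM2l//; nra.
  by lra.
rewrite /half_weight (leNgt x 0) x0/= andbF gtr0_norm//.
by have := ler_powR x1 a0; rewrite powRr0.
Qed.

(** A strict bound on the mass is already visible on a bounded interval, to which
    the transport argument applies. *)
Lemma gauss_mass_itv_lt a s (m k : R) : 0 <= a -> 0 < s -> 0 < k ->
  m < k * gauss_mass a s -> exists2 U, 0 < U &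
  m < k * \int[mu]_(x in `[- U, U]) (expR (- s / 2 * x ^+ 2) * half_weight a x).
Proof.
move=> a0 s0 k0; set g := fun x => _ * _.
have ig : mu.-integrable setT (EFin \o g) by exact: integrable_half_weight_gauss.
have g0 x : 0 <= g x by rewrite mulr_ge0 ?expR_ge0 ?half_weight_ge0.
pose F (n : nat) : set R := `[- n%:R, n%:R]%classic.
have FT : \bigcup_i F i = setT.
  apply/seteqP; split=> // x _; exists (Num.bound x) => //=.
  rewrite /F/= in_itv/= -ler_norml ltW// (le_lt_trans (ler_norm _))//.
  have := archi_boundP (normr_ge0 x).
  by rewrite /Num.bound/= normr_id.
have := @ge0_nondecreasing_set_cvg_integral _ (measurableTypeR R) R F (EFin \o g) mu _ _ _ _.
rewrite FT => cvgF mk.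
have {cvgF} : \int[mu]_(x in F i) g x @[i --> \oo] --> gauss_mass a s.
  have : (\int[mu]_(x in F i) (EFin \o g) x)%E @[i --> \oo] --> (gauss_mass a s)%:E.
    rewrite /gauss_mass /Rintegral fineK; last exact: integrable_fin_num.
    apply: cvgF.
    - move=> i j ij; apply/subsetPset => x; rewrite /F/= !in_itv/= => /andP[x1 x2].
      rewrite (le_trans _ x1) ?(le_trans x2) ?lerN2 ?ler_nat//.
    - by move=> i; exact: measurable_itv.
    - by move=> i; apply: measurable_funTS; case/integrableP: ig.
    - by move=> i x _; rewrite lee_fin.
  by move=> /fine_cvg.
move=> /cvgr_gt /(_ (m / k)); rewrite ltr_pdivrMr// mulrC => /(_ mk).
move=> [n _ /(_ n.+1 (leqnSn _))/=]; rewrite ltr_pdivrMr// mulrC => H.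
by exists n.+1%:R.
Qed.

End half_weight.

(** * The logarithmic Sobolev inequality on the line *)

Section logsob_line.
Context {R : realType}.
Local Notation mu := (@lebesgue_measure R).

Definition half_left (a K : R) : R := if 0 < a then 0 else - K.

Lemma Rintegral_half_weight (a K : R) (f : R -> R) : 0 <= a ->
  (forall x, K < `|x| -> f x = 0) ->
  \int[mu]_x (f x * half_weight a x) =
  \int[mu]_(x in `[half_left a K, K]) (f x * `|x| `^ a).
Proof.
move=> a0 fK; rewrite [RHS]Rintegral_mkcond; apply: eq_Rintegral => x _.
rewrite patchE; case: ifPn; rewrite /half_weight /half_left.
  rewrite inE/= in_itv/=.
  have [a1|a1] := ltP 0 a; last by [].
  have [x0|//] := leP x 0; rewrite /= => /andP[x1 _].
  have -> : x = 0 by apply/eqP; rewrite eq_le x0 x1.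
  by rewrite normr0 powR0 ?gt_eqF.
rewrite notin_setE/= in_itv/= => /negP/nandP H.
have [Kx|xK] := ltP K `|x|; first by rewrite fK// mul0r.
move: xK; rewrite ler_norml => /andP[Kx xK].
case: ifPn H => [a1|a1]; last by rewrite Kx xK => -[].
by rewrite xK -ltNge => -[x0|//]; rewrite /= (ltW x0) mulr0.
Qed.

Lemma Rintegral_half_weight_itv (a K : R) (f : R -> R) : 0 <= a -> 0 < K ->
  \int[mu]_(x in `[- K, K]) (f x * half_weight a x) =
  \int[mu]_(x in `[half_left a K, K]) (f x * `|x| `^ a).
Proof.
move=> a0 K0; pose g x := if x \in `[- K, K] then f x else 0.
have := @Rintegral_half_weight a K g a0.
rewrite /g => H; rewrite Rintegral_mkcond.
transitivity (\int[mu]_x (g x * half_weight a x)).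
  apply: eq_Rintegral => x _; rewrite patchE /g mem_setE.
  by case: ifP => //; rewrite mul0r.
rewrite H.
  apply: eq_Rintegral => x; rewrite inE/= in_itv/= => /andP[lx xK].
  rewrite in_itv/= xK andbT; case: ifPn => //; rewrite -ltNge => xNK.
  move: lx; rewrite /half_left; case: ifPn => [_|_]; rewrite leNgt.
    by rewrite (lt_trans xNK)// oppr_lt0.
  by rewrite xNK.
move=> x; rewrite in_itv/= -ler_norml; by case: leP.
Qed.

(** Used to let the left end point of the source interval tend to the singular
    point 0 of the weight. *)
Lemma Rintegral_itv_ge0_left (b : R) (g : R -> R) : 0 < b ->
  mu.-integrable `[0, b] (EFin \o g) ->
  (forall e, 0 < e < b -> 0 <= \int[mu]_(x in `[e, b]) g x) ->
  0 <= \int[mu]_(x in `[0, b]) g x.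
Proof.
move=> b0 ig H; apply/ler_addgt0Pl => e e0; rewrite -lerBlDl sub0r.
have := @parameterized_integral_near_left R 0 b e g b0 e0 ig.
move=> [d /= d0 /(_ (Num.min (d / 2) (b / 2)))]; rewrite /ball_/= sub0r normrN.
set c := Num.min _ _.
have c0 : 0 < c by rewrite lt_min !divr_gt0.
have cd : c < d by rewrite gt_min ltr_pdivrMr// mulr_natr mulr2n ltrDl d0.
have cb : c < b by rewrite gt_min orbC ltr_pdivrMr// mulr_natr mulr2n ltrDl b0.
rewrite gtr0_norm// => /(_ cd (ltW c0)); rewrite /parameterized_integral => I1.
have := @Rintegral_itvB R g (BLeft 0) (BRight b) c ig.
rewrite !bnd_simp => /(_ (ltW c0) (ltW cb)).
rewrite Rintegral_itv_obnd_cbnd; last first.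
  by apply: integrableS ig => //; apply: subset_itvr; rewrite bnd_simp ltW.
move=> E; have := H c; rewrite c0 cb -E => /(_ isT).
by move: I1; rewrite ltr_norml => /andP[+ _]; lra.
Qed.

(** The transport inequality on the whole support. For [a > 0] it is first
    obtained on [[e, K]], and [e] then tends to 0. *)
Lemma logsob_line_mass_lt (a s K C k : R) (r r' : R -> R) :
  0 <= a -> 0 < s -> 0 < K -> 0 < k ->
  (forall x, 0 <= r x) -> (forall x, is_derive x (1:R) r (r' x)) ->
  continuous r' -> (forall x, r' x ^+ 2 <= C * r x) ->
  (forall x, K <= `|x| -> r x = 0) ->
  \int[mu]_x (r x * half_weight a x) < k * gauss_mass a s ->
  \int[mu]_x (xlnx (r x) * half_weight a x) <=
  (ln k - (1 + a)) * \int[mu]_x (r x * half_weight a x) +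
  (2 * s)^-1 * \int[mu]_x (r' x ^+ 2 / r x * half_weight a x).
Proof.
move=> a0 s0 K0 k0 r0 dr cr' r'C rK.
have rr' x : r x = 0 -> r' x = 0.
  move=> rx; apply/eqP; rewrite -sqrf_eq0 eq_le sqr_ge0 andbT.
  by have := r'C x; rewrite rx mulr0.
have rK' x : K < `|x| -> r x = 0 by move=> /ltW/rK.
move=> /(gauss_mass_itv_lt a0 s0 k0)[U U0].
rewrite Rintegral_half_weight_itv// !(@Rintegral_half_weight a K)//; last 2 first.
- by move=> x /rK' ->; rewrite invr0 mulr0.
- by move=> x /rK' ->; rewrite /xlnx mul0r.
have cW := continuous_normr_powR a0.
have cr : continuous r by move=> x; apply: is_derive_continuous (dr x).
have crW : continuous (fun x => r x * `|x| `^ a).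
  by move=> x; apply: cvgM; [exact: cr|exact: cW].
have irW u v : mu.-integrable `[u, v] (EFin \o (fun x => r x * `|x| `^ a)).
  by apply: continuous_itv_integrable => x _; exact: crW.
have i1 u v : mu.-integrable `[u, v] (EFin \o (fun x => xlnx (r x) * `|x| `^ a)).
  by apply: integrable_xlnx_itv => // x; rewrite powR_ge0.
have i2 u v : mu.-integrable `[u, v] (EFin \o (fun x => r' x ^+ 2 / r x * `|x| `^ a)).
  apply: (@le_integrable _ _ R mu _ (measurable_itv _) _ (EFin \o (fun x => C * `|x| `^ a))).
  - apply/measurable_EFinP; apply: measurable_funTS.
    apply: measurable_funM; last exact: measurable_normr_powR.
    apply: measurable_funM.
      by apply: measurable_funX; exact: continuous_measurable_fun.
    apply: (measurableT_comp (@measurable_inv R)).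
    exact: continuous_measurable_fun.
  - move=> x _ /=; rewrite lee_fin [leLHS]normrM [leRHS]normrM ler_wpM2r//.
    have [rx|rx] := eqVneq (r x) 0; first by rewrite rx invr0 mulr0 normr0.
    have rp : 0 < r x by rewrite lt_def rx r0.
    rewrite ger0_norm ?divr_ge0 ?sqr_ge0//.
    by rewrite (le_trans _ (ler_norm _))// ler_pdivrMr.
  - apply: continuous_itv_integrable => x _; apply: cvgM; first exact: cvg_cst.
    exact: cW.
have [a1|a1] := ltP 0 a; last first.
  have E : a = 0 by apply/eqP; rewrite eq_le a0 a1.
  subst a; move=> HU; apply: (@transport_entropy R 0 s k _ K (half_left 0 U) U) => //.
  - by rewrite /half_left ltxx gtrN.
  - by rewrite ltxx.
  - by rewrite /half_left ltxx gtrN.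
  - by rewrite rK// gtr0_norm.
  - by left; rewrite rK// /half_left ltxx normrN gtr0_norm.
rewrite /half_left a1 => HU.
have iZ c u v (f : R -> R) : mu.-integrable `[u, v] (EFin \o f) ->
    mu.-integrable `[u, v] (EFin \o (fun x => c * f x)).
  by move=> fi; have := @integrableZl _ _ R mu `[u, v] (measurable_itv _) c _ fi; exact.
have iD u v (f g : R -> R) : mu.-integrable `[u, v] (EFin \o f) ->
    mu.-integrable `[u, v] (EFin \o g) ->
    mu.-integrable `[u, v] (EFin \o (fun x => f x + g x)).
  by move=> fi gi; have := @integrableD _ _ R mu `[u, v] (measurable_itv _) _ _ fi gi; exact.
have iB u v (f g : R -> R) : mu.-integrable `[u, v] (EFin \o f) ->
    mu.-integrable `[u, v] (EFin \o g) ->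
    mu.-integrable `[u, v] (EFin \o (fun x => f x - g x)).
  by move=> fi gi; have := @integrableB _ _ R mu `[u, v] (measurable_itv _) _ _ fi gi; exact.
pose g x := (ln k - (1 + a)) * (r x * `|x| `^ a) +
  (2 * s)^-1 * (r' x ^+ 2 / r x * `|x| `^ a) - xlnx (r x) * `|x| `^ a.
have ig u v : mu.-integrable `[u, v] (EFin \o g).
  by apply: (iB) => //; apply: (iD); exact: iZ.
have gE u v : \int[mu]_(x in `[u, v]) g x =
  (ln k - (1 + a)) * \int[mu]_(x in `[u, v]) (r x * `|x| `^ a) +
  (2 * s)^-1 * \int[mu]_(x in `[u, v]) (r' x ^+ 2 / r x * `|x| `^ a) -
  \int[mu]_(x in `[u, v]) (xlnx (r x) * `|x| `^ a).
  rewrite RintegralB//; last by apply: (iD); exact: iZ.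
  by rewrite RintegralD//; [rewrite !RintegralZl|exact: iZ|exact: iZ].
rewrite -subr_ge0 -gE; apply: Rintegral_itv_ge0_left => // e /andP[e0 eK].
rewrite gE subr_ge0; apply: (@transport_entropy R a s k _ K 0 U) => //.
- by rewrite rK// gtr0_norm.
- by right.
apply: le_lt_trans HU.
have := @Rintegral_itvB R _ (BLeft 0) (BRight K) e (irW 0 K).
rewrite !bnd_simp => /(_ (ltW e0) (ltW eK)).
rewrite Rintegral_itv_obnd_cbnd; last first.
  by apply: integrableS (irW 0 K) => //; apply: subset_itvr; rewrite bnd_simp ltW.
move=> <-; rewrite lerBlDr lerDl; apply: Rintegral_ge0 => x _.
by rewrite mulr_ge0 ?powR_ge0.
Qed.

(** The constant [k] tends to [m / Z], the ratio of the two masses. *)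
Lemma logsob_line (a s K C : R) (r r' : R -> R) :
  0 <= a -> 0 < s -> 0 < K ->
  (forall x, 0 <= r x) -> (forall x, is_derive x (1:R) r (r' x)) ->
  continuous r' -> (forall x, r' x ^+ 2 <= C * r x) ->
  (forall x, K <= `|x| -> r x = 0) ->
  \int[mu]_x (xlnx (r x) * half_weight a x) <=
  xlnx (\int[mu]_x (r x * half_weight a x)) -
  (ln (gauss_mass a s) + (1 + a)) * \int[mu]_x (r x * half_weight a x) +
  (2 * s)^-1 * \int[mu]_x (r' x ^+ 2 / r x * half_weight a x).
Proof.
move=> a0 s0 K0 r0 dr cr' r'C rK.
have H k k0 := @logsob_line_mass_lt a s K C k r r' a0 s0 K0 k0 r0 dr cr' r'C rK.
have Z0 := gauss_mass_gt0 a0 s0.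
move: H; set m := \int[mu]_x (r x * half_weight a x) => H.
have : 0 <= m.
  by apply: Rintegral_ge0 => x _; rewrite mulr_ge0// half_weight_ge0.
(* a density of mass 0 is handled with the arbitrary constant [k = 1] *)
rewrite le_eqVlt => /predU1P[m0|m0].
  have := H 1 ltr01; rewrite -m0 mul1r => /(_ Z0).
  by rewrite /xlnx !(mul0r,mulr0,subr0).
apply/ler_addgt0Pr => e e0.
pose t := 1 + e / m.
have t1 : 1 < t by rewrite ltrDl divr_gt0.
have t0 : 0 < t by rewrite (lt_trans _ t1).
have k0 : 0 < t * m / gauss_mass a s by rewrite divr_gt0 ?mulr_gt0.
have := H _ k0; rewrite divfK ?gt_eqF// ltr_pMl// => /(_ t1) /le_trans; apply.
rewrite ln_div ?posrE ?mulr_gt0// lnM ?posrE// /xlnx.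
have lt : ln t <= e / m by apply: le_trans (ln_le_subr1 t0) _; rewrite /t; lra.
have : ln t * m <= e by rewrite -ler_pdivlMr.
lra.
Qed.

End logsob_line.

(** * Integration over tuples and weighted marginals *)

Section tuple_integral.
Context {R : realType}.
Local Notation mu := (@lebesgue_measure R).
Local Notation mR := (measurableTypeR R).
Local Notation leb n := (@lebesgue_tuple R n).

(** This class is stable under every operation of the induction on the
    dimension, and each weighted integral of its members is finite. *)
Definition box_bounded n (K : R) (f : n.-tuple mR -> R) :=
  [/\ measurable_fun setT f, exists C, forall t, `|f t| <= C &
      forall t i, K < `|tnth t i| -> f t = 0].

Lemma box_bounded_integrable n K (f : n.-tuple mR -> R) :
  box_bounded K f -> (leb n).-integrable setT (EFin \o f).
Proof.
move=> [mf [C fC] fK].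
pose B : set (n.-tuple mR) := [set t | forall i, `[- K, K]%classic (tnth t i)].
have mB : measurable B.
  rewrite (_ : B = \bigcap_(i in [set: 'I_n])
      ((fun t : n.-tuple mR => tnth t i) @^-1` `[- K, K]%classic)).
    apply: fin_bigcap_measurable => // i _.
    by rewrite -[X in measurable X]setTI; apply: measurable_tnth.
  by apply/seteqP; split => [t h i _|t h i]; exact: h.
have fB : EFin \o f = (EFin \o f) \_ B.
  apply/funext => t; rewrite patchE; case: ifPn => //.
  rewrite notin_setE /B/= => /existsNP[i]; rewrite /= in_itv/= -ler_norml.
  by move=> /negP; rewrite -ltNge /= => /fK ->.
rewrite fB; apply: (integrable_mkcond (EFin \o f) mB).1.
apply: (@measurable_bounded_integrable _ _ R (leb n) f B mB).
- pose S : set mR := `[- K, K]%classic.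
  rewrite /B /= (@lebesgue_tuple_box R n (fun=> S)) => [|i]; last exact: measurable_itv.
  suff /andP[] : (0 <= \prod_(i < n) mu S < +oo)%E by [].
  apply: (big_ind (fun x : \bar R => (0 <= x < +oo)%E)).
  - by rewrite lee01 ltry.
  - move=> x y /andP[x0 xy] /andP[y0 yy]; rewrite mule_ge0//=.
    by rewrite lte_mul_pinfty// ge0_fin_numE.
  - move=> i _; rewrite measure_ge0 /=.
    by have := @lebesgue_measure_itv R `[- K, K]%R => -> /=; case: ifP => _; rewrite ?ltry.
- exact: measurable_funTS.
- exists C; split; first exact: num_real.
  by move=> M CM t _ /=; apply: le_trans (fC t) (ltW CM).
Qed.

End tuple_integral.

Section marginal.
Context {R : realType}.
Local Notation mu := (@lebesgue_measure R).
Local Notation mR := (measurableTypeR R).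
Local Notation leb n := (@lebesgue_tuple R n).

Lemma tnth_cons_pair0 n (x : mR) (t : n.-tuple mR) : tnth (cons_pair (x, t)) ord0 = x.
Proof. by rewrite (tnth_nth x). Qed.

Lemma tnth_cons_pairS n (x : mR) (t : n.-tuple mR) i :
  tnth (cons_pair (x, t)) (lift ord0 i) = tnth t i.
Proof. by rewrite !(tnth_nth x). Qed.

Lemma measurable_cons_pair1 n (t : n.-tuple mR) :
  measurable_fun setT (fun x : mR => cons_pair (x, t)).
Proof. exact: (measurableT_comp (@measurable_cons_pair R n) (@pair2_measurable _ _ _ _ t)). Qed.

Definition marginal n (f : n.+1.-tuple mR -> R) (t : n.-tuple mR) : R :=
  \int[mu]_x f (cons_pair (x, t)).

Lemma integrable_bounded_support (K C : R) (f : mR -> R) :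
  measurable_fun setT f -> (forall x, `|f x| <= C) ->
  (forall x, K < `|x| -> f x = 0) -> mu.-integrable setT (EFin \o f).
Proof.
move=> mf fC fK.
pose S : set mR := `[- K, K]%classic.
have mS : measurable S by exact: measurable_itv.
have fB : EFin \o f = (EFin \o f) \_ S.
  apply/funext => t; rewrite patchE; case: ifPn => //.
  rewrite notin_setE /S/= in_itv/= -ler_norml.
  by move=> /negP; rewrite -ltNge /= => /fK ->.
rewrite fB; apply: (integrable_mkcond (EFin \o f) mS).1.
apply: (@measurable_bounded_integrable _ _ R mu f S mS).
- have := @lebesgue_measure_itv R `[- K, K]%R; rewrite -/S => E.
  have -> : (mu S < +oo)%E = true by rewrite E /=; case: ifP => _; rewrite ?ltry.
  by [].
- exact: measurable_funTS.
- exists C; split; first exact: num_real.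
  by move=> M CM t _ /=; apply: le_trans (fC t) (ltW CM).
Qed.

Lemma box_bounded_slice n K (f : n.+1.-tuple mR -> R) (t : n.-tuple mR) :
  box_bounded K f ->
  mu.-integrable setT (EFin \o (fun x : mR => f (cons_pair (x, t)))).
Proof.
move=> [mf [C fC] fK]; apply: (@integrable_bounded_support K C).
- exact: (measurableT_comp mf (measurable_cons_pair1 t)).
- by move=> x; exact: fC.
- by move=> x Kx; apply: (fK _ ord0); rewrite tnth_cons_pair0.
Qed.

Lemma box_bounded_pair_integrable n K (f : n.+1.-tuple mR -> R) :
  box_bounded K f ->
  (mu \x leb n)%E.-integrable setT (EFin \o f \o @cons_pair R n).
Proof.
move=> fK; have [mf _ _] := fK; apply/integrableP; split.
  by apply/measurable_EFinP; apply: (measurableT_comp mf); exact: measurable_cons_pair.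
have /integrableP[_] := box_bounded_integrable fK.
apply: le_lt_trans; rewrite le_eqVlt; apply/orP; left; apply/eqP.
have := @ge0_integral_pushforward _ _ _ _ R (@cons_pair R n) (@measurable_cons_pair R n)
  (mu \x leb n)%E setT (fun t => `|(EFin \o f) t|%E) measurableT.
rewrite preimage_setT => ->//.
by apply: measurableT_comp => //; exact/measurable_EFinP.
Qed.

Lemma fubini_G_marginal n K (f : n.+1.-tuple mR -> R) : box_bounded K f ->
  fubini_G mu (EFin \o f \o @cons_pair R n) = EFin \o marginal f.
Proof.
move=> fK; apply/funext => t; rewrite /fubini_G /marginal /= /Rintegral fineK//.
apply: integrable_fin_num => //; exact: (box_bounded_slice t fK).
Qed.

Lemma Rintegral_marginal n K (f : n.+1.-tuple mR -> R) : box_bounded K f ->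
  \int[leb n.+1]_t f t = \int[leb n]_t marginal f t.
Proof.
move=> fK; have iK := box_bounded_pair_integrable fK.
have [mf _ _] := fK; rewrite /Rintegral; congr fine.
have -> : (\int[leb n]_x (marginal f x)%:E = \int[leb n]_x (fubini_G mu (EFin \o f \o @cons_pair R n) x))%E.
  by rewrite (fubini_G_marginal fK).
rewrite (integral21_prod_meas1 iK).
have := @integral_pushforward _ _ _ _ R (@cons_pair R n) (@measurable_cons_pair R n)
  (mu \x leb n)%E setT (EFin \o f).
rewrite preimage_setT; apply => //.
by apply/measurable_EFinP.
Qed.

Lemma box_bounded_marginal n K (f : n.+1.-tuple mR -> R) : box_bounded K f ->
  box_bounded K (marginal f).
Proof.
move=> fK; have iK := box_bounded_pair_integrable fK.
have [mf [C fC] f0] := fK; split.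
- have := measurable_fubini_G iK; rewrite (fubini_G_marginal fK).
  by move=> /measurable_EFinP.
- exists (\int[mu]_x (C * \1_(`[- K, K]) x)) => t.
  have isl := box_bounded_slice t fK.
  apply: le_trans (le_normr_Rintegral measurableT isl) _.
  apply: le_Rintegral => //.
  + exact: (integrable_norm isl).
  + have := @integrableZl _ _ R mu setT measurableT C _ (integrable_indic_itv (-K) K true false).
    exact.
  + move=> x _; rewrite indicE; case: (boolP (x \in _)) => [_|].
      by rewrite mulr1.
    rewrite notin_setE/= in_itv/= -ler_norml => /negP; rewrite -ltNge => Kx.
    by rewrite (f0 _ ord0) ?tnth_cons_pair0// normr0 mulr0.
- move=> t i Ki; rewrite /marginal /Rintegral integral0_eq// => x _.
  by rewrite (f0 _ (lift ord0 i))// tnth_cons_pairS.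
Qed.

Definition tensor_weight n (A : 'I_n -> R) (t : n.-tuple mR) : R :=
  \prod_(i < n) half_weight (A i) (tnth t i).

Definition wmean n (A : 'I_n -> R) (f : n.-tuple mR -> R) : R :=
  \int[leb n]_t (f t * tensor_weight A t).

Lemma tensor_weight_ge0 n (A : 'I_n -> R) t : 0 <= tensor_weight A t.
Proof. by apply: prodr_ge0 => i _; exact: half_weight_ge0. Qed.

Lemma measurable_tensor_weight n (A : 'I_n -> R) : measurable_fun setT (tensor_weight A).
Proof.
apply: measurable_prod => i _.
exact: (measurableT_comp (@measurable_half_weight R (A i)) (@measurable_tnth _ _ _ i)).
Qed.

Lemma half_weight_bound a (K x : R) : 0 <= a -> `|x| <= K -> half_weight a x <= K `^ a.
Proof.
move=> a0 xK; apply: le_trans (half_weight_le _ _) _.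
by apply: ge0_ler_powR; rewrite ?nnegrE// (le_trans _ xK).
Qed.

Lemma box_boundedM n K (f g : n.-tuple mR -> R) : box_bounded K f ->
  measurable_fun setT g ->
  (exists C, forall t, (forall i, `|tnth t i| <= K) -> `|g t| <= C) ->
  box_bounded K (fun t => f t * g t).
Proof.
move=> [mf [C fC] fK] mg [D gD]; split.
- exact: measurable_funM.
- exists (C * `|D|) => t; have [tK|] := pselect (forall i, `|tnth t i| <= K).
    by rewrite normrM ler_pM// (le_trans (gD _ tK))// ler_norm.
  move=> /existsNP[i] /negP; rewrite -ltNge => /fK ->.
  by rewrite mul0r normr0 mulr_ge0// (le_trans _ (fC t)).
- by move=> t i /fK ->; rewrite mul0r.
Qed.

Lemma box_bounded_weight n K (A : 'I_n -> R) (f : n.-tuple mR -> R) :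
  (forall i, 0 <= A i) -> box_bounded K f ->
  box_bounded K (fun t => f t * tensor_weight A t).
Proof.
move=> A0 fK; apply: box_boundedM => //; first exact: measurable_tensor_weight.
exists (\prod_(i < n) K `^ A i) => t tK; rewrite ger0_norm ?tensor_weight_ge0//.
by apply: ler_prod => i _; rewrite half_weight_ge0 half_weight_bound.
Qed.

Lemma box_bounded_half_weight n K a (f : n.+1.-tuple mR -> R) :
  0 <= a -> box_bounded K f ->
  box_bounded K (fun t => f t * half_weight a (tnth t ord0)).
Proof.
move=> a0 fK; apply: box_boundedM => //.
  exact: (measurableT_comp (@measurable_half_weight R a) (@measurable_tnth _ _ _ ord0)).
by exists (K `^ a) => t tK; rewrite ger0_norm ?half_weight_ge0// half_weight_bound.
Qed.

Definition wmarginal n (a : R) (f : n.+1.-tuple mR -> R) (t : n.-tuple mR) : R :=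
  \int[mu]_x (f (cons_pair (x, t)) * half_weight a x).

Lemma wmarginalE n a (f : n.+1.-tuple mR -> R) :
  wmarginal a f = marginal (fun t => f t * half_weight a (tnth t ord0)).
Proof.
by apply/funext => t; apply: eq_Rintegral => x _; rewrite tnth_cons_pair0.
Qed.

Lemma box_bounded_wmarginal n K a (f : n.+1.-tuple mR -> R) :
  0 <= a -> box_bounded K f -> box_bounded K (wmarginal a f).
Proof.
by move=> a0 fK; rewrite wmarginalE; exact/box_bounded_marginal/box_bounded_half_weight.
Qed.

Lemma integrable_wslice n K a (f : n.+1.-tuple mR -> R) (t : n.-tuple mR) :
  0 <= a -> box_bounded K f ->
  mu.-integrable setT (EFin \o (fun x : mR => f (cons_pair (x, t)) * half_weight a x)).
Proof.
move=> a0 /(box_bounded_half_weight a0)/(box_bounded_slice t).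
by apply: eq_integrable => // x _ /=; rewrite tnth_cons_pair0.
Qed.

(** Fubini's theorem for the product weight: the induction integrates out the
    first coordinate. *)
Lemma wmean_wmarginal n K (A : 'I_n.+1 -> R) (f : n.+1.-tuple mR -> R) :
  (forall i, 0 <= A i) -> box_bounded K f ->
  wmean A f = wmean (fun i => A (lift ord0 i)) (wmarginal (A ord0) f).
Proof.
move=> A0 fK; rewrite /wmean (Rintegral_marginal (box_bounded_weight A0 fK)).
apply: eq_Rintegral => t _; rewrite /marginal /wmarginal.
rewrite -RintegralZr//; last exact: (integrable_wslice t (A0 ord0) fK).
apply: eq_Rintegral => x _; rewrite /tensor_weight big_ord_recl tnth_cons_pair0 mulrA.
by congr (_ * _); apply: eq_bigr => i _; rewrite tnth_cons_pairS.
Qed.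

End marginal.

(** * Fisher information of marginals *)

Section smooth_density.
Context {R : realType}.
Local Notation mu := (@lebesgue_measure R).
Local Notation mR := (measurableTypeR R).
Local Notation leb n := (@lebesgue_tuple R n).

Definition set_tnth n (t : n.-tuple mR) (i : 'I_n) (y : mR) : n.-tuple mR :=
  [tuple if j == i then y else tnth t j | j < n].

Lemma set_tnth_cons0 n (x y : mR) (t : n.-tuple mR) :
  set_tnth (cons_pair (x, t)) ord0 y = cons_pair (y, t).
Proof.
apply: eq_from_tnth => j; rewrite tnth_mktuple.
case: (unliftP ord0 j) => [k|] ->; last by rewrite eqxx tnth_cons_pair0.
by rewrite -[_ == _](inj_eq val_inj)/= !tnth_cons_pairS.
Qed.

Lemma set_tnth_consS n (x y : mR) (t : n.-tuple mR) i :
  set_tnth (cons_pair (x, t)) (lift ord0 i) y = cons_pair (x, set_tnth t i y).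
Proof.
apply: eq_from_tnth => j; rewrite tnth_mktuple.
case: (unliftP ord0 j) => [k|] ->; last by rewrite !tnth_cons_pair0.
by rewrite (inj_eq lift_inj) !tnth_cons_pairS tnth_mktuple.
Qed.

(** The partial derivatives [q] are data, so that those of a marginal can be
    prescribed as the marginals of those of the density. The bound
    [q^2 <= C p] makes [q^2 / p] bounded, and 0 where [p] vanishes. *)
Definition smooth_density n (K : R) (p : n.-tuple mR -> R) (q : 'I_n -> n.-tuple mR -> R) :=
  [/\ box_bounded K p, forall i, box_bounded K (q i), forall t, 0 <= p t,
      exists2 C, 0 <= C & forall i t, q i t ^+ 2 <= C * p t &
      forall i t, (forall y, is_derive y (1:R) (fun z : R => p (set_tnth t i z))
                              (q i (set_tnth t i y))) /\
                  continuous (fun y : R => q i (set_tnth t i y))].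

Lemma box_bounded_xlnx n K (p : n.-tuple mR -> R) :
  (forall t, 0 <= p t) -> box_bounded K p -> box_bounded K (fun t => xlnx (p t)).
Proof.
move=> p0 [mp [C pC] pK]; split.
- exact: (measurableT_comp (@measurable_xlnx R) mp).
- exists (1 + C ^+ 2) => t; have /andP[l1 l2] := xlnx_bounds (p0 t).
  have : p t ^+ 2 <= C ^+ 2.
    rewrite lerXn2r ?nnegrE ?p0 ?(le_trans (normr_ge0 _) (pC t))//.
    by rewrite (le_trans _ (pC t))// ler_norm.
  by move=> ?; rewrite ler_norml; have := sqr_ge0 C; lra.
- by move=> t i /pK ->; rewrite /xlnx mul0r.
Qed.

Lemma box_bounded_fisher n K C (p q : n.-tuple mR -> R) :
  (forall t, 0 <= p t) -> box_bounded K p -> box_bounded K q -> 0 <= C ->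
  (forall t, q t ^+ 2 <= C * p t) ->
  box_bounded K (fun t => q t ^+ 2 / p t).
Proof.
move=> p0 [mp _ pK] [mq _ _] C0 qC; split.
- apply: measurable_funM; first exact: measurable_funX.
  exact: (measurableT_comp (@measurable_inv R) mp).
- exists C => t; have [pt|pt] := eqVneq (p t) 0.
    by rewrite pt invr0 mulr0 normr0.
  by rewrite ger0_norm ?divr_ge0 ?sqr_ge0// ler_pdivrMr// lt_def pt p0.
- by move=> t i /pK ->; rewrite invr0 mulr0.
Qed.

(** The optimal choice is [l = Q / P]; if [P = 0] the hypothesis for large [l]
    forces [Q = 0]. *)
Lemma sqr_le_mul_of_affine (Q P F : R) : 0 <= P ->
  (forall l, 2 * l * Q - l ^+ 2 * P <= F) -> Q ^+ 2 <= F * P.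
Proof.
rewrite le_eqVlt => /predU1P[<- H|P0 H].
  rewrite mulr0; have [->|Q0] := eqVneq Q 0; first by rewrite expr0n.
  have := H ((F + 1) / (2 * Q)).
  rewrite mulr0 subr0 (_ : 2 * _ * Q = F + 1); last by field.
  lra.
have := H (Q / P); rewrite (_ : _ - _ = Q ^+ 2 / P); last by field; rewrite gt_eqF.
by rewrite ler_pdivrMr.
Qed.

Section step.
Variables (n : nat) (K a : R) (p : n.+1.-tuple mR -> R)
  (q : 'I_n.+1 -> n.+1.-tuple mR -> R).
Hypotheses (a0 : 0 <= a) (pq : smooth_density K p q).

(** For fixed [l] the expression [2 l q - l^2 p] is linear in [(p, q)], hence
    commutes with taking marginals, and it is at most [q^2 / p]. *)
Lemma fisher_marginal_affine i t l :
  2 * l * wmarginal a (q i) t - l ^+ 2 * wmarginal a p t <=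
  wmarginal a (fun t => q i t ^+ 2 / p t) t.
Proof.
have [pK qK p0 [C C0 qC] _] := pq.
have fK : box_bounded K (fun t => q i t ^+ 2 / p t).
  exact: (box_bounded_fisher p0 pK (qK i) C0).
have i1 := integrable_wslice t a0 (qK i).
have i2 := integrable_wslice t a0 pK.
rewrite /wmarginal -RintegralZl// -[X in _ - X]RintegralZl//.
have iZ c (f : R -> R) : mu.-integrable setT (EFin \o f) ->
    mu.-integrable setT (EFin \o (fun x => c * f x)).
  by move=> fi; have := @integrableZl _ _ R mu setT measurableT c _ fi; exact.
rewrite -RintegralB//; [|exact: iZ|exact: iZ].
apply: le_Rintegral => //.
- have := @integrableB _ _ R mu setT measurableT _ _ (iZ (2 * l) _ i1) (iZ (l ^+ 2) _ i2).
  exact.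
- exact: (integrable_wslice t a0 fK).
move=> x _; set u := cons_pair _.
have [pu|pu] := eqVneq (p u) 0.
  have qu : q i u = 0.
    by apply/eqP; rewrite -sqrf_eq0 eq_le sqr_ge0 andbT; have := qC i u; rewrite pu mulr0.
  by rewrite pu qu !(mul0r,mulr0,subr0,expr0n,invr0).
rewrite mulrA [_ * (p u * _)]mulrA -mulrBl ler_wpM2r ?half_weight_ge0//.
have pp : 0 < p u by rewrite lt_def pu p0.
rewrite -subr_ge0 (_ : _ - _ = (q i u - l * p u) ^+ 2 / p u); last by field.
by rewrite divr_ge0 ?sqr_ge0.
Qed.

Lemma wmarginal_ge0 t : 0 <= wmarginal a p t.
Proof.
have [_ _ p0 _ _] := pq; apply: Rintegral_ge0 => x _.
by rewrite mulr_ge0// half_weight_ge0.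
Qed.

(** Joint convexity of [q^2 / p], seen as a supremum of linear expressions. *)
Lemma fisher_marginal i t :
  wmarginal a (q i) t ^+ 2 / wmarginal a p t <=
  wmarginal a (fun t => q i t ^+ 2 / p t) t.
Proof.
have := sqr_le_mul_of_affine (wmarginal_ge0 t) (fisher_marginal_affine i t).
have [->|P0] := eqVneq (wmarginal a p t) 0.
  move=> _; rewrite invr0 mulr0; apply: Rintegral_ge0 => x _.
  have [_ _ p0 _ _] := pq.
  by rewrite mulr_ge0 ?half_weight_ge0// divr_ge0 ?sqr_ge0.
by rewrite ler_pdivrMr// lt_def P0 wmarginal_ge0.
Qed.

(** A majorant of the slices that does not depend on the slice, as needed to
    differentiate and to pass to the limit under the integral sign. *)
Lemma integrable_box_majorant C : 0 <= C -> mu.-integrable setT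
  (EFin \o (fun x : mR => C * \1_(`[- K, K]) x * half_weight a x)).
Proof.
move=> C0; apply: (@integrable_bounded_support R K (C * K `^ a)).
- apply: measurable_funM; last exact: measurable_half_weight.
  by apply: measurable_funM => //; exact: measurable_indic.
- move=> x; rewrite indicE; case: (boolP (x \in _)) => [|_]; last first.
    by rewrite mulr0 mul0r normr0 mulr_ge0// powR_ge0.
  rewrite inE/= in_itv/= -ler_norml => xK.
  by rewrite mulr1 ger0_norm ?mulr_ge0 ?half_weight_ge0// ler_wpM2l// half_weight_bound.
- move=> x Kx; rewrite indicE memNset ?mulr0 ?mul0r//= in_itv/= -ler_norml.
  by apply/negP; rewrite -ltNge.
Qed.

Lemma slice_le_box_majorant C (f : n.+1.-tuple mR -> R) t (x : mR) :
  (forall u, `|f u| <= C) -> (forall u i, K < `|tnth u i| -> f u = 0) ->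
  `|f (cons_pair (x, t)) * half_weight a x| <= C * \1_(`[- K, K]) x * half_weight a x.
Proof.
move=> fC f0; rewrite normrM [X in _ * X]ger0_norm ?half_weight_ge0//.
rewrite ler_wpM2r ?half_weight_ge0// indicE; case: (boolP (x \in _)) => [_|].
  by rewrite mulr1.
rewrite notin_setE/= in_itv/= -ler_norml => /negP; rewrite -ltNge => Kx.
by rewrite (f0 _ ord0) ?tnth_cons_pair0// normr0 mulr0.
Qed.

Lemma is_derive_wmarginal i t y :
  is_derive y (1:R) (fun z : R => wmarginal a p (set_tnth t i z))
    (wmarginal a (q (lift ord0 i)) (set_tnth t i y)).
Proof.
have [pK qK p0 _ dp] := pq; have [_ [C qC] q0] := qK (lift ord0 i).
have C0 : 0 <= C by apply: le_trans (qC (cons_pair (y, t))).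
pose f (z : R) (x : mR) := p (cons_pair (x, set_tnth t i z)) * half_weight a x.
pose G (x : mR) := C * \1_(`[- K, K]) x * half_weight a x.
have df x z : is_derive z (1:R) (fun z => f z x)
    (q (lift ord0 i) (cons_pair (x, set_tnth t i z)) * half_weight a x).
  have [+ _] := dp (lift ord0 i) (cons_pair (y, t)).
  have [/(_ z) dz _] := dp (lift ord0 i) (cons_pair (x, t)).
  rewrite set_tnth_consS in dz => _.
  have : is_derive z (1:R) (fun z : R => p (cons_pair (x, set_tnth t i z)))
    (q (lift ord0 i) (cons_pair (x, set_tnth t i z))).
    by under [X in is_derive _ _ X]eq_fun do rewrite -set_tnth_consS.
  move=> {}dz; rewrite /f.
  have -> : (fun z0 : R => p (cons_pair (x, set_tnth t i z0)) * half_weight a x) =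
    (fun z0 : R => p (cons_pair (x, set_tnth t i z0))) * cst (half_weight a x) by [].
  by apply: is_derive_eq; rewrite scaler0 add0r /cst/= /GRing.scale/= mulrC.
have yI : (`]y - 1, y + 1[%classic : set R) y.
  by rewrite /= in_itv/= ltrDl ltrBlDr ltrDl ltr01.
have if_ z : (`]y - 1, y + 1[%classic : set R) z -> mu.-integrable setT (EFin \o f z).
  by move=> _; exact: (integrable_wslice _ a0 pK).
have df_ (z : R) (x : mR) : (`]y - 1, y + 1[%classic : set R) z -> setT x ->
    derivable (fun z => f z x) z 1.
  by move=> _ _; have [] := df x z.
have G0 x : 0 <= G x by rewrite /G !mulr_ge0 ?half_weight_ge0// indicE.
have iG := integrable_box_majorant C0.
have Gf (z : R) (x : mR) : (`]y - 1, y + 1[%classic : set R) z -> setT x ->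
    `|partial1of2 f z x| <= G x.
  move=> _ _; rewrite partial1of2E.
  have [_ ->] := df x z; exact: slice_le_box_majorant.
have D1 := derivable_under_integral measurableT yI if_ df_ G0 iG Gf.
have D2 := differentiation_under_integral measurableT yI if_ df_ G0 iG Gf.
apply: DeriveDef; first exact: D1.
rewrite -derive1E [LHS]D2; apply: eq_Rintegral => x _ /=.
by rewrite partial1of2E; have [_ ->] := df x y.
Qed.

Lemma continuous_wmarginal i t :
  continuous (fun z : R => wmarginal a (q (lift ord0 i)) (set_tnth t i z)).
Proof.
have [pK qK p0 _ dp] := pq; have [_ [C qC] q0] := qK (lift ord0 i).
move=> y; have C0 : 0 <= C by apply: le_trans (qC (cons_pair (y, t))).
pose f (z : R) (x : mR) := q (lift ord0 i) (cons_pair (x, set_tnth t i z)) * half_weight a x.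
pose G (x : mR) := C * \1_(`[- K, K]) x * half_weight a x.
have yI : y \in (`]y - 1, y + 1[%classic : set R).
  by rewrite inE/= in_itv/= ltrDl ltrBlDr ltrDl ltr01.
apply: (@continuity_under_integral R _ _ mu f setT measurableT (y - 1) (y + 1) _ _ G) => //.
- by move=> z _; exact: (integrable_wslice _ a0 (qK _)).
- apply: aeW => x _ z _; rewrite /f; apply: cvgM; last exact: cvg_cst.
  have [_ /(_ z)] := dp (lift ord0 i) (cons_pair (x, t)).
  by under [X in continuous_at _ X]eq_fun do rewrite set_tnth_consS.
- exact: integrable_box_majorant.
- by move=> z _; apply: aeW => x _; exact: slice_le_box_majorant.
Qed.

(** The class is preserved by marginals, as the induction requires; the constant
    in [q^2 <= C p] comes from a bound on the marginals of [q^2 / p]. *)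
Lemma smooth_density_wmarginal :
  smooth_density K (wmarginal a p) (fun i => wmarginal a (q (lift ord0 i))).
Proof.
have [pK qK p0 [C C0 qC] _] := pq; split.
- exact: box_bounded_wmarginal.
- by move=> i; exact: box_bounded_wmarginal.
- exact: wmarginal_ge0.
- have fK i : box_bounded K (fun t => q (lift ord0 i) t ^+ 2 / p t).
    exact: (box_bounded_fisher p0 pK (qK _) C0).
  have bK i : exists B, forall t, wmarginal a (fun t => q (lift ord0 i) t ^+ 2 / p t) t <= B.
    have [_ [B fB] _] := box_bounded_wmarginal a0 (fK i).
    by exists B => t; rewrite (le_trans (ler_norm _)).
  have [B BP] := choice bK.
  exists (\sum_(j < n) `|B j|); first exact: sumr_ge0.
  move=> i t; apply: le_trans (sqr_le_mul_of_affine (wmarginal_ge0 t) (fisher_marginal_affine _ t)) _.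
  rewrite ler_wpM2r ?wmarginal_ge0// (le_trans (BP i t))// (le_trans (ler_norm _))//.
  by rewrite (bigD1 i)//= lerDl sumr_ge0.
- by move=> i t; split; [exact: is_derive_wmarginal|exact: continuous_wmarginal].
Qed.

End step.

End smooth_density.

(** * Tensorisation *)

Section logsob_tensor.
Context {R : realType}.
Local Notation mu := (@lebesgue_measure R).
Local Notation mR := (measurableTypeR R).
Local Notation leb n := (@lebesgue_tuple R n).

Lemma wmean_integrable n K (A : 'I_n -> R) (f : n.-tuple mR -> R) :
  (forall i, 0 <= A i) -> box_bounded K f ->
  (leb n).-integrable setT (EFin \o (fun t => f t * tensor_weight A t)).
Proof. by move=> A0 /(box_bounded_weight A0)/box_bounded_integrable. Qed.

Lemma le_wmean n K K' (A : 'I_n -> R) (f g : n.-tuple mR -> R) :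
  (forall i, 0 <= A i) -> box_bounded K f -> box_bounded K' g ->
  (forall t, f t <= g t) -> wmean A f <= wmean A g.
Proof.
move=> A0 fK gK fg; apply: le_Rintegral => //; [exact: wmean_integrable fK|exact: wmean_integrable gK|].
by move=> t _; rewrite ler_wpM2r ?tensor_weight_ge0.
Qed.

Lemma box_boundedD n K (f g : n.-tuple mR -> R) :
  box_bounded K f -> box_bounded K g -> box_bounded K (fun t => f t + g t).
Proof.
move=> [mf [C fC] fK] [mg [D gD] gK]; split.
- exact: measurable_funD.
- by exists (C + D) => t; rewrite (le_trans (ler_normD _ _))// lerD.
- by move=> t i Ki; rewrite (fK _ i)// (gK _ i)// addr0.
Qed.

Lemma box_boundedZ n K c (f : n.-tuple mR -> R) :
  box_bounded K f -> box_bounded K (fun t => c * f t).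
Proof.
move=> [mf [C fC] fK]; split.
- exact: measurable_funM.
- by exists (`|c| * C) => t; rewrite normrM ler_wpM2l.
- by move=> t i Ki; rewrite (fK _ i)// mulr0.
Qed.

Lemma wmeanD n K (A : 'I_n -> R) (f g : n.-tuple mR -> R) :
  (forall i, 0 <= A i) -> box_bounded K f -> box_bounded K g ->
  wmean A (fun t => f t + g t) = wmean A f + wmean A g.
Proof.
move=> A0 fK gK; rewrite /wmean -RintegralD//; [|exact: wmean_integrable fK|exact: wmean_integrable gK].
by apply: eq_Rintegral => t _; rewrite mulrDl.
Qed.

Lemma wmeanZ n K (A : 'I_n -> R) c (f : n.-tuple mR -> R) :
  (forall i, 0 <= A i) -> box_bounded K f ->
  wmean A (fun t => c * f t) = c * wmean A f.
Proof.
move=> A0 fK; rewrite /wmean -RintegralZl//; last exact: wmean_integrable fK.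
by apply: eq_Rintegral => t _; rewrite mulrA.
Qed.

Lemma logsob_slice n K a s (p : n.+1.-tuple mR -> R) q (t : n.-tuple mR) :
  0 <= a -> 0 < s -> 0 < K -> smooth_density K p q ->
  wmarginal a (fun u => xlnx (p u)) t <=
  xlnx (wmarginal a p t) - (ln (gauss_mass a s) + (1 + a)) * wmarginal a p t +
  (2 * s)^-1 * wmarginal a (fun u => q ord0 u ^+ 2 / p u) t.
Proof.
move=> a0 s0 K0 [[_ _ pK] qK p0 [C C0 qC] dp].
have [dp1 dp2] := dp ord0 (cons_pair (0, t)).
have E (f : n.+1.-tuple mR -> R) :
    (fun y : R => f (set_tnth (cons_pair (0, t)) ord0 y)) = (fun y : R => f (cons_pair (y, t))).
  by apply/funext => y; rewrite set_tnth_cons0.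
apply: (@logsob_line R a s (K + 1) C (fun x => p (cons_pair (x, t)))
  (fun x => q ord0 (cons_pair (x, t)))) => //.
- by rewrite addr_gt0.
- by move=> x; have := dp1 x; rewrite E set_tnth_cons0.
- by move: dp2; rewrite E.
- by move=> x Kx; apply: (pK _ ord0); rewrite tnth_cons_pair0 (lt_le_trans _ Kx)// ltrDl.
Qed.

(** Induction on the dimension: the inequality on the line bounds the entropy of
    each slice by that of its mass, which is the marginal, and the induction
    hypothesis applies to the marginal, whose Fisher information has not grown. *)
Lemma logsob_tensor n K s (A : 'I_n -> R) (p : n.-tuple mR -> R) q :
  (forall i, 0 <= A i) -> 0 < s -> 0 < K -> smooth_density K p q ->
  wmean A (fun t => xlnx (p t)) <=
  xlnx (wmean A p) -
  (\sum_(i < n) (ln (gauss_mass (A i) s) + (1 + A i))) * wmean A p +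
  (2 * s)^-1 * \sum_(i < n) wmean A (fun t => q i t ^+ 2 / p t).
Proof.
move=> + s0 K0; elim: n A p q => [A p q A0 pq|n IH A p q A0 pq].
  rewrite !big_ord0 mul0r mulr0 subr0 addr0.
  (* in dimension 0 the measure is a unit mass at the empty tuple *)
  have E f : wmean A f = f [tuple].
    have W t : tensor_weight A t = 1 by rewrite /tensor_weight big_ord0.
    rewrite /wmean /Rintegral; under eq_integral do rewrite W mulr1.
    rewrite /= integral_dirac//; first by rewrite diracT mul1e.
    move=> _ B mB; rewrite setTI.
    have [H|H] := pselect (B (f [tuple])%:E).
      rewrite (_ : _ @^-1` _ = setT); first exact: measurableT.
      by apply/seteqP; split => // t _; rewrite /= (tuple0 t).
    rewrite (_ : _ @^-1` _ = set0); first exact: measurable0.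
    by apply/seteqP; split => // t; rewrite /= (tuple0 t).
  by rewrite !E.
have [pK qK p0 [C C0 qC] dp] := pq.
have a0 := A0 ord0; pose A' i := A (lift ord0 i); have A'0 i : 0 <= A' i by exact: A0.
have fK i : box_bounded K (fun t => q i t ^+ 2 / p t).
  exact: (box_bounded_fisher p0 pK (qK i) C0).
have PQ := smooth_density_wmarginal a0 pq.
have [PK QK P0 [D D0 QD] _] := PQ.
have FK i : box_bounded K (fun t => wmarginal (A ord0) (q (lift ord0 i)) t ^+ 2 /
    wmarginal (A ord0) p t).
  exact: (box_bounded_fisher P0 PK (QK i) D0).
have {}IH := IH A' _ _ A'0 PQ.
rewrite !(wmean_wmarginal A0 (box_bounded_xlnx p0 pK)) !(wmean_wmarginal A0 pK) -/A'.
rewrite big_ord_recl [X in _ + _ * X]big_ord_recl (wmean_wmarginal A0 (fK ord0)) -/A'.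
have F i : wmean A' (fun t => wmarginal (A ord0) (q (lift ord0 i)) t ^+ 2 /
    wmarginal (A ord0) p t) <= wmean A (fun t => q (lift ord0 i) t ^+ 2 / p t).
  rewrite (wmean_wmarginal A0 (fK _)) -/A'.
  apply: (le_wmean A'0 (FK i) (box_bounded_wmarginal a0 (fK _))) => t.
  exact: (fisher_marginal a0 pq).
have {F} : \sum_(i < n) wmean A' (fun t => wmarginal (A ord0) (q (lift ord0 i)) t ^+ 2 /
    wmarginal (A ord0) p t) <= \sum_(i < n) wmean A (fun t => q (lift ord0 i) t ^+ 2 / p t).
  by apply: ler_sum => i _; exact: F.
have s20 : 0 < (2 * s)^-1 by rewrite invr_gt0 mulr_gt0.
rewrite -(ler_pM2l s20) => F.
have XK := box_bounded_xlnx P0 PK.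
have ZK := box_boundedZ (- (ln (gauss_mass (A ord0) s) + (1 + A ord0))) PK.
have GK := box_boundedZ (2 * s)^-1 (box_bounded_wmarginal a0 (fK ord0)).
have S : wmean A' (wmarginal (A ord0) (fun t => xlnx (p t))) <=
    wmean A' (fun t => xlnx (wmarginal (A ord0) p t)) -
    (ln (gauss_mass (A ord0) s) + (1 + A ord0)) * wmean A' (wmarginal (A ord0) p) +
    (2 * s)^-1 * wmean A' (wmarginal (A ord0) (fun u => q ord0 u ^+ 2 / p u)).
  rewrite -mulNr -(wmeanZ _ A'0 PK) -(wmeanZ _ A'0 (box_bounded_wmarginal a0 (fK ord0))).
  rewrite -(wmeanD A'0 XK ZK) -(wmeanD A'0 (box_boundedD XK ZK) GK).
  apply: (le_wmean A'0 (box_bounded_wmarginal a0 (box_bounded_xlnx p0 pK))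
    (box_boundedD (box_boundedD XK ZK) GK)) => t.
  by rewrite mulNr; exact: logsob_slice pq.
move: S IH F; rewrite mulrDl mulrDr; lra.
Qed.

End logsob_tensor.

(** * Measurability and slices of functions of row vectors *)

Section row_vectors.
Context {R : realType} {n : nat}.
Local Notation mR := (measurableTypeR R).
Local Notation mu := (@lebesgue_rV R n).
Implicit Types (x : 'rV[R]_n) (f u : 'rV[R]_n -> R).

Lemma measurable_coord i : measurable_fun setT (fun x : 'rV[R]_n => x 0 i : mR).
Proof.
move=> _ Y mY; rewrite setTI; apply: sub_sigma_algebra => /=.
rewrite -bigcup_seq/=; exists i => /=; first by rewrite mem_index_enum.
by exists Y => //; rewrite setTI.
Qed.

Lemma ler_coord_norm x i : `|x 0 i| <= `|x|.
Proof.
rewrite [leRHS]/Num.norm /= mx_normrE.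
by apply: (le_bigmax _ (fun ij => `|x ij.1 ij.2|) (0, i)).
Qed.

(** The measurable sets are generated by the coordinates, so an open set has to
    be written as a countable union of boxes: those with rational centre and
    side [2 / (k + 1)] that it contains. *)
Lemma open_measurable_rV (O : set 'rV[R]_n) : open O -> measurable O.
Proof.
move=> oO.
pose box (z : 'rV[rat]_n * nat) : set 'rV[R]_n :=
  [set x | forall i, `]ratr (z.1 0 i) - z.2.+1%:R^-1, ratr (z.1 0 i) + z.2.+1%:R^-1[%classic (x 0 i)].
pose F z := if asbool (box z `<=` O) then box z else set0.
have mbox z : measurable (box z).
  rewrite (_ : box z = \bigcap_(i in [set: 'I_n]) ((fun x : 'rV[R]_n => x 0 i : mR) @^-1`
      `]ratr (z.1 0 i) - z.2.+1%:R^-1, ratr (z.1 0 i) + z.2.+1%:R^-1[%classic)).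
    apply: fin_bigcap_measurable => // i _.
    by rewrite -[X in measurable X]setTI; apply: measurable_coord.
  by apply/seteqP; split => [t h i _|t h i]; exact: h.
rewrite (_ : O = \bigcup_z F z).
  apply: countable_bigcupT_measurable => //.
  by move=> z; rewrite /F; case: ifP.
apply/seteqP; split => [x Ox|x [z _]]; last first.
  by rewrite /F; case: asboolP => // zO; exact: zO.
have /nbhs_ballP[e /= e0 eO] : nbhs x O by exact: open_nbhs_nbhs.
have [k ke] : exists k : nat, k.+1%:R^-1 < e / 2.
  have e20 : 0 < e / 2 by rewrite divr_gt0.
  have [k _ /(_ k (leqnn _))] := near_infty_natSinv_lt (PosNum e20).
  by exists k.
have q i : exists q : rat, `|x 0 i - ratr q| < k.+1%:R^-1.
  have : x 0 i - k.+1%:R^-1 < x 0 i + k.+1%:R^-1 by rewrite ltrD2l gtrN// invr_gt0 ltr0n.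
  move=> /rat_in_itvoo[r]; rewrite in_itv/= => /andP[r1 r2].
  by exists r; rewrite distrC ltr_distl r1 r2.
have [r rP] := choice q.
exists (\row_i r i, k) => //; rewrite /F; case: asboolP => [_|].
  by move=> i /=; rewrite in_itv/= mxE; have := rP i; rewrite ltr_distl.
move=> H; exfalso; apply: H => y yB; apply: eO; split=> // j i; rewrite (ord1 j) /ball/=.
have := yB i; rewrite /= in_itv/= mxE -ltr_distl distrC => h.
apply: le_lt_trans (ler_distD (ratr (r i)) _ _) _.
by rewrite (splitr e) ltrD// (lt_trans _ ke)// rP.
Qed.

Lemma continuous_measurable_rV f : continuous f -> measurable_fun setT f.
Proof.
move=> /continuousP cf; apply: (measurability _ (RGenOpens.measurableE R)).
move=> _ [_ [a [b ->] <-]]; rewrite setTI; apply: open_measurable_rV.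
exact/cf/interval_open.
Qed.

Lemma rV_of_set_tnth (t : n.-tuple mR) i (y z : R) :
  rV_of_tuple (set_tnth t i (z + y)) = z *: 'e_i + rV_of_tuple (set_tnth t i y).
Proof.
apply/rowP => j; rewrite !mxE !tnth_mktuple eqxx/=.
by case: eqVneq => [_|_]; rewrite ?mulr1 ?mulr0 ?add0r.
Qed.

(** Links the gradient of a function of row vectors to the one-variable
    derivatives required of a smooth density on tuples. *)
Lemma is_derive_rV_slice u (t : n.-tuple mR) i (y : R) :
  differentiable u (rV_of_tuple (set_tnth t i y)) ->
  is_derive y (1:R) (fun z : R => u (rV_of_tuple (set_tnth t i z)))
    (grad u (rV_of_tuple (set_tnth t i y)) 0 i).
Proof.
move=> du; rewrite mxE.
have E : (fun h : R => h^-1 *: (((fun z : R => u (rV_of_tuple (set_tnth t i z))) \o shift y) (h *: 1) -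
      u (rV_of_tuple (set_tnth t i y)))) =
    (fun h : R => h^-1 *: ((u \o shift (rV_of_tuple (set_tnth t i y))) (h *: 'e_i) -
      u (rV_of_tuple (set_tnth t i y)))).
  apply/funext => h /=; congr (_ *: (u _ - _)).
  by rewrite [h%:A]mulr1 rV_of_set_tnth.
have dv : derivable u (rV_of_tuple (set_tnth t i y)) 'e_i by exact: diff_derivable.
by apply: DeriveDef; rewrite /derivable /derive E.
Qed.

Lemma continuous_rV_slice (t : n.-tuple mR) i :
  continuous (fun y : R => rV_of_tuple (set_tnth t i y)).
Proof.
have -> : (fun y : R => rV_of_tuple (set_tnth t i y)) =
    (fun y : R => y *: 'e_i + rV_of_tuple (set_tnth t i 0)).
  by apply/funext => y; rewrite -rV_of_set_tnth addr0.
move=> y; apply: cvgD; last exact: cvg_cst.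
exact: scalel_continuous.
Qed.

(** Outside the support both the function and its gradient vanish, since the
    complement of the support is open. *)
Lemma Cc1_bounded u : Cc1 u -> exists K, [/\ 0 < K, forall x, `|u x| <= K,
    forall x i, `|grad u x 0 i| <= K &
    forall x i, K < `|x 0 i| -> u x = 0 /\ grad u x = 0].
Proof.
move=> [du cg cS]; set S := closure _ in cS.
have cu : continuous u by move=> x; exact: differentiable_continuous.
have uS x : ~ S x -> u x = 0 /\ grad u x = 0.
  move=> Sx; have : nbhs x (~` S).
    by apply: open_nbhs_nbhs; split=> //; apply: closed_openC; exact: closed_closure.
  move=> nx; have nu : \forall y \near x, u y = cst 0 y.
    apply: filterS nx => y Sy; apply/eqP/negPn/negP => uy; apply: Sy.
    exact: subset_closure.
  split; first exact: (nbhs_singleton nu).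
  by apply/rowP => i; rewrite !mxE (near_eq_derive _ nu) derive_cst.
have [M1 [_ HM1]] := compact_bounded cS.
have [M2 [_ HM2]] := compact_bounded (continuous_compact (continuous_subspaceT cu) cS).
have [M3 [_ HM3]] := compact_bounded (continuous_compact (continuous_subspaceT cg) cS).
pose K := 1 + `|M1| + `|M2| + `|M3|.
have K1 : M1 < K by have := ler_norm M1; have := normr_ge0 M2; have := normr_ge0 M3; rewrite /K; lra.
have K2 : M2 < K by have := ler_norm M2; have := normr_ge0 M1; have := normr_ge0 M3; rewrite /K; lra.
have K3 : M3 < K by have := ler_norm M3; have := normr_ge0 M2; have := normr_ge0 M1; rewrite /K; lra.
have K0 : 0 < K by have := normr_ge0 M1; have := normr_ge0 M2; have := normr_ge0 M3; rewrite /K; lra.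
exists K; split => //.
- move=> x; have [Sx|/uS[-> _]] := pselect (S x); last by rewrite normr0 ltW.
  by apply: (HM2 _ K2); exists x.
- move=> x i; have [Sx|/uS[_ ->]] := pselect (S x); last by rewrite mxE normr0 ltW.
  by apply: le_trans (ler_coord_norm _ _) _; apply: (HM3 _ K3); exists x.
- move=> x i Kx; apply: uS => Sx; have := HM1 _ K1 x Sx.
  by apply/negP; rewrite -ltNge (lt_le_trans Kx)// ler_coord_norm.
Qed.

End row_vectors.

(** * Truncation of small amplitudes *)

Section soft_truncation.
Context {R : realType}.
Implicit Types e v : R.

(** The square of [h v = sqrt (v^2 + e^2) - e]. It behaves like [v^4 / (4 e^2)]
    near 0, which tames the logarithm there, and it increases to [v^2] as [e]
    tends to 0. *)
Definition soft_sq e v : R := (Num.sqrt (v ^+ 2 + e ^+ 2) - e) ^+ 2.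

Definition dsoft_sq e v : R :=
  2 * (Num.sqrt (v ^+ 2 + e ^+ 2) - e) * (v / Num.sqrt (v ^+ 2 + e ^+ 2)).

Lemma soft_sq_arg_gt0 e v : 0 < e -> 0 < v ^+ 2 + e ^+ 2.
Proof. by move=> e0; rewrite ltr_wpDl ?sqr_ge0 ?exprn_gt0. Qed.

Lemma soft_sqrt_ge e v : 0 < e -> e <= Num.sqrt (v ^+ 2 + e ^+ 2).
Proof.
move=> e0; rewrite -[leLHS]ger0_norm ?(ltW e0)// -sqrtr_sqr ler_sqrt.
  by rewrite lerDr sqr_ge0.
exact/ltW/soft_sq_arg_gt0.
Qed.

Lemma soft_sqrt_le e v : 0 < e -> Num.sqrt (v ^+ 2 + e ^+ 2) - e <= `|v|.
Proof.
move=> e0; rewrite lerBlDr -[leRHS]ger0_norm ?addr_ge0 ?(ltW e0)//.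
rewrite -sqrtr_sqr ler_sqrt ?sqr_ge0// sqrrD real_normK ?num_real//.
by rewrite lerD2r lerDl mulrn_wge0// mulr_ge0// ltW.
Qed.

Lemma soft_sq_ge0 e v : 0 <= soft_sq e v. Proof. exact: sqr_ge0. Qed.

Lemma soft_sq_le e v : 0 < e -> soft_sq e v <= v ^+ 2.
Proof.
move=> e0; rewrite /soft_sq -[leRHS]real_normK ?num_real//.
by rewrite lerXn2r ?nnegrE ?subr_ge0 ?soft_sqrt_ge ?soft_sqrt_le.
Qed.

Lemma soft_sq0 e : 0 < e -> soft_sq e 0 = 0.
Proof.
move=> e0; apply/eqP; rewrite eq_le soft_sq_ge0 andbT.
by rewrite (le_trans (soft_sq_le _ e0))// expr0n.
Qed.

Lemma is_derive_soft_sq e v : 0 < e -> is_derive v (1:R) (soft_sq e) (dsoft_sq e v).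
Proof.
move=> e0; have a0 := soft_sq_arg_gt0 v e0.
have d1 : is_derive v (1:R) (fun v : R => v ^+ 2 + e ^+ 2) (2 * v).
  have -> : (fun v : R => v ^+ 2 + e ^+ 2) = (id ^+ 2) + cst (e ^+ 2) by [].
  by apply: is_derive_eq; rewrite addr0 expr1 /GRing.scale/= mulr1.
have d2 := @is_derive1_comp R Num.sqrt (fun v : R => v ^+ 2 + e ^+ 2) v _ _ (is_derive1_sqrt a0) d1.
have -> : soft_sq e = ((Num.sqrt \o (fun v : R => v ^+ 2 + e ^+ 2)) - cst e) ^+ 2 by [].
apply: is_derive_eq; rewrite expr1 subr0 /dsoft_sq /GRing.scale/=.
have -> : ((Num.sqrt \o (fun v : R => v ^+ 2 + e ^+ 2)) - cst e) v =
  Num.sqrt (v ^+ 2 + e ^+ 2) - e by [].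
by field; rewrite gt_eqF// sqrtr_gt0.
Qed.

(** This is [(2 h h')^2 <= 4 h^2], that is [|h'| <= 1]. *)
Lemma dsoft_sq_sqr_le e v : 0 < e -> dsoft_sq e v ^+ 2 <= 4 * soft_sq e v.
Proof.
move=> e0; have a0 := soft_sq_arg_gt0 v e0.
have v1 : (v / Num.sqrt (v ^+ 2 + e ^+ 2)) ^+ 2 <= 1.
  rewrite expr_div_n sqr_sqrtr ?(ltW a0)// ler_pdivrMr// mul1r lerDl sqr_ge0//.
rewrite /dsoft_sq /soft_sq exprMn.
rewrite (_ : (2 * _) ^+ 2 = 4 * (Num.sqrt (v ^+ 2 + e ^+ 2) - e) ^+ 2); last by ring.
by rewrite ler_piMr// mulr_ge0 ?sqr_ge0.
Qed.

Lemma continuous_dsoft_sq e : 0 < e -> continuous (dsoft_sq e).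
Proof.
move=> e0 v.
have cs : {for v, continuous (fun v : R => Num.sqrt (v ^+ 2 + e ^+ 2))}.
  apply: (@continuous_comp _ _ _ (fun v : R => v ^+ 2 + e ^+ 2) Num.sqrt).
    by apply: cvgD; [exact: exprn_continuous|exact: cvg_cst].
  exact: sqrt_continuous.
apply: cvgM.
  apply: cvgM; first exact: cvg_cst.
  by apply: cvgB; [exact: cs|exact: cvg_cst].
apply: cvgM; first exact: cvg_id.
by apply: cvgV; [rewrite gt_eqF// sqrtr_gt0 soft_sq_arg_gt0|exact: cs].
Qed.

Lemma continuous_soft_sq e : 0 < e -> continuous (soft_sq e).
Proof. by move=> e0 v; apply: is_derive_continuous (is_derive_soft_sq v e0). Qed.

(** From [ln h >= 1 - 1 / h] one gets [h^2 ln h^2 >= - 2 h], and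
    [v^2 = h^2 + 2 e h >= 2 e h]. The lower bound is integrable for a square
    integrable [v], whereas [v^2 ln v^2] has no such bound. *)
Lemma xlnx_soft_sq_ge e v : 0 < e -> - (v ^+ 2 / e) <= xlnx (soft_sq e v).
Proof.
move=> e0; have := soft_sqrt_ge v e0; rewrite -subr_ge0 /soft_sq.
have : (Num.sqrt (v ^+ 2 + e ^+ 2)) ^+ 2 = v ^+ 2 + e ^+ 2.
  by rewrite sqr_sqrtr// ltW// soft_sq_arg_gt0.
set w := Num.sqrt _ => w2.
rewrite le_eqVlt => /predU1P[<-|h0].
  by rewrite /xlnx expr0n mul0r oppr_le0 divr_ge0 ?sqr_ge0// ltW.
set h := w - e in h0 *.
rewrite /xlnx lnXn// -mulr_natr.
have l : 1 - h^-1 <= ln h.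
  have : ln h^-1 <= h^-1 - 1 by apply: ln_le_subr1; rewrite invr_gt0.
  by rewrite lnV ?posrE//; lra.
have l2 : h ^+ 2 * (1 - h^-1) <= h ^+ 2 * ln h by rewrite ler_wpM2l ?sqr_ge0.
have l3 : h ^+ 2 * (1 - h^-1) = h ^+ 2 - h by field; rewrite gt_eqF.
have l4 : 2 * h <= v ^+ 2 / e.
  rewrite ler_pdivlMr//; have : v ^+ 2 = h ^+ 2 + 2 * e * h.
    by rewrite /h -[v ^+ 2](addrK (e ^+ 2)) -w2; ring.
  by move=> ->; have := sqr_ge0 h; lra.
have := sqr_ge0 h; lra.
Qed.

End soft_truncation.

(** * The inequality for compactly supported functions *)

Section logsob_Cc1.
Context {R : realType} {n : nat}.
Local Notation mR := (measurableTypeR R).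
Local Notation leb := (@lebesgue_tuple R n).
Local Notation mu := (@lebesgue_rV R n).
Implicit Types (x A : 'rV[R]_n) (f u : 'rV[R]_n -> R).

Definition orthant_weight A x : R := \prod_(i < n) half_weight (A 0 i) (x 0 i).

Lemma orthant_weight_ge0 A x : 0 <= orthant_weight A x.
Proof. by apply: prodr_ge0 => i _; exact: half_weight_ge0. Qed.

Lemma measurable_orthant_weight A : measurable_fun setT (orthant_weight A).
Proof.
apply: measurable_prod => i _.
exact: (measurableT_comp (@measurable_half_weight R (A 0 i)) (measurable_coord i)).
Qed.

Lemma orthant_weight_tuple A (t : n.-tuple mR) :
  orthant_weight A (rV_of_tuple t) = tensor_weight (fun i => A 0 i) t.
Proof. by apply: eq_bigr => i _; rewrite mxE. Qed.

Lemma orthant_weightE A x : orthant_weight A x =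
  if x \in orthant A then monomial A x else 0.
Proof.
case: ifPn => [|].
  rewrite inE /orthant/= => xA; apply: eq_bigr => i _; rewrite /half_weight.
  case: ifPn => // /andP[Ai]; by rewrite leNgt (xA i Ai).
rewrite notin_setE /orthant/= => /existsNP[i] /not_implyP[Ai /negP xi].
by rewrite /orthant_weight (bigD1 i)//= /half_weight Ai leNgt xi mul0r.
Qed.

Lemma measurable_monomial A : measurable_fun setT (monomial A).
Proof.
apply: measurable_prod => i _.
exact: (measurableT_comp (@measurable_normr_powR R (A 0 i)) (measurable_coord i)).
Qed.

Lemma wintE A (h : 'rV[R]_n -> R) :
  wint A h = (\int[mu]_x (h x * orthant_weight A x)%:E)%E.
Proof.
rewrite /wint integral_mkcond; apply: eq_integral => x _.
by rewrite patchE orthant_weightE; case: ifP => // _; rewrite mulr0.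
Qed.

Definition rmean A (h : 'rV[R]_n -> R) : R := \int[mu]_x (h x * orthant_weight A x).

(** Transfers integrals over row vectors to integrals over tuples, on which the
    tensorised inequality is stated. *)
Lemma rmean_wmean A (h : 'rV[R]_n -> R) K : (forall i, 0 <= A 0 i) ->
  measurable_fun setT h -> box_bounded K (h \o @rV_of_tuple R n) ->
  mu.-integrable setT (EFin \o (fun x => h x * orthant_weight A x)) /\
  rmean A h = wmean (fun i => A 0 i) (h \o @rV_of_tuple R n).
Proof.
move=> A0 mh hK.
have ih : leb.-integrable (@rV_of_tuple R n @^-1` setT)
    ((EFin \o (fun x => h x * orthant_weight A x)) \o @rV_of_tuple R n).
  rewrite preimage_setT (_ : _ \o _ = EFin \o (fun t => (h \o @rV_of_tuple R n) t *
    tensor_weight (fun i => A 0 i) t)); first exact: wmean_integrable hK.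
  by apply/funext => t; rewrite /= orthant_weight_tuple.
have mf : measurable_fun setT (EFin \o (fun x => h x * orthant_weight A x)).
  by apply/measurable_EFinP; apply: measurable_funM => //; exact: measurable_orthant_weight.
split.
  exact: (integrable_pushforward (@measurable_rV_of_tuple R n) mf ih measurableT).
rewrite /rmean /Rintegral.
rewrite (_ : mu = pushforward leb (@rV_of_tuple R n) :> (_ -> _))//.
have := integral_pushforward (@measurable_rV_of_tuple R n) mf ih measurableT.
rewrite preimage_setT => ->.
congr fine; apply: eq_integral => t _ /=.
by rewrite orthant_weight_tuple.
Qed.

Definition log_mass A (s : R) : R := \sum_(i < n) ln (gauss_mass (A 0 i) s).

Lemma Cc1_continuous u : Cc1 u -> continuous u.
Proof. by move=> [du _ _] x; exact: differentiable_continuous. Qed.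

Lemma Cc1_grad_continuous u i : Cc1 u -> continuous (fun x => grad u x 0 i).
Proof.
move=> [_ cg _] x.
apply: (@continuous_comp _ _ _ (grad u) (fun y : 'rV[R]_n => y 0 i)); first exact: cg.
exact: coord_continuous.
Qed.

Lemma box_bounded_rV K C (h : 'rV[R]_n -> R) : measurable_fun setT h ->
  (forall x, `|h x| <= C) -> (forall x i, K < `|x 0 i| -> h x = 0) ->
  box_bounded K (h \o @rV_of_tuple R n).
Proof.
move=> mh hC hK; split.
- exact: (measurableT_comp mh (@measurable_rV_of_tuple R n)).
- by exists C => t; exact: hC.
- by move=> t i Ki; apply: (hK _ i); rewrite mxE.
Qed.

Lemma Cc1_smooth_density u e : Cc1 u -> 0 < e -> exists K, [/\ 0 < K,
  smooth_density K ((fun x => soft_sq e (u x)) \o @rV_of_tuple R n)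
    (fun i => (fun x => dsoft_sq e (u x) * grad u x 0 i) \o @rV_of_tuple R n),
  box_bounded K ((fun x => u x ^+ 2) \o @rV_of_tuple R n) &
  forall i, box_bounded K ((fun x => grad u x 0 i ^+ 2) \o @rV_of_tuple R n)].
Proof.
move=> cu e0; have [K [K0 uK gK sK]] := Cc1_bounded cu.
have mu_ : measurable_fun setT u by apply: continuous_measurable_rV; exact: Cc1_continuous.
have mg i : measurable_fun setT (fun x => grad u x 0 i).
  by apply: continuous_measurable_rV; exact: Cc1_grad_continuous.
have uK2 x : u x ^+ 2 <= K ^+ 2.
  by rewrite -[leLHS]real_normK ?num_real// lerXn2r ?nnegrE// ltW.
have gK2 i x : grad u x 0 i ^+ 2 <= K ^+ 2.
  by rewrite -[leLHS]real_normK ?num_real// lerXn2r ?nnegrE// ltW.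
have mS (F : R -> R) : continuous F -> measurable_fun setT (fun x => F (u x)).
  by move=> cF; exact: (measurableT_comp (continuous_measurable_fun cF) mu_).
have dK x : `|dsoft_sq e (u x)| <= 2 * K.
  rewrite -ler_sqr ?nnegrE ?mulr_ge0 ?(ltW K0)// real_normK ?num_real//.
  rewrite (le_trans (dsoft_sq_sqr_le _ e0))// exprMn -natrX ler_pM2l//.
  by rewrite (le_trans (soft_sq_le _ e0)).
have pK : box_bounded K ((fun x => soft_sq e (u x)) \o @rV_of_tuple R n).
  apply: (@box_bounded_rV _ (K ^+ 2)).
  - by apply: mS; exact: continuous_soft_sq.
  - by move=> x; rewrite ger0_norm ?soft_sq_ge0// (le_trans (soft_sq_le _ e0)).
  - by move=> x i /sK[-> _]; rewrite soft_sq0.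
exists K; split => //; last 2 first.
- apply: (@box_bounded_rV _ (K ^+ 2)).
  - exact: measurable_funX.
  - by move=> x; rewrite ger0_norm ?sqr_ge0.
  - by move=> x i /sK[-> _]; rewrite expr0n.
- move=> i; apply: (@box_bounded_rV _ (K ^+ 2)).
  - exact: measurable_funX.
  - by move=> x; rewrite ger0_norm ?sqr_ge0.
  - by move=> x j /sK[_ ->]; rewrite mxE expr0n.
split => //.
- move=> i; apply: (@box_bounded_rV _ (2 * K * K)).
  - by apply: measurable_funM => //; apply: mS; exact: continuous_dsoft_sq.
  - by move=> x; rewrite normrM ler_pM.
  - by move=> x j /sK[_ ->]; rewrite mxE mulr0.
- by move=> t; exact: soft_sq_ge0.
- exists (4 * K ^+ 2); first by rewrite mulr_ge0 ?sqr_ge0.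
  move=> i t /=; rewrite exprMn [leRHS]mulrAC ler_pM ?sqr_ge0//; exact: dsoft_sq_sqr_le.
- move=> i t; have [du _ _] := cu; split => [y|y].
    have dy := is_derive_rV_slice (du (rV_of_tuple (set_tnth t i y))).
    exact: (@is_derive1_comp R (soft_sq e) _ y _ _ (is_derive_soft_sq _ e0) dy).
  rewrite /=; apply: cvgM.
    apply: (@continuous_comp _ _ _ (fun y : R => u (rV_of_tuple (set_tnth t i y))) (dsoft_sq e)).
      apply: (@continuous_comp _ _ _ (fun y : R => rV_of_tuple (set_tnth t i y)) u).
        exact: continuous_rV_slice.
      exact: Cc1_continuous.
    exact: continuous_dsoft_sq.
  apply: (@continuous_comp _ _ _ (fun y : R => rV_of_tuple (set_tnth t i y)) (fun x => grad u x 0 i)).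
    exact: continuous_rV_slice.
  exact: Cc1_grad_continuous.
Qed.

Lemma rmeanD A (f h : 'rV[R]_n -> R) :
  mu.-integrable setT (EFin \o (fun x => f x * orthant_weight A x)) ->
  mu.-integrable setT (EFin \o (fun x => h x * orthant_weight A x)) ->
  rmean A (fun x => f x + h x) = rmean A f + rmean A h.
Proof.
move=> fi hi; rewrite /rmean -RintegralD//.
by apply: eq_Rintegral => x _; rewrite mulrDl.
Qed.

Lemma integrable_weightD A (f h : 'rV[R]_n -> R) :
  mu.-integrable setT (EFin \o (fun x => f x * orthant_weight A x)) ->
  mu.-integrable setT (EFin \o (fun x => h x * orthant_weight A x)) ->
  mu.-integrable setT (EFin \o (fun x => (f x + h x) * orthant_weight A x)).
Proof.
move=> fi hi; have := @integrableD _ _ R mu setT measurableT _ _ fi hi.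
by apply: eq_integrable => // x _; rewrite /= mulrDl.
Qed.

Lemma rmeanZ A c (f : 'rV[R]_n -> R) :
  mu.-integrable setT (EFin \o (fun x => f x * orthant_weight A x)) ->
  rmean A (fun x => c * f x) = c * rmean A f.
Proof.
move=> fi; rewrite /rmean -RintegralZl//.
by apply: eq_Rintegral => x _; rewrite mulrA.
Qed.

Lemma integrable_weightZ A c (f : 'rV[R]_n -> R) :
  mu.-integrable setT (EFin \o (fun x => f x * orthant_weight A x)) ->
  mu.-integrable setT (EFin \o (fun x => (c * f x) * orthant_weight A x)).
Proof.
move=> fi; have := @integrableZl _ _ R mu setT measurableT c _ fi.
by apply: eq_integrable => // x _; rewrite /= -EFinM mulrA.
Qed.

Lemma wint_rmean A (f : 'rV[R]_n -> R) :
  mu.-integrable setT (EFin \o (fun x => f x * orthant_weight A x)) ->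
  wint A f = (rmean A f)%:E.
Proof.
by move=> fi; rewrite wintE /rmean /Rintegral fineK//; exact: integrable_fin_num.
Qed.

Lemma Cc1_integrable A e u : (forall i, 0 <= A 0 i) -> 0 < e -> Cc1 u ->
  [/\ mu.-integrable setT (EFin \o (fun x => xlnx (soft_sq e (u x)) * orthant_weight A x)),
      mu.-integrable setT (EFin \o (fun x => soft_sq e (u x) * orthant_weight A x)),
      mu.-integrable setT (EFin \o (fun x => u x ^+ 2 * orthant_weight A x)) &
      mu.-integrable setT (EFin \o (fun x => sqnorm (grad u x) * orthant_weight A x))].
Proof.
move=> A0 e0 cu; have [K [K0 [pK qK p0 _ _] uK gK]] := Cc1_smooth_density cu e0.
have mu_ : measurable_fun setT u by apply: continuous_measurable_rV; exact: Cc1_continuous.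
have mg i : measurable_fun setT (fun x => grad u x 0 i).
  by apply: continuous_measurable_rV; exact: Cc1_grad_continuous.
have mS : measurable_fun setT (fun x => soft_sq e (u x)).
  exact: (measurableT_comp (continuous_measurable_fun (continuous_soft_sq e0)) mu_).
have mX : measurable_fun setT (fun x => xlnx (soft_sq e (u x))).
  exact: (measurableT_comp (@measurable_xlnx R) mS).
split.
- by have [] := rmean_wmean A0 mX (box_bounded_xlnx p0 pK).
- by have [] := rmean_wmean A0 mS pK.
- by have [] := rmean_wmean A0 (measurable_funX 2 mu_) uK.
- have ig i : mu.-integrable setT (EFin \o (fun x => grad u x 0 i ^+ 2 * orthant_weight A x)).
    by have [] := rmean_wmean A0 (measurable_funX 2 (mg i)) (gK i).
  have := @integrable_sum _ _ R mu setT measurableT _ (index_enum 'I_n) xpredT _ (fun i _ => ig i).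
  apply: eq_integrable => // x _.
  by rewrite /= sumEFin /sqnorm mulr_suml.
Qed.

(** The tensorised inequality for the density [soft_sq e u], whose Fisher
    information is at most [4 |grad u|^2]. *)
Lemma logsob_Cc1 A e s u : (forall i, 0 <= A 0 i) -> 0 < e -> 0 < s -> Cc1 u ->
  rmean A (fun x => xlnx (soft_sq e (u x))) <=
  xlnx (rmean A (fun x => soft_sq e (u x))) -
  (log_mass A s + hdim A) * rmean A (fun x => soft_sq e (u x)) +
  2 / s * rmean A (fun x => sqnorm (grad u x)).
Proof.
move=> A0 e0 s0 cu; have [K [K0 pq uK gK]] := Cc1_smooth_density cu e0.
have [pK qK p0 [C C0 qC] _] := pq.
have mu_ : measurable_fun setT u by apply: continuous_measurable_rV; exact: Cc1_continuous.
have mg i : measurable_fun setT (fun x => grad u x 0 i).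
  by apply: continuous_measurable_rV; exact: Cc1_grad_continuous.
have mS : measurable_fun setT (fun x => soft_sq e (u x)).
  exact: (measurableT_comp (continuous_measurable_fun (continuous_soft_sq e0)) mu_).
have mX : measurable_fun setT (fun x => xlnx (soft_sq e (u x))).
  exact: (measurableT_comp (@measurable_xlnx R) mS).
have [_ ->] := rmean_wmean A0 mX (box_bounded_xlnx p0 pK).
have [_ ->] := rmean_wmean A0 mS pK.
apply: le_trans (logsob_tensor A0 s0 K0 pq) _.
rewrite big_split/= -/(log_mass A s) big_split/= sumr_const card_ord -/(hdim A).
rewrite lerD2l.
have -> : rmean A (fun x => sqnorm (grad u x)) =
    \sum_(i < n) wmean (fun i => A 0 i) ((fun x => grad u x 0 i ^+ 2) \o @rV_of_tuple R n).
  have E i : wmean (fun i => A 0 i) ((fun x => grad u x 0 i ^+ 2) \o @rV_of_tuple R n) =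
      rmean A (fun x => grad u x 0 i ^+ 2).
    by have [_ ->] := rmean_wmean A0 (measurable_funX 2 (mg i)) (gK i).
  under eq_bigr do rewrite E.
  have ig i : mu.-integrable setT (EFin \o (fun x => grad u x 0 i ^+ 2 * orthant_weight A x)).
    by have [] := rmean_wmean A0 (measurable_funX 2 (mg i)) (gK i).
  apply: EFin_inj; rewrite -sumEFin.
  under [in RHS]eq_bigr do rewrite -(wint_rmean (ig _)) wintE.
  have [_ _ _ ig2] := Cc1_integrable A0 e0 cu.
  rewrite -(wint_rmean ig2) wintE -integral_sum//.
  by apply: eq_integral => x _; rewrite sumEFin /sqnorm mulr_suml.
rewrite !mulr_sumr; apply: ler_sum => i _.
have fK : box_bounded K (fun t => (dsoft_sq e (u (rV_of_tuple t)) * grad u (rV_of_tuple t) 0 i) ^+ 2 /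
    soft_sq e (u (rV_of_tuple t))).
  exact: (box_bounded_fisher p0 pK (qK i) C0).
rewrite (_ : 2 / s = (2 * s)^-1 * 4); last by field; rewrite gt_eqF.
rewrite -mulrA ler_pM2l ?invr_gt0 ?mulr_gt0//.
rewrite -(wmeanZ _ A0 (gK i)).
apply: (le_wmean A0 fK (box_boundedZ 4 (gK i))) => t /=.
set v := u _; have [z|z] := eqVneq (soft_sq e v) 0.
  by rewrite z invr0 mulr0 mulr_ge0 ?sqr_ge0.
have zp : 0 < soft_sq e v by rewrite lt_def z soft_sq_ge0.
by rewrite ler_pdivrMr// exprMn [leRHS]mulrAC ler_wpM2r ?sqr_ge0// dsoft_sq_sqr_le.
Qed.

End logsob_Cc1.

(** * Two limit theorems *)

Section limits.
Context d (T : measurableType d) (R : realType) (mu : {measure set T -> \bar R}).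

(** Fatou's lemma with limits holding almost everywhere and asymptotic upper
    bounds [M + e] on the integrals. *)
Lemma fatou_ae_le (F_ : nat -> T -> \bar R) (F : T -> \bar R) (M : R) :
  (forall k, measurable_fun setT (F_ k)) -> (forall k x, 0 <= F_ k x)%E ->
  measurable_fun setT F -> (forall x, 0 <= F x)%E ->
  {ae mu, forall x, F_ k x @[k --> \oo] --> F x} ->
  (forall e : R, 0 < e -> \forall k \near \oo, (\int[mu]_x F_ k x <= (M + e)%:E)%E) ->
  (\int[mu]_x F x <= M%:E)%E.
Proof.
move=> mF_ F_0 mF F0 [N [mN N0 cF]] FM.
rewrite (ge0_negligible_integral _ _ _ _ N0)//.
have mD : measurable (setT `\` N) by exact: measurableD.
have E : (\int[mu]_(x in setT `\` N) F x =
    \int[mu]_(x in setT `\` N) limn_einf (F_^~ x))%E.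
  apply: eq_integral => x; rewrite inE => -[_ Nx].
  have cx : F_ k x @[k --> \oo] --> F x.
    by apply: contrapT => H; apply: Nx; exact: cF.
  by have [-> _] := cvg_limn_einf_sup cx.
rewrite {}E; apply: le_trans (fatou mu mD _ _) _.
- by move=> k; apply: measurable_funTS.
- by move=> k x _; exact: F_0.
apply/lee_addgt0Pr => e e0; rewrite -EFinD limn_einf_lim.
apply: lime_le; first exact: is_cvg_einfs.
apply: filterS (FM e e0) => k; apply: le_trans.
apply: le_trans (_ : _ <= \int[mu]_(x in setT `\` N) F_ k x)%E _.
  by apply: ereal_inf_lbound; exists k => //=.
by apply: ge0_subset_integral => //; exact: mF_.
Qed.

(** The sum of the functions has a finite integral, so it is finite almost
    everywhere and its general term tends to 0. *)
Lemma ae_cvg_of_summable (h : nat -> T -> R) :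
  (forall k, measurable_fun setT (h k)) -> (forall k x, 0 <= h k x) ->
  (forall k, \int[mu]_x (h k x)%:E <= ((1 / 2) ^+ k)%:E)%E ->
  {ae mu, forall x, h k x @[k --> \oo] --> 0}.
Proof.
move=> mh h0 hk.
have mE k : measurable_fun setT (EFin \o h k) by exact/measurable_EFinP.
pose S x := (\sum_(k <oo) (h k x)%:E)%E.
have S0 x : (0 <= S x)%E by apply: nneseries_ge0 => k _ _; rewrite lee_fin.
have mS : measurable_fun setT S.
  apply: ge0_emeasurable_sum; first by move=> k x _ _; rewrite lee_fin.
  by move=> k _; exact: mE.
have iS : (\int[mu]_x S x <= 2%:E)%E.
  rewrite /S integral_nneseries//; last by move=> k x _; rewrite lee_fin.
  apply: le_trans (_ : _ <= \sum_(k <oo) ((1 / 2) ^+ k)%:E)%E _.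
    by apply: lee_nneseries => // k _ _; apply: integral_ge0 => x _; rewrite lee_fin.
  apply: lime_le.
    by apply: is_cvg_nneseries => k _ _; rewrite lee_fin exprn_ge0.
  apply: nearW => k; rewrite sumEFin lee_fin.
  have E : \sum_(i < k) (1 / 2) ^+ i = 2 * (1 - (1 / 2) ^+ k) :> R.
    elim: k => [|k IH]; first by rewrite big_ord0 expr0 subrr mulr0.
    by rewrite big_ord_recr/= IH exprS; field.
  rewrite big_mkord E; have : 0 <= (1 / 2) ^+ k :> R by rewrite exprn_ge0.
  lra.
have intS : mu.-integrable setT S.
  apply/integrableP; split => //.
  under eq_integral do rewrite gee0_abs//.
  by rewrite (le_lt_trans iS)// ltry.
have := integrable_ae measurableT intS; apply: filterS => x /(_ I) Sx.
have := nneseries_tail_cvg (P := xpredT) (f := fun k => (h k x)%:E).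
rewrite ltey_eq Sx /= => /(_ isT (fun k _ => _)) => H.
have {}H : (\sum_(N <= k <oo) (h k x)%:E)%E @[N --> \oo] --> 0%E.
  by apply: H => k; rewrite lee_fin.
have cE : (h k x)%:E @[k --> \oo] --> 0%E.
  apply: (@squeeze_cvge _ _ _ _ (cst 0%E) _ (fun N => \sum_(N <= k <oo) (h k x)%:E)%E) => //.
  - apply: nearW => k; rewrite lee_fin h0 /=.
    have := @nneseries_lim_ge R (fun k => (h k x)%:E) xpredT k k.+1.
    by rewrite big_nat1; apply => i _ _; rewrite lee_fin.
  - exact: cvg_cst.
by move/fine_cvg : cE.
Qed.

End limits.

(** * Approximation in the weighted Sobolev space *)

Section xlnx_continuity.
Context {R : realType}.
Implicit Types e v t : R.

Lemma continuous_xlnx_gt0 t : 0 < t -> {for t, continuous (@xlnx R)}.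
Proof. by move=> t0; apply: cvgM; [exact: cvg_id|exact: continuous_ln]. Qed.

Lemma soft_sq_gt0 e v : 0 < e -> v != 0 -> 0 < soft_sq e v.
Proof.
move=> e0 v0; rewrite lt_def soft_sq_ge0 andbT /soft_sq sqrf_eq0 subr_eq0.
apply/eqP => E; have := soft_sq_arg_gt0 v e0; have : Num.sqrt (v ^+ 2 + e ^+ 2) ^+ 2 = e ^+ 2 by rewrite E.
move=> + /ltW h; rewrite sqr_sqrtr// => /eqP; rewrite -subr_eq0 addrK sqrf_eq0.
by rewrite (negbTE v0).
Qed.

(** The only singular point of the logarithm is [v = 0], where the function is
    squeezed between [- v^2 / e] and [v^4]. *)
Lemma continuous_xlnx_soft_sq e : 0 < e -> continuous (fun v : R => xlnx (soft_sq e v)).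
Proof.
move=> e0 v; have [->|v0] := eqVneq v 0; last first.
  apply: (@continuous_comp _ _ _ (soft_sq e) (@xlnx R)); first exact: continuous_soft_sq.
  by apply: continuous_xlnx_gt0; exact: soft_sq_gt0.
rewrite /continuous_at soft_sq0// {2}/xlnx mul0r.
apply: (squeeze_cvgr (f := fun v : R => - (v ^+ 2 / e)) (h := fun v : R => (v ^+ 2) ^+ 2)).
- apply: nearW => w; rewrite xlnx_soft_sq_ge//=.
  have /andP[_ +] := xlnx_bounds (soft_sq_ge0 e w); move=> /le_trans; apply.
  by rewrite lerXn2r ?nnegrE ?sqr_ge0 ?soft_sq_ge0 ?soft_sq_le.
- have H : continuous (fun v : R => - (v ^+ 2 / e)).
    move=> w; apply: (@cvgN _ R^o); apply: cvgM; last exact: cvg_cst.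
    exact: exprn_continuous.
  by have := H 0; rewrite /continuous_at expr0n mul0r oppr0.
- have H : continuous (fun v : R => (v ^+ 2) ^+ 2).
    move=> w; apply: (@continuous_comp _ _ _ (fun v : R => v ^+ 2) (fun v : R => v ^+ 2));
    exact: exprn_continuous.
  by have := H 0; rewrite /continuous_at !expr0n.
Qed.

End xlnx_continuity.

Section H10_limits.
Context {R : realType} {n : nat}.
Local Notation mu := (@lebesgue_rV R n).
Implicit Types (x A : 'rV[R]_n) (f u : 'rV[R]_n -> R) (g : 'rV[R]_n -> 'rV[R]_n).

Lemma orthant_weight_le A x : orthant_weight A x <= monomial A x.
Proof. by apply: ler_prod => i _; rewrite half_weight_ge0 half_weight_le. Qed.

Lemma measurable_sqnorm g : (forall i, measurable_fun setT (fun x => g x 0 i)) ->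
  measurable_fun setT (fun x => sqnorm (g x)).
Proof. by move=> mg; apply: measurable_sum => i; apply: measurable_funX. Qed.

Lemma sqnorm_ge0 x : 0 <= sqnorm x.
Proof. by apply: sumr_ge0 => i _; rewrite sqr_ge0. Qed.

Lemma Cc1_measurable u : Cc1 u -> measurable_fun setT u.
Proof. by move=> cu; apply: continuous_measurable_rV; exact: Cc1_continuous. Qed.

Lemma Cc1_grad_measurable u i : Cc1 u -> measurable_fun setT (fun x => grad u x 0 i).
Proof. by move=> cu; apply: continuous_measurable_rV; exact: Cc1_grad_continuous. Qed.

(** Young's inequality; the factor [1 + d] close to 1 preserves the sharp
    constant when [u] approximates [f]. *)
Lemma sqr_perturb (d a b : R) : 0 < d ->
  a ^+ 2 <= (1 + d) * b ^+ 2 + (1 + d^-1) * (a - b) ^+ 2.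
Proof.
move=> d0; rewrite -subr_ge0.
rewrite (_ : _ - _ = d^-1 * (d * b - (a - b)) ^+ 2); last by field; rewrite gt_eqF.
by rewrite mulr_ge0 ?sqr_ge0// invr_ge0 ltW.
Qed.

Lemma sqnorm_perturb (d : R) (a b : 'rV[R]_n) : 0 < d ->
  sqnorm a <= (1 + d) * sqnorm b + (1 + d^-1) * sqnorm (a - b).
Proof.
move=> d0; rewrite /sqnorm !mulr_sumr -big_split/=; apply: ler_sum => i _.
by rewrite !mxE; exact: sqr_perturb.
Qed.

Section fixed.
Variables (A : 'rV[R]_n) (f : 'rV[R]_n -> R) (g : 'rV[R]_n -> 'rV[R]_n).
Hypotheses (mf : measurable_fun setT f)
  (mg : forall i, measurable_fun setT (fun x => g x 0 i)).

Lemma measurable_H1_integrand u : Cc1 u -> measurable_fun setT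
  (fun x => (`|u x - f x| ^+ 2 + sqnorm (grad u x - g x)) * monomial A x).
Proof.
move=> cu; apply: measurable_funM; last exact: measurable_monomial.
apply: measurable_funD.
  apply: measurable_funX; apply: measurableT_comp; first exact: normr_measurable.
  by apply: measurable_funB => //; exact: Cc1_measurable.
apply: measurable_sqnorm => i; under eq_fun do rewrite !mxE.
have -> : (fun x => 'D_'e_i u x - g x 0 i) = (fun x => grad u x 0 i - g x 0 i).
  by apply/funext => x; rewrite mxE.
by apply: measurable_funB => //; exact: Cc1_grad_measurable.
Qed.

(** The weights differ: the distance in the Sobolev space is over the whole
    space, where the monomial weight dominates the weight of the orthant. *)
Lemma energy_perturb (a b d : R) u : 0 <= a -> 0 <= b -> 0 < d -> Cc1 u ->
  (\int[mu]_x ((a * u x ^+ 2 + b * sqnorm (grad u x)) * orthant_weight A x)%:E <=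
   (1 + d)%:E * \int[mu]_x ((a * f x ^+ 2 + b * sqnorm (g x)) * orthant_weight A x)%:E +
   ((1 + d^-1) * (a + b))%:E * H1_sqdist A f g u)%E.
Proof.
move=> a0 b0 d0 cu.
have c0 : 0 <= (1 + d^-1) * (a + b) by rewrite mulr_ge0 ?addr_ge0// invr_ge0 ltW.
have d10 : 0 <= 1 + d by rewrite addr_ge0// ltW.
have m1 : measurable_fun setT (fun x => (a * f x ^+ 2 + b * sqnorm (g x)) * orthant_weight A x).
  apply: measurable_funM; last exact: measurable_orthant_weight.
  apply: measurable_funD; apply: measurable_funM => //; first exact: measurable_funX.
  exact: measurable_sqnorm.
have m2 := measurable_H1_integrand cu.
have p1 x : 0 <= (a * f x ^+ 2 + b * sqnorm (g x)) * orthant_weight A x.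
  by rewrite mulr_ge0 ?orthant_weight_ge0// addr_ge0// mulr_ge0 ?sqr_ge0 ?sqnorm_ge0.
have p2 x : 0 <= (`|u x - f x| ^+ 2 + sqnorm (grad u x - g x)) * monomial A x.
  rewrite mulr_ge0 ?(le_trans _ (orthant_weight_le _ _)) ?orthant_weight_ge0//.
  by rewrite addr_ge0 ?sqr_ge0 ?sqnorm_ge0.
rewrite /H1_sqdist -!ge0_integralZl_EFin//; last 4 first.
- by move=> x _; rewrite lee_fin.
- exact/measurable_EFinP.
- by move=> x _; rewrite lee_fin.
- exact/measurable_EFinP.
rewrite -ge0_integralD//; last 4 first.
- by move=> x _; rewrite mule_ge0// lee_fin.
- by apply/measurable_EFinP; apply: measurable_funM.
- by move=> x _; rewrite mule_ge0// lee_fin.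
- by apply/measurable_EFinP; apply: measurable_funM.
apply: ge0_le_integral => //.
- move=> x _; rewrite lee_fin mulr_ge0 ?orthant_weight_ge0// addr_ge0// mulr_ge0 ?sqr_ge0 ?sqnorm_ge0//.
- apply/measurable_EFinP; apply: measurable_funM; last exact: measurable_orthant_weight.
  apply: measurable_funD; apply: measurable_funM => //.
    by apply: measurable_funX; exact: Cc1_measurable.
  by apply: measurable_sqnorm => i; exact: Cc1_grad_measurable.
- by apply/measurable_EFinP; apply: measurable_funD; apply: measurable_funM.
move=> x _; rewrite -!EFinM -EFinD lee_fin.
have h1 := sqr_perturb (u x) (f x) d0.
have h2 := sqnorm_perturb (grad u x) (g x) d0.
have W0 := orthant_weight_ge0 A x; have Wm := orthant_weight_le A x.
rewrite real_normK ?num_real//.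
set s := (u x - f x) ^+ 2 in h1 *; set t := sqnorm (_ - _) in h2 *.
have s0 : 0 <= s by exact: sqr_ge0.
have t0 : 0 <= t by exact: sqnorm_ge0.
have h3 : (1 + d^-1) * (a + b) * ((s + t) * orthant_weight A x) <=
  (1 + d^-1) * (a + b) * ((s + t) * monomial A x).
  by rewrite ler_wpM2l// ler_wpM2l// addr_ge0.
have h4 : a * u x ^+ 2 + b * sqnorm (grad u x) <=
    (1 + d) * (a * f x ^+ 2 + b * sqnorm (g x)) + (1 + d^-1) * (a + b) * (s + t).
  have k1 := ler_wpM2l a0 h1; have k2 := ler_wpM2l b0 h2.
  have e0 : 0 <= 1 + d^-1 by rewrite addr_ge0// invr_ge0 ltW.
  have k3 : 0 <= (1 + d^-1) * (a * t + b * s) by rewrite mulr_ge0// addr_ge0// mulr_ge0.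
  apply: le_trans (lerD k1 k2) _; rewrite -subr_ge0.
  rewrite (_ : _ - _ = (1 + d^-1) * (a * t + b * s))//; ring.
apply: le_trans (ler_wpM2r W0 h4) _.
by rewrite mulrDl -[X in X + _]mulrA -[X in _ + X]mulrA lerD2l.
Qed.

(** Only the products of [(v k - f)^2] with the weight are controlled, hence the
    restriction to points where the weight is nonzero. *)
Lemma H1_sqdist_ae_cvg (v : nat -> 'rV[R]_n -> R) : (forall k, Cc1 (v k)) ->
  (forall k, H1_sqdist A f g (v k) <= ((1 / 2) ^+ k)%:E)%E ->
  {ae mu, forall x, orthant_weight A x != 0 -> v k x @[k --> \oo] --> f x}.
Proof.
move=> cv dv.
have := @ae_cvg_of_summable _ _ R mu (fun k x => (v k x - f x) ^+ 2 * orthant_weight A x).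
have mh k : measurable_fun setT (fun x => (v k x - f x) ^+ 2 * orthant_weight A x).
  apply: measurable_funM; last exact: measurable_orthant_weight.
  by apply: measurable_funX; apply: measurable_funB => //; exact: Cc1_measurable.
move=> /(_ mh) H.
have h0 k x : 0 <= (v k x - f x) ^+ 2 * orthant_weight A x.
  by rewrite mulr_ge0 ?sqr_ge0 ?orthant_weight_ge0.
have {}H := H h0; have : {ae mu, forall x, (v k x - f x) ^+ 2 * orthant_weight A x @[k --> \oo] --> 0}.
  apply: H => k; apply: le_trans (dv k); apply: ge0_le_integral => //.
  - by move=> x _; rewrite lee_fin.
  - exact/measurable_EFinP.
  - by apply/measurable_EFinP; exact: measurable_H1_integrand.
  move=> x _; rewrite lee_fin ler_pM ?sqr_ge0 ?orthant_weight_ge0 ?orthant_weight_le//.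
  by rewrite real_normK ?num_real// lerDl sqnorm_ge0.
apply: filterS => x H2 Wx; apply/cvgrPdist_lt => e e0.
have Wp : 0 < orthant_weight A x by rewrite lt_def Wx orthant_weight_ge0.
have ep : 0 < e ^+ 2 * orthant_weight A x by rewrite mulr_gt0 ?exprn_gt0.
move/cvgrPdist_lt : H2 => /(_ _ ep); apply: filterS => k.
rewrite sub0r normrN ger0_norm ?h0// ltr_pM2r// => h.
by rewrite distrC -ltr_sqr ?nnegrE ?(ltW e0)// real_normK ?num_real.
Qed.

End fixed.

Lemma H10_approximation A f g : H10 A f g -> exists v : nat -> 'rV[R]_n -> R,
  (forall k, Cc1 (v k)) /\ (forall k, H1_sqdist A f g (v k) <= ((1 / 2) ^+ k)%:E)%E.
Proof.
move=> [_ _ [u [cu du]]].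
have H k : exists m, (H1_sqdist A f g (u m) <= ((1 / 2) ^+ k)%:E)%E.
  have ek : 0 < (1 / 2) ^+ k :> R by rewrite exprn_gt0.
  have /fine_cvgP[[N1 _ fu] cf] := du.
  move/cvgrPdist_lt : cf => /(_ _ ek)[N2 _ HN].
  exists (maxn N1 N2); have f1 := fu (maxn N1 N2) (leq_maxl _ _).
  have := HN (maxn N1 N2) (leq_maxr _ _); rewrite /= sub0r normrN => h.
  rewrite -(fineK f1) lee_fin ltW//; exact: le_lt_trans (ler_norm _) h.
by have [m Hm] := choice H; exists (fun k => u (m k)).
Qed.

End H10_limits.

(** * Passage to the limit with truncated amplitudes *)

Section soft_bound.
Context {R : realType} {n : nat}.
Local Notation mu := (@lebesgue_rV R n).
Implicit Types (x A : 'rV[R]_n) (f u : 'rV[R]_n -> R) (g : 'rV[R]_n -> 'rV[R]_n).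

Lemma near_geometric_le (C e : R) : 0 < e -> \forall k \near \oo, C * (1 / 2) ^+ k <= e.
Proof.
move=> e0.
have : C * (1 / 2) ^+ k @[k --> \oo] --> C * 0.
  apply: cvgM; first exact: cvg_cst.
  by apply: cvg_expr; rewrite ger0_norm; lra.
rewrite mulr0 => /cvgrPdist_le /(_ _ e0); apply: filterS => k.
by rewrite sub0r normrN; apply: le_trans; rewrite ler_norm.
Qed.

Lemma energyE A f g (a b I : R) : 0 <= a -> 0 <= b ->
  measurable_fun setT f -> (forall i, measurable_fun setT (fun x => g x 0 i)) ->
  wint A (fun x => `|f x| ^+ 2) = 1%:E -> wint A (fun x => sqnorm (g x)) = I%:E ->
  (\int[mu]_x ((a * f x ^+ 2 + b * sqnorm (g x)) * orthant_weight A x)%:E = (a + b * I)%:E)%E.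
Proof.
move=> a0 b0 mf mg f1 gI.
have mW := measurable_orthant_weight A.
have m1 : measurable_fun setT (fun x => `|f x| ^+ 2 * orthant_weight A x).
  apply: measurable_funM => //; apply: measurable_funX.
  exact: (measurableT_comp (@normr_measurable R setT) mf).
have m2 : measurable_fun setT (fun x => sqnorm (g x) * orthant_weight A x).
  by apply: measurable_funM => //; exact: measurable_sqnorm.
have p1 x : 0 <= `|f x| ^+ 2 * orthant_weight A x.
  by rewrite mulr_ge0 ?sqr_ge0 ?orthant_weight_ge0.
have p2 x : 0 <= sqnorm (g x) * orthant_weight A x.
  by rewrite mulr_ge0 ?sqnorm_ge0 ?orthant_weight_ge0.
have -> : (a + b * I)%:E = (a%:E * wint A (fun x => `|f x| ^+ 2)%R + b%:E * wint A (fun x => sqnorm (g x))%R)%E.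
  by rewrite f1 gI -!EFinM -EFinD mulr1.
rewrite !wintE -!ge0_integralZl_EFin//.
- rewrite -ge0_integralD//.
  + apply: eq_integral => x _; rewrite -!EFinM -EFinD real_normK ?num_real//.
    by rewrite mulrDl !mulrA.
  + by move=> x _; rewrite -EFinM lee_fin mulr_ge0.
  + by apply/measurable_EFinP; apply: measurable_funM.
  + by move=> x _; rewrite -EFinM lee_fin mulr_ge0.
  + by apply/measurable_EFinP; apply: measurable_funM.
- by move=> x _; rewrite lee_fin.
- exact/measurable_EFinP.
- by move=> x _; rewrite lee_fin.
- exact/measurable_EFinP.
Qed.

Lemma energy_rmean A u (a b : R) : (forall i, 0 <= A 0 i) -> Cc1 u ->
  (\int[mu]_x ((a * u x ^+ 2 + b * sqnorm (grad u x)) * orthant_weight A x)%:E =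
  (a * rmean A (fun x => u x ^+ 2) + b * rmean A (fun x => sqnorm (grad u x)))%:E)%E.
Proof.
move=> A0 cu; have [_ _ i1 i2] := Cc1_integrable A0 ltr01 cu.
have j1 := integrable_weightZ a i1; have j2 := integrable_weightZ b i2.
rewrite -(rmeanZ a i1) -(rmeanZ b i2) -(rmeanD j1 j2) -wint_rmean; last exact: integrable_weightD.
by rewrite wintE.
Qed.

(** The factor of the mass in the inequality when the mass is known to be at most
    [k], which happens along an approximating sequence as soon as [k > 1]. *)
Definition logsob_const A (s k : R) : R := log_mass A s + hdim A - ln k.

Lemma H10_energy_near A f g (v : nat -> 'rV[R]_n -> R) (a b I e : R) :
  (forall i, 0 <= A 0 i) ->
  measurable_fun setT f -> (forall i, measurable_fun setT (fun x => g x 0 i)) ->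
  wint A (fun x => `|f x| ^+ 2) = 1%:E -> wint A (fun x => sqnorm (g x)) = I%:E ->
  0 <= I ->
  (forall k, Cc1 (v k)) ->
  (forall k, H1_sqdist A f g (v k) <= ((1 / 2) ^+ k)%:E)%E ->
  0 <= a -> 0 <= b -> 0 < e ->
  \forall k \near \oo, a * rmean A (fun x => v k x ^+ 2) +
     b * rmean A (fun x => sqnorm (grad (v k) x)) <= a + b * I + e.
Proof.
move=> A0 mf mg f1 gI I0 cv dv a0 b0 e0.
set M := a + b * I; have M0 : 0 <= M by rewrite addr_ge0// mulr_ge0.
pose d := e / 2 / (M + 1); have d0 : 0 < d by rewrite !divr_gt0// ltr_wpDl.
have e20 : 0 < e / 2 by rewrite divr_gt0.
apply: filterS (near_geometric_le ((1 + d^-1) * (a + b)) e20) => k hk.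
have := energy_perturb A mf mg a0 b0 d0 (cv k).
rewrite (energyE a0 b0 mf mg f1 gI) energy_rmean// -/M => H.
have c0 : 0 <= (1 + d^-1) * (a + b) by rewrite mulr_ge0 ?addr_ge0// invr_ge0 ltW.
rewrite -lee_fin; apply: le_trans H _.
apply: (@le_trans _ _ ((1 + d)%:E * M%:E + ((1 + d^-1) * (a + b))%:E * ((1 / 2) ^+ k)%:E)%E).
  by rewrite leeD2l// lee_wpmul2l// lee_fin.
rewrite -!EFinM -EFinD lee_fin.
have : d * M <= e / 2.
  rewrite /d mulrAC ler_pdivrMr; last by rewrite ltr_wpDl.
  by rewrite ler_wpM2l ?(ltW e20)// lerDl.
lra.
Qed.

(** The term in [a] makes the integrand nonnegative, so that Fatou's lemma
    applies. It contributes exactly [a] on the right because the masses of the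
    approximants tend to that of [f]. *)
Lemma H10_soft_bound A f g (I e s k : R) (c := logsob_const A s k) (a := e^-1 + `|c|) : (forall i, 0 <= A 0 i) ->
  H10 A f g -> wint A (fun x => `|f x| ^+ 2) = 1%:E ->
  wint A (fun x => sqnorm (g x)) = I%:E -> 0 < e -> 0 < s -> 1 < k ->
  (\int[mu]_x ((xlnx (soft_sq e (f x)) + c * soft_sq e (f x) + a * f x ^+ 2) *
     orthant_weight A x)%:E <= (a + 2 / s * I)%:E)%E.
Proof.
move=> A0 fg f1 gI e0 s0 k1; have [mf mg _] := fg.
have k0 : 0 < k by apply: lt_trans k1.
have I0 : 0 <= I.
  rewrite -lee_fin -gI wintE; apply: integral_ge0 => x _.
  by rewrite lee_fin mulr_ge0 ?sqnorm_ge0 ?orthant_weight_ge0.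
have a0 : 0 <= a by rewrite /a addr_ge0// invr_ge0 ltW.
have s20 : 0 <= 2 / s by rewrite divr_ge0// ltW.
have [v [cv dv]] := H10_approximation fg.
pose G w := xlnx (soft_sq e w) + c * soft_sq e w + a * w ^+ 2.
have cG : continuous G.
  move=> w; apply: cvgD; first apply: cvgD.
  - exact: continuous_xlnx_soft_sq.
  - by apply: cvgM; [exact: cvg_cst|exact: continuous_soft_sq].
  - by apply: cvgM; [exact: cvg_cst|exact: exprn_continuous].
have G0 w : 0 <= G w.
  have h1 := xlnx_soft_sq_ge w e0; have h2 := soft_sq_le w e0; have h3 := soft_sq_ge0 e w.
  have h4 : - (`|c| * w ^+ 2) <= c * soft_sq e w.
    have := ler_norm (- c); rewrite normrN => h5.
    have := ler_wpM2r h3 h5; have := ler_wpM2l (normr_ge0 c) h2; lra.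
  rewrite /G /a; lra.
have mW := measurable_orthant_weight A.
have mGW u : measurable_fun setT u -> measurable_fun setT (fun x => G (u x) * orthant_weight A x).
  move=> mu_; apply: measurable_funM => //.
  exact: (measurableT_comp (continuous_measurable_fun cG) mu_).
apply: (@fatou_ae_le _ _ R mu (fun k x => (G (v k x) * orthant_weight A x)%:E)).
- by move=> j; apply/measurable_EFinP; apply: mGW; exact: Cc1_measurable.
- by move=> j x; rewrite lee_fin mulr_ge0 ?orthant_weight_ge0.
- by apply/measurable_EFinP; apply: mGW.
- by move=> x; rewrite lee_fin mulr_ge0 ?orthant_weight_ge0//; exact: G0.
- have := H1_sqdist_ae_cvg mf mg cv dv; apply: filterS => x Hx.
  have [->|W0] := eqVneq (orthant_weight A x) 0.
    by rewrite mulr0; under eq_fun do rewrite mulr0; exact: cvg_cst.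
  apply: cvg_EFin; first by apply: nearW.
  apply: cvgM; last exact: cvg_cst.
  apply: continuous_cvg; first exact: cG.
  exact: Hx.
move=> h h0.
have k10 : 0 < k - 1 by rewrite subr_gt0.
(* eventually the mass is at most [k], and [a] times the mass plus [2 / s] times
   the energy exceeds its limit by at most [h] *)
have n1 := @H10_energy_near A f g v 1 0 I (k - 1) A0 mf mg f1 gI I0 cv dv ler01 (lexx 0) k10.
have n2 := @H10_energy_near A f g v a (2 / s) I h A0 mf mg f1 gI I0 cv dv a0 s20 h0.
near=> j.
have U1 : rmean A (fun x => v j x ^+ 2) <= k.
  suff : 1 * rmean A (fun x => v j x ^+ 2) + 0 * rmean A (fun x => sqnorm (grad (v j) x)) <= 1 + 0 * I + (k - 1).
    by rewrite !mul0r !addr0 mul1r addrCA subrr addr0.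
  by near: j.
have N2 : a * rmean A (fun x => v j x ^+ 2) + 2 / s * rmean A (fun x => sqnorm (grad (v j) x)) <= a + 2 / s * I + h.
  by near: j.
have [i1 i2 i3 i4] := Cc1_integrable A0 e0 (cv j).
have j2 := integrable_weightZ c i2; have j3 := integrable_weightZ a i3.
have -> : (\int[mu]_x (G (v j x) * orthant_weight A x)%:E =
    (rmean A (fun x => xlnx (soft_sq e (v j x))) + c * rmean A (fun x => soft_sq e (v j x)) +
    a * rmean A (fun x => v j x ^+ 2))%:E)%E.
  rewrite -(rmeanZ c i2) -(rmeanZ a i3) -(rmeanD i1 j2) -(rmeanD (integrable_weightD i1 j2) j3).
  by rewrite -wint_rmean ?wintE//; exact: integrable_weightD (integrable_weightD i1 j2) j3.
rewrite lee_fin; apply: le_trans N2.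
have LS := logsob_Cc1 A0 e0 s0 (cv j).
set m := rmean A (fun x => soft_sq e (v j x)) in LS *.
have m0 : 0 <= m.
  by apply: Rintegral_ge0 => x _; rewrite mulr_ge0 ?soft_sq_ge0 ?orthant_weight_ge0.
have mk : m <= k.
  apply: le_trans U1; apply: le_Rintegral => // x _.
  by rewrite ler_wpM2r ?orthant_weight_ge0// soft_sq_le.
have : xlnx m <= m * ln k.
  move: m0; rewrite le_eqVlt => /predU1P[<-|m0]; first by rewrite /xlnx !mul0r.
  by rewrite /xlnx ler_pM2l// ler_ln ?posrE.
rewrite /c /logsob_const; lra.
Unshelve. all: by end_near. Qed.

Lemma H10_energy_fin A f g : (forall i, 0 <= A 0 i) ->
  H10 A f g -> exists2 I, 0 <= I & wint A (fun x => sqnorm (g x)) = I%:E.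
Proof.
move=> A0 fg; have [mf mg _] := fg.
have [v [cv dv]] := H10_approximation fg.
have [_ _ _ i4] := Cc1_integrable A0 ltr01 (cv 0).
have Wp := orthant_weight_ge0 A; have Wm := orthant_weight_le A.
have mW := measurable_orthant_weight A.
have mgr : measurable_fun setT (fun x => sqnorm (grad (v 0) x)).
  by apply: measurable_sqnorm => i; exact: Cc1_grad_measurable.
have gfin : (wint A (fun x => sqnorm (g x)) < +oo)%E.
  apply: (@le_lt_trans _ _ (2%:E * wint A (fun x => sqnorm (grad (v 0%N) x)) + 2%:E * H1_sqdist A f g (v 0%N))%E).
    rewrite !wintE /H1_sqdist -!ge0_integralZl_EFin//; last 4 first.
    - move=> x _; rewrite lee_fin mulr_ge0 ?(le_trans (Wp x) (Wm x))//.
      by rewrite addr_ge0 ?sqr_ge0 ?sqnorm_ge0.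
    - by apply/measurable_EFinP; exact: measurable_H1_integrand.
    - by move=> x _; rewrite lee_fin mulr_ge0 ?sqnorm_ge0.
    - by apply/measurable_EFinP; apply: measurable_funM.
    rewrite -ge0_integralD//; last 4 first.
    - by move=> x _; rewrite -EFinM lee_fin !mulr_ge0 ?sqnorm_ge0.
    - by apply/measurable_EFinP; do 2 apply: measurable_funM => //.
    - move=> x _; rewrite -EFinM lee_fin !mulr_ge0 ?(le_trans (Wp x) (Wm x))//.
      by rewrite addr_ge0 ?sqr_ge0 ?sqnorm_ge0.
    - by apply/measurable_EFinP; apply: measurable_funM => //; exact: measurable_H1_integrand.
    apply: ge0_le_integral => //.
    - by move=> x _; rewrite lee_fin mulr_ge0 ?sqnorm_ge0.
    - by apply/measurable_EFinP; apply: measurable_funM => //; exact: measurable_sqnorm.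
    - apply/measurable_EFinP; apply: measurable_funD.
        by do 2 apply: measurable_funM => //.
      by apply: measurable_funM => //; exact: measurable_H1_integrand.
    move=> x _; rewrite -!EFinM -EFinD lee_fin.
    have := @sqnorm_perturb R n 1 (g x) (grad (v 0%N) x) ltr01.
    have -> : sqnorm (g x - grad (v 0%N) x) = sqnorm (grad (v 0%N) x - g x).
      by apply: eq_bigr => i _; rewrite !mxE -sqrrN opprB.
    rewrite invr1 -[1 + 1]/2; set p := sqnorm (grad _ x - _); set q := sqnorm (grad _ _).
    move=> h; apply: le_trans (ler_wpM2r (Wp x) h) _.
    rewrite mulrDl -!mulrA lerD2l ler_pM2l// ler_pM ?sqnorm_ge0//.
    by rewrite lerDr sqr_ge0.
  rewrite wint_rmean// -EFinM lte_add_pinfty ?ltry// lte_mul_pinfty//.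
  by rewrite (le_lt_trans (dv 0%N))// ltry.
exists (fine (wint A (fun x => sqnorm (g x)))).
  rewrite fine_ge0// wintE; apply: integral_ge0 => x _.
  by rewrite lee_fin mulr_ge0 ?sqnorm_ge0.
rewrite fineK// ge0_fin_numE// wintE; apply: integral_ge0 => x _.
by rewrite lee_fin mulr_ge0 ?sqnorm_ge0.
Qed.

End soft_bound.

(** * Removal of the truncation *)

Section logsob_H10.
Context {R : realType} {n : nat}.
Local Notation mu := (@lebesgue_rV R n).
Implicit Types (x A : 'rV[R]_n) (f u : 'rV[R]_n -> R) (g : 'rV[R]_n -> 'rV[R]_n).

Lemma cvg_soft_sq (v : R) : soft_sq (k.+1%:R^-1) v @[k --> \oo] --> v ^+ 2.
Proof.
have H : Num.sqrt (v ^+ 2 + k.+1%:R^-1 ^+ 2) - k.+1%:R^-1 @[k --> \oo] --> `|v|.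
  apply: (squeeze_cvgr (f := fun k => `|v| - k.+1%:R^-1) (h := fun k => `|v|)).
  - apply: nearW => k; have e0 : 0 < k.+1%:R^-1 :> R by rewrite invr_gt0.
    rewrite soft_sqrt_le// andbT lerD2r -sqrtr_sqr ler_sqrt ?lerDl ?sqr_ge0//.
    by rewrite ltW// soft_sq_arg_gt0.
  - rewrite -[X in _ --> X]subr0; apply: cvgB; first exact: cvg_cst.
    exact: cvg_harmonic.
  - exact: cvg_cst.
suff : soft_sq (k.+1%:R^-1) v @[k --> \oo] --> `|v| ^+ 2 by rewrite real_normK ?num_real.
exact: (cvgM H H).
Qed.

Lemma cvg_xlnx_soft_sq (v : R) :
  xlnx (soft_sq (k.+1%:R^-1) v) @[k --> \oo] --> xlnx (v ^+ 2).
Proof.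
have [->|v0] := eqVneq v 0.
  rewrite expr0n/=; under eq_fun do rewrite soft_sq0 ?invr_gt0//.
  exact: cvg_cst.
apply: continuous_cvg; last exact: cvg_soft_sq.
by apply: continuous_xlnx_gt0; rewrite exprn_even_gt0.
Qed.

(** Domination of [z ln z] for [z <= y] by [y] alone: with [z = t y] one has
    [z ln z = t (y ln y) + y (t ln t)] and [0 <= t <= 1]. *)
Lemma xlnx_norm_le (z y : R) : 0 <= z <= y -> `|xlnx z| <= `|xlnx y| + y.
Proof.
move=> /andP[]; rewrite le_eqVlt => /predU1P[<- y0|z0 zy].
  by rewrite {1}/xlnx mul0r normr0 addr_ge0.
have y0 : 0 < y by apply: lt_le_trans zy.
pose t := z / y; have t0 : 0 < t by rewrite divr_gt0.
have t1 : t <= 1 by rewrite ler_pdivrMr// mul1r.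
have zE : z = t * y by rewrite /t divfK// gt_eqF.
have -> : xlnx z = t * xlnx y + y * xlnx t.
  by rewrite zE /xlnx lnM ?posrE//; ring.
have hY : `|xlnx t| <= 1.
  have /andP[h1 h2] := xlnx_bounds (ltW t0).
  by rewrite ler_norml h1 (le_trans h2)// expr_le1// ltW.
move: (xlnx y) (xlnx t) hY => X Y hY; apply: le_trans (ler_normD _ _) _.
rewrite (normrM t) (normrM y) (gtr0_norm t0) (gtr0_norm y0).
by rewrite lerD ?ler_piMl// ler_piMr// ltW.
Qed.

(** Gives the integrability of the positive part of [f^2 ln f^2] from the
    truncated inequality with [e = 1]. For large [v] the square [v^2] is at most
    [4 soft_sq 1 v]; for small [v] the logarithm is bounded above. *)
Lemma xlnx_sqr_le (v : R) :
  Num.max (xlnx (v ^+ 2)) 0 <= 4 * `|xlnx (soft_sq 1 v)| + 9 * v ^+ 2.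
Proof.
have v2 := sqr_ge0 v; rewrite ge_max; apply/andP; split; last first.
  by rewrite addr_ge0// mulr_ge0.
(* beyond [4 / 3] one has [sqrt (v^2 + 1) - 1 >= |v| / 2] *)
have [v4|v4] := leP `|v| (4 / 3).
  have [->|v0] := eqVneq v 0.
    by rewrite expr0n/= /xlnx mul0r addr_ge0 ?mulr0// mulr_ge0.
  have vp : 0 < v ^+ 2 by rewrite exprn_even_gt0.
  have vv : v ^+ 2 <= 16 / 9.
    rewrite -real_normK ?num_real//.
    rewrite (_ : 16 / 9 = (4 / 3) ^+ 2); last by field.
    by rewrite lerXn2r ?nnegrE// divr_ge0.
  have : ln (v ^+ 2) <= 9 by have := ln_le_subr1 vp; lra.
  move=> /(ler_wpM2l v2); rewrite -/(xlnx (v ^+ 2)).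
  by have := normr_ge0 (xlnx (soft_sq 1 v)); lra.
have vp : 0 < v ^+ 2 by rewrite exprn_even_gt0//= -normr_eq0 gt_eqF//; lra.
have h : `|v| / 2 <= Num.sqrt (v ^+ 2 + 1 ^+ 2) - 1.
  rewrite lerBrDr -[leLHS]ger0_norm; last by rewrite addr_ge0// divr_ge0.
  rewrite -sqrtr_sqr ler_sqrt ?soft_sq_arg_gt0//; last by rewrite ltW// soft_sq_arg_gt0.
  rewrite -(@real_normK _ v) ?num_real//.
  move: v4; set w := `|v| => v4.
  have -> : (w / 2 + 1) ^+ 2 = w ^+ 2 / 4 + w + 1 by field.
  have : 4 / 3 * w <= w ^+ 2 by rewrite expr2 ler_wpM2r ?normr_ge0// ltW.
  rewrite expr1n; lra.
have yz : v ^+ 2 <= 4 * soft_sq 1 v.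
  have E : v ^+ 2 = 4 * (`|v| / 2) ^+ 2.
    by rewrite -[in LHS]real_normK ?num_real//; field.
  have a0 : 0 <= `|v| / 2 by rewrite divr_ge0.
  by rewrite {1}E /soft_sq ler_pM2l// lerXn2r ?nnegrE// (le_trans a0 h).
set z := soft_sq 1 v in yz *.
have z0 : 0 < z by lra.
have : xlnx (v ^+ 2) <= v ^+ 2 * (ln 4 + ln z).
  by rewrite /xlnx ler_pM2l// -lnM ?posrE// ler_ln ?posrE// mulr_gt0.
have l4 : ln 4 <= 3 :> R by have := @ln_le_subr1 R 4; lra.
have : v ^+ 2 * ln z <= 4 * `|xlnx z|.
  have [lz|lz] := leP 0 (ln z).
    rewrite (@ger0_norm _ (xlnx z)); last by rewrite /xlnx mulr_ge0 ?(ltW z0).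
    by rewrite /xlnx mulrA ler_wpM2r.
  by rewrite (le_trans (_ : _ <= 0)) ?mulr_ge0// mulr_ge0_le0// ltW.
have := ler_wpM2l v2 l4; lra.
Qed.

Lemma integrable_weight_le A (f h : 'rV[R]_n -> R) :
  measurable_fun setT f ->
  mu.-integrable setT (EFin \o (fun x => h x * orthant_weight A x)) ->
  (forall x, `|f x| <= h x) ->
  mu.-integrable setT (EFin \o (fun x => f x * orthant_weight A x)).
Proof.
move=> mf ih fh; apply: (le_integrable measurableT _ _ ih).
  by apply/measurable_EFinP; apply: measurable_funM => //; exact: measurable_orthant_weight.
move=> x _; rewrite /= lee_fin !normrM ler_wpM2r//.
by rewrite (le_trans (fh x))// ler_norm.
Qed.

Lemma integrable_weight_ge0 A (f : 'rV[R]_n -> R) :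
  measurable_fun setT f -> (forall x, 0 <= f x) -> (wint A f < +oo)%E ->
  mu.-integrable setT (EFin \o (fun x => f x * orthant_weight A x)).
Proof.
move=> mf f0; rewrite wintE => fi; apply/integrableP; split.
  by apply/measurable_EFinP; apply: measurable_funM => //; exact: measurable_orthant_weight.
under eq_integral => x _ do rewrite /= ger0_norm ?mulr_ge0 ?orthant_weight_ge0//.
exact: fi.
Qed.

Section inequality.
Variables (A : 'rV[R]_n) (f : 'rV[R]_n -> R) (g : 'rV[R]_n -> 'rV[R]_n) (I : R).
Hypotheses (A0 : forall i, 0 <= A 0 i) (fg : H10 A f g)
  (f1 : wint A (fun x => `|f x| ^+ 2) = 1%:E)
  (gI : wint A (fun x => sqnorm (g x)) = I%:E).

Local Notation W := (orthant_weight A).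
Local Notation integ h := (mu.-integrable setT (EFin \o (fun x => h x * W x))).

Let mf : measurable_fun setT f. Proof. by case: fg. Qed.

Let mf2 : measurable_fun setT (fun x => f x ^+ 2).
Proof. exact: measurable_funX. Qed.

Let f2E : (fun x => `|f x| ^+ 2) = (fun x => f x ^+ 2).
Proof. by apply/funext => x; rewrite real_normK ?num_real. Qed.

Lemma sqr_integrable : integ (fun x => f x ^+ 2).
Proof.
apply: integrable_weight_ge0 => //; first by move=> x; exact: sqr_ge0.
by rewrite -f2E f1 ltry.
Qed.

Lemma sqr_rmean : rmean A (fun x => f x ^+ 2) = 1.
Proof. by apply: EFin_inj; rewrite -wint_rmean; [rewrite -f2E|exact: sqr_integrable]. Qed.

Let msoft e : 0 < e -> measurable_fun setT (fun x => soft_sq e (f x)).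
Proof.
by move=> e0; exact: (measurableT_comp (continuous_measurable_fun (continuous_soft_sq e0)) mf).
Qed.

Lemma soft_integrable e : 0 < e -> integ (fun x => soft_sq e (f x)).
Proof.
move=> e0; apply: (integrable_weight_le (msoft e0) sqr_integrable) => x.
by rewrite ger0_norm ?soft_sq_ge0// soft_sq_le.
Qed.

(** The bound of Fatou's lemma with the auxiliary terms removed, which is
    possible because they are integrable. *)
Lemma xlnx_soft e s k : 0 < e -> 0 < s -> 1 < k ->
  integ (fun x => xlnx (soft_sq e (f x))) /\
  rmean A (fun x => xlnx (soft_sq e (f x))) +
  logsob_const A s k * rmean A (fun x => soft_sq e (f x)) <= 2 / s * I.
Proof.
move=> e0 s0 k1; have := H10_soft_bound A0 fg f1 gI e0 s0 k1.
set c := logsob_const A s k; set a := e^-1 + `|c| => H.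
have i2 := integrable_weightZ c (soft_integrable e0).
have i3 := integrable_weightZ a sqr_integrable.
have mX : measurable_fun setT (fun x => xlnx (soft_sq e (f x))).
  exact: (measurableT_comp (@measurable_xlnx R) (msoft e0)).
have X0 x : 0 <= xlnx (soft_sq e (f x)) + c * soft_sq e (f x) + a * f x ^+ 2.
  have h1 := xlnx_soft_sq_ge (f x) e0; have h2 := soft_sq_le (f x) e0; have h3 := soft_sq_ge0 e (f x).
  have h4 : - (`|c| * f x ^+ 2) <= c * soft_sq e (f x).
    have := ler_norm (- c); rewrite normrN => h5.
    have := ler_wpM2r h3 h5; have := ler_wpM2l (normr_ge0 c) h2; lra.
  rewrite /a; lra.
have iX : integ (fun x => xlnx (soft_sq e (f x)) + c * soft_sq e (f x) + a * f x ^+ 2).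
  apply: integrable_weight_ge0 => //.
    apply: measurable_funD; last exact: measurable_funM.
    by apply: measurable_funD => //; apply: measurable_funM => //; exact: msoft.
  by rewrite wintE (le_lt_trans H)// ltry.
have i1 : integ (fun x => xlnx (soft_sq e (f x))).
  have := integrable_weightD iX (integrable_weightZ (-1) (integrable_weightD i2 i3)).
  by apply: eq_integrable => // x _ /=; congr ((_ * _)%:E); ring.
split => //; move: H; rewrite -wintE (wint_rmean iX) lee_fin.
rewrite (rmeanD (integrable_weightD i1 i2) i3) (rmeanD i1 i2) (rmeanZ _ (soft_integrable e0)).
rewrite (rmeanZ _ sqr_integrable) sqr_rmean; lra.
Qed.

Let mxf : measurable_fun setT (fun x => xlnx (f x ^+ 2)).
Proof. exact: (measurableT_comp (@measurable_xlnx R) mf2). Qed.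

Lemma xlnx_pos_integrable : integ (fun x => Num.max (xlnx (f x ^+ 2)) 0).
Proof.
have [i1 _] := @xlnx_soft 1 1 2 ltr01 ltr01 (ltr1n R 2).
have i1' : integ (fun x => `|xlnx (soft_sq 1 (f x))|).
  have := integrable_norm i1; apply: eq_integrable => // x _ /=.
  by rewrite normrM [X in _ * X]ger0_norm ?orthant_weight_ge0.
have := integrable_weightD (integrable_weightZ 4 i1') (integrable_weightZ 9 sqr_integrable).
move=> /integrable_weight_le; apply; first exact: measurable_maxr.
by move=> x; rewrite ger0_norm ?le_max ?lexx ?orbT//; exact: xlnx_sqr_le.
Qed.

(** Dominated convergence as the truncation disappears, followed by [k] tending
    to 1. *)
Lemma logsob_integrable s : integ (fun x => xlnx (f x ^+ 2)) -> 0 < s ->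
  rmean A (fun x => xlnx (f x ^+ 2)) <= 2 / s * I - (log_mass A s + hdim A).
Proof.
move=> iX s0.
suff H k : 1 < k -> rmean A (fun x => xlnx (f x ^+ 2)) + logsob_const A s k <= 2 / s * I.
  apply/ler_addgt0Pr => e e0.
  have k1 : 1 < 1 + e by rewrite ltrDl.
  have := H _ k1; have := @ln_le_subr1 R (1 + e) (lt_trans ltr01 k1).
  rewrite /logsob_const; lra.
move=> k1; set c := logsob_const A s k.
have iL := integrable_weightD iX (integrable_weightZ c sqr_integrable).
have -> : rmean A (fun x => xlnx (f x ^+ 2)) + c =
    rmean A (fun x => xlnx (f x ^+ 2) + c * f x ^+ 2).
  by rewrite (rmeanD iX (integrable_weightZ c sqr_integrable)) (rmeanZ c sqr_integrable) sqr_rmean mulr1.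
have iX' : integ (fun x => `|xlnx (f x ^+ 2)|).
  have := integrable_norm iX; apply: eq_integrable => // x _ /=.
  by rewrite normrM [X in _ * X]ger0_norm ?orthant_weight_ge0.
have iB := integrable_weightD iX' (integrable_weightZ (1 + `|c|) sqr_integrable).
pose F k x := (xlnx (soft_sq k.+1%:R^-1 (f x)) + c * soft_sq k.+1%:R^-1 (f x)) * W x.
have e0 j : 0 < j.+1%:R^-1 :> R by rewrite invr_gt0.
have mW := measurable_orthant_weight A.
have i1 j : integ (fun x => xlnx (soft_sq j.+1%:R^-1 (f x))).
  by have [] := xlnx_soft (e0 j) s0 k1.
have FE j : (\int[mu]_x (EFin \o F j) x = (rmean A (fun x => xlnx (soft_sq j.+1%:R^-1 (f x))) +
    c * rmean A (fun x => soft_sq j.+1%:R^-1 (f x)))%:E)%E.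
  have i2 := integrable_weightZ c (soft_integrable (e0 j)).
  rewrite -(rmeanZ c (soft_integrable (e0 j))) -(rmeanD (i1 j) i2) -wint_rmean ?wintE//.
  exact: integrable_weightD.
rewrite -lee_fin -(wint_rmean iL) wintE.
have [|||_ _ cF] := @dominated_convergence _ _ R mu setT measurableT (fun k => EFin \o F k)
  (EFin \o (fun x => (xlnx (f x ^+ 2) + c * f x ^+ 2) * W x)) _
  _ (measurable_int mu iL) _ iB _.
  - move=> j; apply/measurable_EFinP; apply: measurable_funM => //.
    apply: measurable_funD; last by apply: measurable_funM => //; exact: msoft.
    exact: (measurableT_comp (@measurable_xlnx R) (msoft (e0 j))).
  - apply: aeW => x _; apply: cvg_EFin; first exact: nearW.
    apply: cvgM; last exact: cvg_cst.
    apply: cvgD; first exact: cvg_xlnx_soft_sq.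
    by apply: cvgM; [exact: cvg_cst|exact: cvg_soft_sq].
  - apply: aeW => x j _; rewrite /= lee_fin normrM [X in _ * X]ger0_norm ?orthant_weight_ge0//.
    rewrite ler_wpM2r ?orthant_weight_ge0// (le_trans (ler_normD _ _))//.
    have zy : 0 <= soft_sq j.+1%:R^-1 (f x) <= f x ^+ 2 by rewrite soft_sq_ge0 soft_sq_le.
    rewrite [(1 + _) * _]mulrDl mul1r addrA lerD ?xlnx_norm_le// normrM ler_wpM2l//.
    by rewrite ger0_norm ?soft_sq_ge0// soft_sq_le.
rewrite -(cvg_lim _ cF)//; apply: lime_le; first by apply/cvg_ex; eexists; exact: cF.
apply: nearW => j; rewrite /= FE lee_fin.
by have [] := xlnx_soft (e0 j) s0 k1.
Qed.

(** If the negative part is not integrable the left side is [-oo]. *)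
Lemma logsob_H10 s : 0 < s ->
  (wint A (fun x => xlnx (`|f x| ^+ 2)) <= (2 / s * I - (log_mass A s + hdim A))%:E)%E.
Proof.
move=> s0.
have -> : (fun x => xlnx (`|f x| ^+ 2)) = (fun x => xlnx (f x ^+ 2)).
  by apply/funext => x; rewrite real_normK ?num_real.
have ip := xlnx_pos_integrable.
set h := fun x => xlnx (f x ^+ 2) * W x.
have mh : measurable_fun setT (EFin \o h).
  by apply/measurable_EFinP; apply: measurable_funM => //; exact: measurable_orthant_weight.
have hp : (\int[mu]_x ((EFin \o h)^\+ x) < +oo)%E.
  have -> : (EFin \o h)^\+%E = EFin \o (fun x => Num.max (xlnx (f x ^+ 2)) 0 * W x).
    apply/funext => x; rewrite funeposE /= -EFin_max; congr (_%:E).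
    by rewrite /h maxr_pMl ?orthant_weight_ge0// mul0r.
  by have := integrable_lty measurableT ip.
have [hn|] := pselect (\int[mu]_x ((EFin \o h)^\- x) < +oo)%E.
  have ih : integ (fun x => xlnx (f x ^+ 2)).
    apply/integrableP; split => //.
    rewrite (eq_integral (fun x => (EFin \o h)^\+ x + (EFin \o h)^\- x)%E); last first.
      by move=> x _; rewrite -[LHS]/((abse \o (EFin \o h)) x) fune_abse.
    rewrite ge0_integralD//; [|exact: measurable_funepos|exact: measurable_funeneg].
    exact: lte_add_pinfty.
  by rewrite (wint_rmean ih) lee_fin; exact: logsob_integrable.
move=> /negP; rewrite -leNgt leye_eq => /eqP hn.
rewrite wintE integralE -/h [X in (_ - X)%E]hn.
by rewrite (_ : _ - +oo = -oo)%E ?leNye// addeC; case: (\int[mu]_x _)%E hp.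
Qed.

End inequality.

End logsob_H10.

(** * Gamma integrals as Gaussian integrals *)

Section gamma.
Context {R : realType}.
Local Notation mu := (@lebesgue_measure R).
Implicit Types a s : R.

(** Monotone convergence: it carries the substitution below from compact intervals
    of the open half-line to the half-line. *)
Lemma integral_itv0y_lim (h : R -> R) (u v : nat -> R) :
  measurable_fun setT h -> (forall x, 0 < x -> 0 <= h x) ->
  (forall k, 0 < u k) -> (forall x, 0 < x -> exists k, u k <= x <= v k) ->
  (forall j k, (j <= k)%N -> u k <= u j /\ v j <= v k) ->
  (\int[mu]_(x in `[u k, v k]) (h x)%:E @[k --> \oo] --> \int[mu]_(x in `]0%R, +oo[) (h x)%:E)%E.
Proof.
move=> mh h0 u0 uv nd.
pose F k : set (measurableTypeR R) := `[u k, v k]%classic.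
have FT : \bigcup_k F k = `]0, +oo[%classic.
  apply/seteqP; split=> x.
    by move=> [k _]; rewrite /F/= !in_itv/= andbT => /andP[ux _]; exact: lt_le_trans ux.
  by rewrite /= in_itv/= andbT => /uv[k ?]; exists k => //; rewrite /F/= in_itv.
rewrite -FT.
apply: (@ge0_nondecreasing_set_cvg_integral _ (measurableTypeR R) R F (EFin \o h) mu).
- move=> i j ij; apply/subsetPset => x; rewrite /F/= !in_itv/= => /andP[x1 x2].
  have [h1 h2] := nd _ _ ij.
  by rewrite (le_trans h1 x1) (le_trans x2 h2).
- by move=> i; exact: measurable_itv.
- by move=> i; apply/measurable_EFinP; apply: measurable_funTS.
- move=> i x; rewrite /F/= in_itv/= => /andP[ux _]; rewrite lee_fin h0//.
  exact: lt_le_trans ux.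
Qed.

Lemma measurable_powR_gauss a s : measurable_fun setT (fun x : R => x `^ a * expR (- s / 2 * x ^+ 2)).
Proof. by apply: measurable_funM; [exact: measurable_powR|exact: measurable_gauss]. Qed.

(** Substitution [t = s x^2 / 2]. *)
Lemma integral_gamma_gauss a s : 0 <= a -> 0 < s ->
  (\int[mu]_(t in `]0%R, +oo[) (t `^ ((a + 1) / 2 - 1) * expR (- t))%:E =
   (2 * (s / 2) `^ ((a + 1) / 2))%:E *
   \int[mu]_(x in `]0%R, +oo[) (x `^ a * expR (- s / 2 * x ^+ 2))%:E)%E.
Proof.
move=> a0 s0; set z := (a + 1) / 2.
have s20 : 0 < s / 2 by rewrite divr_gt0.
pose F (x : R) := s / 2 * x ^+ 2.
pose G (t : R) := t `^ (z - 1) * expR (- t).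
pose H (x : R) := x `^ a * expR (- s / 2 * x ^+ 2).
set c := 2 * (s / 2) `^ z.
have c0 : 0 < c by rewrite mulr_gt0// powR_gt0.
pose u k : R := k.+1%:R^-1; pose v k : R := k.+1%:R.
have u0 k : 0 < u k by rewrite invr_gt0 ltr0n.
have v0 k : 0 < v k by rewrite ltr0n.
have uv k : u k <= v k by rewrite /u /v (le_trans (_ : _ <= 1)) ?invf_le1 ?ler1n ?ltr0n.
have nd j k : (j <= k)%N -> u k <= u j /\ v j <= v k.
  by move=> jk; rewrite /u /v lef_pV2 ?posrE ?ltr0n// ler_nat.
have bnd x : 0 < x -> exists k, u k <= x <= v k.
  move=> x0; pose k := maxn (Num.bound x) (Num.bound x^-1).
  have h1 : x <= k.+1%:R.
    apply: le_trans (ltW (archi_boundP (ltW x0))) _.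
    by rewrite ler_nat (leq_trans (leq_maxl _ _) (leqnSn _)).
  have h2 : x^-1 <= k.+1%:R.
    have := archi_boundP (ltW x0); have xV : 0 <= x^-1 by rewrite invr_ge0 ltW.
    move=> _; apply: le_trans (ltW (archi_boundP xV)) _.
    by rewrite ler_nat (leq_trans (leq_maxr _ _) (leqnSn _)).
  exists k; rewrite /u /v h1 andbT -[leRHS]invrK lef_pV2 ?posrE ?ltr0n// invr_gt0//.
have dF x : is_derive x (1:R) F (s * x).
  have -> : F = cst (s / 2) * (id ^+ 2) by [].
  by apply: is_derive_eq; rewrite /GRing.scale/= mulr0 addr0 expr1 mulr1 /cst; field.
have F1 : F^`()%classic = fun x => s * x.
  by apply/funext => x; rewrite derive1E; have [_ ->] := dF x.
have cF x : {for x, continuous F} by exact: is_derive_continuous (dF x).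
have F1c : continuous (fun x : R => s * x).
  by move=> x; apply: cvgM; [exact: cvg_cst|exact: cvg_id].
have Fm x y : 0 < x -> x < y -> F x < F y.
  by move=> x0 xy; rewrite /F ltr_pM2l// ltrXn2r ?ltW// (lt_le_trans _ xy).
have Fp x : 0 < x -> 0 < F x by move=> x0; rewrite /F mulr_gt0// exprn_gt0.
have sub k : (\int[mu]_(t in `[F (u k), F (v k)]) (G t)%:E =
    c%:E * \int[mu]_(x in `[u k, v k]) (H x)%:E)%E.
  rewrite (@integration_by_substitution_increasing R F G (u k) (v k)) //.
  - rewrite -ge0_integralZl_EFin//; last 3 first.
    + move=> x; rewrite /= in_itv/= => /andP[ux _]; rewrite lee_fin /H mulr_ge0 ?powR_ge0 ?expR_ge0//.
    + by apply/measurable_EFinP; apply: measurable_funTS; exact: measurable_powR_gauss.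
    + exact: ltW.
    apply: eq_integral => x; rewrite inE/= in_itv/= => /andP[ux _].
    have x0 : 0 < x by exact: lt_le_trans ux.
    rewrite -EFinM; congr EFin; rewrite F1 /= /G /H.
    have -> : (((fun t : R => t `^ (z - 1) * expR (- t)) \o F) * (fun x0 : R => s * x0)) x =
      F x `^ (z - 1) * expR (- F x) * (s * x) by [].
    rewrite {2}/F.
    have -> : - (s / 2 * x ^+ 2) = - s / 2 * x ^+ 2 by field.
    have -> : F x `^ (z - 1) = (s / 2) `^ z / (s / 2) * (x `^ a / x).
      rewrite /F powRM ?sqr_ge0 ?(ltW s20)//; congr (_ * _).
        by rewrite powRB ?powRr1 ?(ltW s20)// (gt_eqF s20) implybT.
      rewrite -powR_mulrn ?(ltW x0)// -powRrM.
      have -> : 2%:R * (z - 1) = a - 1 :> R by rewrite /z; field.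
      by rewrite powRB ?powRr1 ?(ltW x0)// (gt_eqF x0) implybT.
    rewrite /c; field; rewrite !gt_eqF//.
  - move=> x y; rewrite !in_itv/= => /andP[ux _] _; apply: Fm; exact: lt_le_trans ux.
  - by move=> x _; rewrite F1; exact: F1c.
  - by rewrite F1; apply/cvg_ex; eexists; apply: cvg_at_right_filter; exact: F1c.
  - by rewrite F1; apply/cvg_ex; eexists; apply: cvg_at_left_filter; exact: F1c.
  - split.
    + by move=> x _; have [] := dF x.
    + by apply: cvg_at_right_filter; exact: cF.
    + by apply: cvg_at_left_filter; exact: cF.
  - apply: continuous_in_subspaceT => t; rewrite inE/= in_itv/= => /andP[Ft _].
    have t0 : 0 < t by apply: lt_le_trans Ft; exact: Fp.
    apply: cvgM.
      exact: is_derive_continuous (is_derive1_powR (z - 1) t0).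
    apply: (@continuous_comp _ _ _ -%R expR); last exact: continuous_expR.
    exact: oppr_continuous.
have mG : measurable_fun setT G.
  apply: measurable_funM; first exact: measurable_powR.
  by apply: measurableT_comp; [exact: measurable_expR|exact: oppr_measurable].
have L1 : (\int[mu]_(t in `[F (u k), F (v k)]) (G t)%:E @[k --> \oo] -->
    \int[mu]_(t in `]0%R, +oo[) (G t)%:E)%E.
  apply: (@integral_itv0y_lim G (F \o u) (F \o v)) => //.
  - by move=> x _; rewrite /G mulr_ge0 ?powR_ge0 ?expR_ge0.
  - by move=> k; exact: Fp.
  - move=> t t0; pose x := Num.sqrt (t / (s / 2)).
    have x0 : 0 < x by rewrite sqrtr_gt0 divr_gt0.
    have Fx : F x = t.
      by rewrite /F sqr_sqrtr ?divr_ge0 ?ltW//; rewrite mulrC divfK// gt_eqF.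
    have [k /andP[h1 h2]] := bnd x x0; exists k; rewrite -Fx /F /= !ler_pM2l//.
    by rewrite !lerXn2r ?nnegrE ?(ltW x0) ?(ltW (u0 _)) ?(ltW (v0 _)).
  - move=> j k /nd[h1 h2]; rewrite /F/= !ler_pM2l//.
    by rewrite !lerXn2r ?nnegrE ?(ltW (u0 _)) ?(ltW (v0 _)).
have L2 : (\int[mu]_(x in `[u k, v k]) (H x)%:E @[k --> \oo] -->
    \int[mu]_(x in `]0%R, +oo[) (H x)%:E)%E.
  apply: integral_itv0y_lim => //; first exact: measurable_powR_gauss.
  by move=> x _; rewrite /H mulr_ge0 ?powR_ge0 ?expR_ge0.
have L3 : (\int[mu]_(t in `[F (u k), F (v k)]) (G t)%:E @[k --> \oo] -->
    c%:E * \int[mu]_(x in `]0%R, +oo[) (H x)%:E)%E.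
  under eq_fun do rewrite sub.
  by apply: cvgeZl.
exact: (cvg_unique _ L1 L3).
Qed.

End gamma.

(** * The constant and the optimal scale *)

Section constants.
Context {R : realType}.
Local Notation mu := (@lebesgue_measure R).
Implicit Types a s : R.

(** For [a = 0] the weight lives on the whole line, and parity accounts for the
    factor 2; this is the origin of the power of 2 in [PiA]. *)
Lemma gauss_mass_half_line a s : 0 <= a -> 0 < s ->
  ((gauss_mass a s)%:E = (if (0 < a)%R then 1 else 2%:E) *
   \int[mu]_(x in `]0%R, +oo[) (x `^ a * expR (- s / 2 * x ^+ 2))%:E)%E.
Proof.
move=> a0 s0; rewrite /gauss_mass /Rintegral fineK; last first.
  by apply: integrable_fin_num => //; exact: integrable_half_weight_gauss.
move: a0; rewrite le_eqVlt => /predU1P[<-|a0].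
  rewrite ltxx; under eq_integral => x _ do rewrite /half_weight ltxx/= powRr0 mulr1.
  rewrite (@ge0_symfun_integralT R (fun x => expR (- s / 2 * x ^+ 2))).
  - congr (_ * _)%E; rewrite -set_itvcy -integral_itv_obnd_cbnd.
      by apply: eq_integral => x _; rewrite powRr0 mul1r.
    by apply/measurable_EFinP; apply: measurable_funTS; exact: measurable_gauss.
  - by move=> x; exact: expR_ge0.
  - move=> x; apply: (@continuous_comp _ _ _ (fun x : R => - s / 2 * x ^+ 2) expR); last exact: continuous_expR.
    by apply: cvgM; [exact: cvg_cst|exact: exprn_continuous].
  - by move=> x /=; rewrite sqrrN.
rewrite a0 mul1e [RHS]integral_mkcond; apply: eq_integral => x _.
rewrite patchE; case: ifPn; rewrite /half_weight a0/=.
  rewrite inE/= in_itv/= andbT => x0; rewrite leNgt x0/= gtr0_norm//.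
  by rewrite mulrC.
by rewrite notin_setE/= in_itv/= andbT => /negP; rewrite -leNgt => ->; rewrite mulr0.
Qed.

Lemma Gamma_gauss_mass a s : 0 <= a -> 0 < s ->
  Gamma ((a + 1) / 2) =
  (if 0 < a then 2 else 1) * (s / 2) `^ ((a + 1) / 2) * gauss_mass a s.
Proof.
move=> a0 s0; rewrite /Gamma /Rintegral.
rewrite (_ : (fun t => (_ * _)%:E) = (fun t : R => (t `^ ((a + 1) / 2 - 1) * expR (- t))%:E))//.
rewrite (integral_gamma_gauss a0 s0).
have := gauss_mass_half_line a0 s0.
case: (ltP 0 a) => [a1|a1]; set J := (\int[_]_(_ in _) _)%E.
  by rewrite mul1e => <-; rewrite -EFinM.
move=> E; have JE : J = (gauss_mass a s / 2)%:E.
  rewrite EFinM E muleC muleA -EFinM mulVf// mul1e//.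
rewrite JE -EFinM /=; by field.
Qed.

Lemma Gamma_half_gt0 a : 0 <= a -> 0 < Gamma ((a + 1) / 2).
Proof.
move=> a0; rewrite (@Gamma_gauss_mass a 1)// !mulr_gt0 ?powR_gt0 ?gauss_mass_gt0//.
by case: ifP.
Qed.

Context {n : nat}.
Variable A : 'rV[R]_n.
Hypothesis A0 : forall i, 0 <= A 0 i.

Lemma hdim_ge : n%:R <= hdim A.
Proof. by rewrite /hdim lerDl; apply: sumr_ge0 => i _; exact: A0. Qed.

Lemma hdim_gt0 : (1 <= n)%N -> 0 < hdim A.
Proof. by move=> n1; apply: lt_le_trans hdim_ge; rewrite ltr0n. Qed.

Lemma prod_ifE : \prod_(i < n) (if 0 < A 0 i then 2 else 1) = 2 ^+ #|[set i | 0 < A 0 i]%SET| :> R.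
Proof.
rewrite -big_mkcond/= -prodr_const; apply: eq_bigl => i; by rewrite inE.
Qed.

Lemma PiA_base_gt0 :
  0 < (\prod_(i < n) Gamma ((A 0 i + 1) / 2)) / 2 ^+ #|[set i | 0 < A 0 i]%SET|.
Proof.
rewrite divr_gt0 ?exprn_gt0//; apply: prodr_gt0 => i _; exact: Gamma_half_gt0.
Qed.

Lemma PiA_gt0 : 0 < PiA A.
Proof. by rewrite /PiA powR_gt0// PiA_base_gt0. Qed.

Lemma log_massE s : (1 <= n)%N -> 0 < s ->
  log_mass A s = hdim A / 2 * (ln (PiA A) - ln (s / 2)).
Proof.
move=> n1 s0; have D0 := hdim_gt0 n1.
have s20 : 0 < s / 2 by rewrite divr_gt0.
have lnP : ln (PiA A) = 2 / hdim A * ln ((\prod_(i < n) Gamma ((A 0 i + 1) / 2)) / 2 ^+ #|[set i | 0 < A 0 i]%SET|).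
  by rewrite /PiA ln_powR.
rewrite lnP -prod_ifE -prodf_div/=.
have -> : ln (\prod_(i < n) (Gamma ((A 0 i + 1) / 2) / (if 0 < A 0 i then 2 else 1))) =
    \sum_(i < n) ((A 0 i + 1) / 2 * ln (s / 2) + ln (gauss_mass (A 0 i) s)).
  have H (m : nat) (F : 'I_m -> R) : (forall i, 0 < F i) -> ln (\prod_(i < m) F i) = \sum_(i < m) ln (F i).
    elim: m F => [|m IH] F F0; first by rewrite !big_ord0 ln1.
    by rewrite !big_ord_recr/= lnM ?posrE ?prodr_gt0// IH.
  rewrite H; last by move=> i; rewrite divr_gt0 ?Gamma_half_gt0//; case: ifP.
  apply: eq_bigr => i _; have m0 := gauss_mass_gt0 (A0 i) s0.
  have z0 : 0 < (if 0 < A 0 i then 2 else 1) :> R by case: ifP.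
  have kK (k x y : R) : 0 < k -> k * x * y / k = x * y.
    by move=> k0; field; rewrite gt_eqF.
  rewrite (Gamma_gauss_mass (A0 i) s0) kK//.
  by rewrite lnM ?posrE ?powR_gt0// ln_powR.
rewrite big_split/= -/(log_mass A s).
have -> : \sum_(i < n) (A 0 i + 1) / 2 * ln (s / 2) = hdim A / 2 * ln (s / 2).
  by rewrite -!mulr_suml big_split/= sumr_const card_ord /hdim addrC.
rewrite mulrBr; field; by rewrite gt_eqF.
Qed.

End constants.

Section optimal_scale.
Context {R : realType} {n : nat}.
Implicit Types (A : 'rV[R]_n) (f : 'rV[R]_n -> R) (g : 'rV[R]_n -> 'rV[R]_n).

(** The scale [2 I / D] minimises [I / s + (D / 2) ln s]. If the energy vanishes
    the right side is [-oo], and small scales show that so is the left side. *)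
Lemma logsob_sharp A f g : (1 <= n)%N -> (forall i, 0 <= A 0 i) -> H10 A f g ->
  wint A (fun x => `|f x| ^+ 2) = 1%:E ->
  (wint A (fun x => xlnx (`|f x| ^+ 2)) <= logsob_rhs A g)%E.
Proof.
move=> n1 A0 fg f1; have D0 := hdim_gt0 A0 n1; have P0 := PiA_gt0 A0.
have [I I0 gI] := H10_energy_fin A0 fg.
have H s : 0 < s -> (wint A (fun x => xlnx (`|f x| ^+ 2)) <=
    (I / s - (hdim A / 2 * (ln (PiA A) - ln s) + hdim A))%:E)%E.
  move=> s0; have s20 : 0 < 2 * s by rewrite mulr_gt0.
  have := logsob_H10 A0 fg f1 gI s20; rewrite (log_massE A0 n1 s20).
  rewrite (_ : 2 / (2 * s) * I = I / s); last by field; rewrite gt_eqF.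
  by rewrite (_ : 2 * s / 2 = s)//; field.
rewrite /logsob_rhs gI.
move: I0; rewrite le_eqVlt => /predU1P[I0|I0].
  rewrite -I0 mule0 le0_lneNy// gt0_muleNy ?lte_fin ?divr_gt0// leeNy_eq.
  move: H; case: (wint _ _) => [r| |] H //; last by have := H 1 ltr01.
  (* a finite value [r] is contradicted by a scale whose logarithm is small enough *)
  exfalso; pose c := r + hdim A / 2 * ln (PiA A) + hdim A.
  pose s := expR (2 / hdim A * (c - 1)).
  have := H s (expR_gt0 _); rewrite -I0 mul0r lee_fin /s expRK.
  rewrite (_ : 0 - _ = - (hdim A / 2 * ln (PiA A)) - hdim A + (c - 1)); last by field; rewrite gt_eqF.
  rewrite /c; lra.
have s0 : 0 < 2 * I / hdim A by rewrite divr_gt0// mulr_gt0.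
apply: le_trans (H _ s0) _.
have E0 := expR_gt0 (1 : R).
have k0 : 0 < 2 / (PiA A * expR 1 * hdim A) by rewrite divr_gt0// !mulr_gt0.
rewrite -EFinM lne_EFin; last by rewrite mulr_gt0.
rewrite -EFinM lee_fin.
have -> : 2 / (PiA A * expR 1 * hdim A) * I = (2 * I / hdim A) / (PiA A * expR 1).
  by field; rewrite !gt_eqF.
have PE0 : 0 < PiA A * expR 1 by rewrite mulr_gt0.
rewrite [ln (_ / (PiA A * _))]ln_div ?posrE//.
have -> : ln (PiA A * expR 1) = ln (PiA A) + 1 by rewrite lnM ?posrE// expRK.
rewrite le_eqVlt; apply/orP; left; apply/eqP; field.
by rewrite !gt_eqF.
Qed.

Lemma logsob_positive_part A f g : (forall i, 0 <= A 0 i) -> H10 A f g ->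
  wint A (fun x => `|f x| ^+ 2) = 1%:E ->
  (wint A (fun x => Num.max (xlnx (`|f x| ^+ 2)) 0)%R < +oo)%E.
Proof.
move=> A0 fg f1; have [I I0 gI] := H10_energy_fin A0 fg.
have := xlnx_pos_integrable A0 fg f1 gI.
have -> : (fun x => Num.max (xlnx (f x ^+ 2)) 0 * orthant_weight A x) =
    (fun x => Num.max (xlnx (`|f x| ^+ 2)) 0 * orthant_weight A x).
  by apply/funext => x; rewrite real_normK ?num_real.
by move=> /wint_rmean ->; rewrite ltry.
Qed.

End optimal_scale.

(** * Gaussian integrals on row vectors *)

Section product_integral.
Context {R : realType}.
Local Notation mR := (measurableTypeR R).
Local Notation leb n := (@lebesgue_tuple R n).

Lemma integral_tuple_prod n (phi : 'I_n -> R -> R) (I : 'I_n -> R) :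
  (forall i, measurable_fun setT (phi i)) -> (forall i x, 0 <= phi i x) ->
  (forall i, (\int[@lebesgue_measure R]_x (phi i x)%:E = (I i)%:E)%E) ->
  (\int[leb n]_t (\prod_(i < n) phi i (tnth t i))%:E = (\prod_(i < n) I i)%:E)%E.
Proof.
elim: n phi I => [|n IH] phi I mphi phi0 phiI.
  rewrite big_ord0; under eq_integral do rewrite big_ord0.
  by rewrite /= integral_dirac// diracT mul1e.
have mP m (psi : 'I_m -> R -> R) : (forall i, measurable_fun setT (psi i)) ->
    measurable_fun setT (fun t : m.-tuple mR => \prod_(i < m) psi i (tnth t i)).
  move=> mpsi; apply: measurable_prod => i _.
  exact: (measurableT_comp (mpsi i) (@measurable_tnth _ _ _ i)).
have P0 m (psi : 'I_m -> R -> R) (t : m.-tuple mR) : (forall i x, 0 <= psi i x) ->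
    0 <= \prod_(i < m) psi i (tnth t i).
  by move=> psi0; apply: prodr_ge0.
set f := fun t : n.+1.-tuple mR => (\prod_(i < n.+1) phi i (tnth t i))%:E.
have mf : measurable_fun setT f by apply/measurable_EFinP; exact: mP.
have := @ge0_integral_pushforward _ _ _ _ R (@cons_pair R n) (@measurable_cons_pair R n)
  (lebesgue_measure \x leb n)%E setT f measurableT mf.
rewrite preimage_setT => E; transitivity (\int[(lebesgue_measure \x leb n)%E]_z (f \o @cons_pair R n) z)%E.
  by apply: E => t _; rewrite lee_fin P0.
rewrite fubini_tonelli2; last 2 first.
- exact: (measurableT_comp mf (@measurable_cons_pair R n)).
- by move=> z; rewrite /= lee_fin P0.
rewrite big_ord_recl EFinM -(IH (fun i => phi (lift ord0 i)) (fun i => I (lift ord0 i)))//.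
rewrite -ge0_integralZl//.
- apply: eq_integral => t _; rewrite /fubini_G -(phiI ord0) muleC -ge0_integralZl//.
  + apply: eq_integral => x _; rewrite /= /f big_ord_recl tnth_cons_pair0 -EFinM mulrC.
    by congr ((_ * _)%:E); apply: eq_bigr => i _; rewrite tnth_cons_pairS.
  + by apply/measurable_EFinP; exact: mphi.
  + by move=> x _; rewrite lee_fin.
  + by rewrite lee_fin prodr_ge0.
- by apply/measurable_EFinP; exact: (mP _ (fun i => phi (lift ord0 i))).
- by move=> t _; rewrite lee_fin prodr_ge0.
- by rewrite -phiI; apply: integral_ge0 => x _; rewrite lee_fin.
Qed.

Lemma integral_rV_prod n (phi : 'I_n -> R -> R) (I : 'I_n -> R) :
  (forall i, measurable_fun setT (phi i)) -> (forall i x, 0 <= phi i x) ->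
  (forall i, (\int[@lebesgue_measure R]_x (phi i x)%:E = (I i)%:E)%E) ->
  (\int[@lebesgue_rV R n]_x (\prod_(i < n) phi i (x 0%R i))%:E = (\prod_(i < n) I i)%:E)%E.
Proof.
move=> mphi phi0 phiI; rewrite -(integral_tuple_prod mphi phi0 phiI).
have mf : measurable_fun setT (fun x : 'rV[R]_n => (\prod_(i < n) phi i (x 0 i))%:E).
  apply/measurable_EFinP; apply: measurable_prod => i _.
  exact: (measurableT_comp (mphi i) (measurable_coord i)).
have := @ge0_integral_pushforward _ _ _ _ R (@rV_of_tuple R n) (@measurable_rV_of_tuple R n)
  (leb n) setT _ measurableT mf.
rewrite preimage_setT => E; rewrite (_ : @lebesgue_rV R n = pushforward (leb n) (@rV_of_tuple R n) :> (_ -> _))//.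
rewrite E; last by move=> x _; rewrite lee_fin prodr_ge0.
by apply: eq_integral => t _ /=; congr EFin; apply: eq_bigr => i _; rewrite mxE.
Qed.

Lemma expR_sqnorm n s (x : 'rV[R]_n) :
  expR (- s / 2 * sqnorm x) = \prod_(i < n) expR (- s / 2 * x 0 i ^+ 2).
Proof. by rewrite /sqnorm mulr_sumr expR_sum. Qed.

Lemma integral_gauss_weight n (A : 'rV[R]_n) s : (forall i, 0 <= A 0 i) -> 0 < s ->
  wint A (fun x => expR (- s / 2 * sqnorm x)) = (\prod_(i < n) gauss_mass (A 0 i) s)%:E.
Proof.
move=> A0 s0; rewrite wintE.
under eq_integral => x _ do rewrite expR_sqnorm /orthant_weight -big_split/=.
apply: (@integral_rV_prod n (fun i y => expR (- s / 2 * y ^+ 2) * half_weight (A 0 i) y)).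
- move=> i; apply: measurable_funM; first exact: measurable_gauss.
  exact: measurable_half_weight.
- by move=> i y; rewrite mulr_ge0 ?expR_ge0 ?half_weight_ge0.
- move=> i; rewrite /gauss_mass /Rintegral fineK//.
  by apply: integrable_fin_num => //; exact: integrable_half_weight_gauss.
Qed.

Lemma prod_gauss_massE n (A : 'rV[R]_n) s : (1 <= n)%N -> (forall i, 0 <= A 0 i) -> 0 < s ->
  \prod_(i < n) gauss_mass (A 0 i) s = (2 * PiA A / s) `^ (hdim A / 2).
Proof.
move=> n1 A0 s0; have P0 := PiA_gt0 A0.
have H (m : nat) (F : 'I_m -> R) : (forall i, 0 < F i) -> \prod_(i < m) F i = expR (\sum_(i < m) ln (F i)).
  by move=> F0; rewrite expR_sum; apply: eq_bigr => i _; rewrite lnK ?posrE.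
rewrite H; last by move=> i; exact: gauss_mass_gt0.
rewrite -/(log_mass A s) log_massE//.
have b0 : 0 < 2 * PiA A / s by rewrite divr_gt0// mulr_gt0.
rewrite /powR gt_eqF//; congr (expR (_ * _)).
have s20 : 0 < s / 2 by rewrite divr_gt0.
rewrite -ln_div ?posrE//; congr ln; field; rewrite gt_eqF//.
Qed.

(** Integrability for the monomial weight on the whole space, on which the
    distance of the Sobolev space is defined. *)
Lemma integrable_gauss_monomial n (A : 'rV[R]_n) s : (forall i, 0 <= A 0 i) -> 0 < s ->
  (@lebesgue_rV R n).-integrable setT
    (EFin \o (fun x => expR (- s / 2 * sqnorm x) * monomial A x)).
Proof.
move=> A0 s0.
have E x : expR (- s / 2 * sqnorm x) * monomial A x =
    \prod_(i < n) (`|x 0 i| `^ A 0 i * expR (- s / 2 * x 0 i ^+ 2)).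
  by rewrite expR_sqnorm /monomial -big_split/=; apply: eq_bigr => i _; rewrite mulrC.
apply/integrableP; split.
  apply/measurable_EFinP; apply: measurable_funM; last exact: measurable_monomial.
  under eq_fun do rewrite expR_sqnorm.
  apply: measurable_prod => i _.
  exact: (measurableT_comp (@measurable_gauss R s) (measurable_coord i)).
under eq_integral => x _ do rewrite /= ger0_norm ?mulr_ge0 ?expR_ge0 ?prodr_ge0 ?E//.
rewrite (@integral_rV_prod n (fun i y => `|y| `^ A 0 i * expR (- s / 2 * y ^+ 2))
  (fun i => \int[lebesgue_measure]_y (`|y| `^ A 0 i * expR (- s / 2 * y ^+ 2)))).
- by rewrite ltry.
- by move=> i; apply: measurable_funM; [exact: measurable_normr_powR|exact: measurable_gauss].
- by move=> i y; rewrite mulr_ge0 ?expR_ge0 ?powR_ge0.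
- move=> i; rewrite /Rintegral fineK//.
  by apply: integrable_fin_num => //; exact: integrable_powR_gauss.
Qed.

End product_integral.

(** * Radial functions *)

Section radial.
Context {R : realType} {n : nat}.
Implicit Types (x : 'rV[R]_n) (phi : R -> R).

(** Reduces a directional derivative to a derivative of a function of one real
    variable. *)
Lemma is_derive_line (f : 'rV[R]_n -> R) x v d :
  is_derive (0 : R) (1:R) (fun h : R => f (h *: v + x)) d -> is_derive x v f d.
Proof.
move=> df.
have E : (fun h : R => h^-1 *: (((fun h : R => f (h *: v + x)) \o shift 0) (h *: 1) -
      f (0 *: v + x))) =
    (fun h : R => h^-1 *: ((f \o shift x) (h *: v) - f x)).
  by apply/funext => h /=; rewrite addr0 scale0r add0r [h%:A]mulr1.
by have [d1 d2] := df; apply: DeriveDef; [move: d1; rewrite /derivable E|move: d2; rewrite /derive E].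
Qed.

Lemma sqnorm_line x i (h : R) : sqnorm (h *: 'e_i + x) = sqnorm x + 2 * h * x 0 i + h ^+ 2.
Proof.
rewrite /sqnorm (bigD1 i)//= [in RHS](bigD1 i)//= !mxE !eqxx mulr1.
have -> : \sum_(j < n | j != i) (h *: 'e_i + x) 0 j ^+ 2 = \sum_(j < n | j != i) x 0 j ^+ 2.
  by apply: eq_bigr => j ji; rewrite !mxE (negbTE ji) andbF mulr0 add0r.
by ring.
Qed.

Lemma differentiable_sqnorm x : differentiable (@sqnorm R n) x.
Proof.
have -> : @sqnorm R n = \sum_(i < n) (fun x : 'rV[R]_n => x 0 i) ^+ 2.
  by apply/funext => y; rewrite fct_sumE.
apply: differentiable_sum => i; apply: differentiableX.
exact: differentiable_coord.
Qed.

Lemma continuous_sqnorm : continuous (@sqnorm R n).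
Proof. by move=> x; apply: differentiable_continuous; exact: differentiable_sqnorm. Qed.

Lemma differentiable_radial phi phi' x :
  (forall r, is_derive r (1:R) phi (phi' r)) -> differentiable (phi \o @sqnorm R n) x.
Proof.
move=> dphi; apply: differentiable_comp; first exact: differentiable_sqnorm.
by apply/derivable1_diffP; have [] := dphi (sqnorm x).
Qed.

Lemma grad_radial phi phi' x : (forall r, is_derive r (1:R) phi (phi' r)) ->
  grad (phi \o @sqnorm R n) x = (2 * phi' (sqnorm x)) *: x.
Proof.
move=> dphi; apply/rowP => i; rewrite !mxE.
suff H : is_derive x 'e_i (phi \o @sqnorm R n) (2 * phi' (sqnorm x) * x 0 i) by have [_ ->] := H.
apply: is_derive_line.
have -> : (fun h : R => (phi \o @sqnorm R n) (h *: 'e_i + x)) =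
    phi \o (fun h : R => sqnorm x + 2 * h * x 0 i + h ^+ 2).
  by apply/funext => h /=; rewrite sqnorm_line.
have d1 : is_derive (0:R) (1:R) (fun h : R => sqnorm x + 2 * h * x 0 i + h ^+ 2) (2 * x 0 i).
  have -> : (fun h : R => sqnorm x + 2 * h * x 0 i + h ^+ 2) =
      cst (sqnorm x) + (2 * x 0 i) \*: id + id ^+ 2.
    apply/funext => h; have -> : (cst (sqnorm x) + (2 * x 0 i) \*: id + id ^+ 2) h =
      sqnorm x + (2 * x 0 i) * h + h ^+ 2 by [].
    by ring.
  by apply: is_derive_eq; rewrite /GRing.scale/=; ring.
have d2 := dphi (sqnorm x + 2 * 0 * x 0 i + 0 ^+ 2).
have d3 := @is_derive1_comp R phi (fun h : R => sqnorm x + 2 * h * x 0 i + h ^+ 2) 0 _ _ d2 d1.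
apply: (is_derive_eq d3).
by rewrite mulr0 mul0r expr0n/= !addr0; ring.
Qed.

(** The norm on row vectors is the maximum norm. *)
Lemma norm_le_sqnorm x : `|x| <= 1 + sqnorm x.
Proof.
rewrite [leLHS]/Num.norm /= mx_normrE; apply: bigmax_le => [|[j i] _ /=].
  by rewrite addr_ge0// sqnorm_ge0.
rewrite (ord1 j).
have h : x 0 i ^+ 2 <= sqnorm x.
  by rewrite /sqnorm (bigD1 i)//= lerDl sumr_ge0// => k _; exact: sqr_ge0.
have := sqr_ge0 (`|x 0 i| - 1); rewrite -(@real_normK _ (x 0 i)) ?num_real// in h *.
have := normr_ge0 (x 0 i); nra.
Qed.

Lemma Cc1_radial phi phi' M : (forall r, is_derive r (1:R) phi (phi' r)) ->
  continuous phi' -> (forall r, M < r -> phi r = 0) -> Cc1 (phi \o @sqnorm R n).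
Proof.
move=> dphi cphi phi0; split.
- by move=> x; exact: differentiable_radial dphi.
- have -> : grad (phi \o @sqnorm R n) = fun x => (2 * phi' (sqnorm x)) *: x.
    by apply/funext => x; exact: grad_radial.
  move=> x; have c1 : (fun y => 2 * phi' (sqnorm y)) @ x --> 2 * phi' (sqnorm x).
    apply: (@continuous_comp _ _ _ (@sqnorm R n) (fun r : R => 2 * phi' r)).
      exact: continuous_sqnorm.
    by apply: cvgM; [exact: cvg_cst|exact: cphi].
  have c2 : (fun y : 'rV[R]_n => y) @ x --> x by exact: cvg_id.
  exact: (cvgZ c1 c2).
- apply: bounded_closed_compact; last exact: closed_closure.
  have S : closure [set x | (phi \o @sqnorm R n) x != 0] `<=` [set x | sqnorm x <= M].
    rewrite closureE => x /(_ [set x | sqnorm x <= M]); apply; split.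
      have -> : [set x | sqnorm x <= M] = @sqnorm R n @^-1` [set r | r <= M] by [].
      by apply: closed_comp; [move=> y _; exact: continuous_sqnorm|exact: closed_le].
    move=> y /= py; rewrite leNgt; apply/negP => My.
    by move/eqP : py; apply; exact: phi0.
  exists (1 + M); split; first exact: num_real.
  move=> K MK x /S/= xM; apply: le_trans (norm_le_sqnorm x) _.
  by rewrite ltW// (le_lt_trans _ MK)// lerD2l.
Qed.

End radial.

Section cutoff.
Context {R : realType}.

(** A profile with continuous derivative that vanishes on the negative axis;
    composed with an affine function of the squared norm it gives the cutoffs. *)
Definition pos_sq (r : R) : R := Num.max 0 r ^+ 2.

Lemma is_derive_pos_sq (r : R) : is_derive r (1:R) pos_sq (2 * Num.max 0 r).
Proof.
have [r0|r0|r0] := ltgtP r 0.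
- rewrite mulr0.
  apply: (@near_eq_is_derive _ _ _ (cst (0:R))).
  near=> y; rewrite /pos_sq max_l ?expr0n//=.
  by rewrite ltW//; near: y; exact: lt_nbhsl.
- have d2 : is_derive r (1:R) (id ^+ 2 : R -> R) (2 * r).
    by apply: is_derive_eq; rewrite /GRing.scale/= expr1 mulr1.
  apply: near_eq_is_derive d2; near=> y; rewrite /pos_sq max_r//=.
  by rewrite ltW//; near: y; exact: lt_nbhsr.
- rewrite r0 mulr0.
  have c0 : h^-1 *: ((pos_sq \o shift 0) (h *: 1) - pos_sq 0) @[h --> (0:R)^'] --> (0:R).
    apply/cvgrPdist_lt => /= e e0; near=> h.
    rewrite sub0r normrN addr0 [h%:A]mulr1 {2}/pos_sq maxxx expr0n subr0.
    have hn0 : h != 0 by near: h; exact: nbhs_dnbhs_neq.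
    rewrite [_ *: _]/(_ * _) normrM normfV ltr_pdivrMl ?normr_gt0//.
    have : `|pos_sq h| <= `|h| * `|h|.
      rewrite /pos_sq ger0_norm ?sqr_ge0//; have [h0|h0] := leP h 0.
        by rewrite expr0n mulr_ge0.
      by rewrite expr2 !gtr0_norm.
    move=> /le_lt_trans; apply; rewrite ltr_pM2l ?normr_gt0//.
    by near: h; apply: dnbhs0_lt.
  by apply: DeriveDef; [apply/cvg_ex; exists 0|apply/cvg_lim].
Unshelve. all: by end_near. Qed.

Lemma continuous_dpos_sq : continuous (fun r : R => 2 * Num.max 0 r).
Proof.
move=> r; apply: cvgM; first exact: cvg_cst.
apply: (@continuous_max _ _ (cst 0) id); [exact: cst_continuous|exact: cvg_id].
Qed.

End cutoff.

(** * Moments of the Gaussian *)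

Section gauss_moments.
Context {R : realType} {n : nat}.
Local Notation mu := (@lebesgue_rV R n).
Variable A : 'rV[R]_n.
Hypotheses (n1 : (1 <= n)%N) (A0 : forall i, 0 <= A 0 i).
Local Notation W := (orthant_weight A).
Local Notation gauss s := (fun x : 'rV[R]_n => expR (- s / 2 * sqnorm x)).
Local Notation integ h := (mu.-integrable setT (EFin \o (fun x => h x * W x))).

Lemma measurable_gauss_rV s : measurable_fun setT (gauss s).
Proof.
apply: measurableT_comp; first exact: measurable_expR.
apply: measurable_funM => //; apply: continuous_measurable_rV; exact: continuous_sqnorm.
Qed.

Lemma gauss_integrable s : 0 < s -> integ (gauss s).
Proof.
move=> s0; apply: (le_integrable measurableT _ _ (integrable_gauss_monomial A0 s0)).
  apply/measurable_EFinP; apply: measurable_funM; last exact: measurable_orthant_weight.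
  exact: measurable_gauss_rV.
move=> x _; rewrite /= lee_fin !normrM ler_wpM2l//.
rewrite !ger0_norm ?orthant_weight_ge0 ?orthant_weight_le//.
exact: le_trans (orthant_weight_ge0 A x) (orthant_weight_le A x).
Qed.

Lemma gauss_rmean s : 0 < s -> rmean A (gauss s) = (2 * PiA A / s) `^ (hdim A / 2).
Proof.
move=> s0; apply: EFin_inj; rewrite -wint_rmean; last exact: gauss_integrable.
by rewrite integral_gauss_weight// prod_gauss_massE.
Qed.

(** From [r / 4 <= exp (r / 4)], that is half of the decay. *)
Lemma sqnorm_gauss_le (x : 'rV[R]_n) : sqnorm x * expR (- 1 / 2 * sqnorm x) <=
  4 * expR (- (1 / 2) / 2 * sqnorm x).
Proof.
set r := sqnorm x; have : r / 4 <= expR (r / 4) by have := expR_ge1Dx (r / 4); lra.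
move=> h; rewrite (_ : - (1 / 2) / 2 * r = r / 4 + (- 1 / 2 * r)); last by field.
rewrite expRD mulrA ler_wpM2r ?expR_ge0//; lra.
Qed.

Lemma sqnorm_gauss_integrable : integ (fun x => sqnorm x * expR (- 1 / 2 * sqnorm x)).
Proof.
have s0 : 0 < 1 / 2 :> R by lra.
apply: (integrable_weight_le _ (integrable_weightZ 4 (gauss_integrable s0))).
  apply: measurable_funM; last exact: measurable_gauss_rV.
  by apply: continuous_measurable_rV; exact: continuous_sqnorm.
move=> x; rewrite ger0_norm ?mulr_ge0 ?sqnorm_ge0 ?expR_ge0//.
exact: sqnorm_gauss_le.
Qed.

(** The second moment is minus twice the derivative at 1 of the mass
    [Z s^(-D/2)] with respect to the scale. Differentiation under the integral
    sign is avoided: by [1 + y <= exp y] the affine function of slope [- M / 2]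
    touches the mass from below at [s = 1], and the mass is an explicit
    differentiable function of [s]. *)
Lemma sqnorm_gauss_rmean :
  rmean A (fun x => sqnorm x * expR (- 1 / 2 * sqnorm x)) = hdim A * rmean A (gauss 1).
Proof.
set M := rmean A (fun x => _ * _); set Z := rmean A (gauss 1).
have P0 := PiA_gt0 A0; have D0 := hdim_gt0 A0 n1.
have ZE (s : R) : 0 < s -> rmean A (gauss s) = Z * s `^ (- (hdim A / 2)).
  move=> s0; rewrite /Z !gauss_rmean// divr1 powRM ?invr_ge0 ?mulr_ge0 ?(ltW P0) ?(ltW s0)//.
  by rewrite -[s^-1]powR_inv1 ?(ltW s0)// -powRrM mulN1r.
pose f (s : R) := Z * s `^ (- (hdim A / 2)) + (s - 1) / 2 * M.
have fmin (s : R) : 0 < s -> f 1 <= f s.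
  move=> s0; have -> : f 1 = Z by rewrite /f powR1 mulr1 subrr !mul0r addr0.
  rewrite /f -ZE//.
  have i1 := gauss_integrable s0.
  have i2 := integrable_weightZ ((s - 1) / 2) sqnorm_gauss_integrable.
  rewrite /M -(rmeanZ _ sqnorm_gauss_integrable) -(rmeanD i1 i2).
  apply: le_Rintegral => //.
  - exact: gauss_integrable.
  - exact: integrable_weightD.
  move=> x _; rewrite ler_wpM2r ?orthant_weight_ge0//.
  set y := sqnorm x; rewrite (_ : - s / 2 * y = - ((s - 1) / 2 * y) + (- 1 / 2 * y)); last by field.
  rewrite expRD; have := expR_ge1Dx (- ((s - 1) / 2 * y)).
  move=> /(ler_wpM2r (expR_ge0 (- 1 / 2 * y))); rewrite -/y; lra.
have df (s : R) : 0 < s -> is_derive s (1:R) f (Z * (- (hdim A / 2) * s `^ (- (hdim A / 2) - 1)) + M / 2).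
  move=> s0; have d1 := is_derive1_powR (- (hdim A / 2)) s0.
  have -> : f = Z \*: (fun s => s `^ (- (hdim A / 2))) + (M / 2) \*: (id - cst 1).
    apply/funext => t; rewrite /f.
    have -> : (Z \*: (fun s => s `^ (- (hdim A / 2))) + (M / 2) \*: (id - cst 1)) t =
      Z * t `^ (- (hdim A / 2)) + M / 2 * (t - 1) by [].
    by congr (_ + _); field.
  by apply: is_derive_eq; rewrite /GRing.scale/= subr0 mulr1.
have d0 : is_derive (1 : R) (1:R) f 0.
  apply: (@derive1_at_min R f 0 2 1); first by rewrite ler0n.
  - by move=> t; rewrite in_itv/= => /andP[t0 _]; have [] := df t t0.
  - by rewrite in_itv/= ltr01 ltr1n.
  - by move=> t; rewrite in_itv/= => /andP[t0 _]; exact: fmin.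
have [_ E1] := d0; have [_] := df 1 ltr01; rewrite E1 powR1 mulr1.
lra.
Qed.

End gauss_moments.

(** * The extremal function *)

Section extremal.
Context {R : realType} {n : nat}.
Local Notation mu := (@lebesgue_rV R n).
Variable A : 'rV[R]_n.
Hypotheses (n1 : (1 <= n)%N) (A0 : forall i, 0 <= A 0 i).
Local Notation W := (orthant_weight A).
Local Notation F := (extremal A).
Let c0 : R := (2 * PiA A) `^ (hdim A / 4).

Let P0 : 0 < 2 * PiA A. Proof. by rewrite mulr_gt0// PiA_gt0. Qed.

Let c00 : 0 < c0. Proof. exact: powR_gt0. Qed.

Let c0sqr : c0 ^+ 2 = rmean A (fun x => expR (- 1 / 2 * sqnorm x)).
Proof.
rewrite gauss_rmean// divr1 /c0 -powR_mulrn ?powR_ge0// -powRrM.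
by congr (_ `^ _); field.
Qed.

Let phi (r : R) := expR (- r / 4) / c0.

Let dphi r : is_derive r (1:R) phi (- (phi r / 4)).
Proof.
have d1 : is_derive r (1:R) (fun r : R => - r / 4) (- 4^-1).
  have -> : (fun r : R => - r / 4) = (- 4^-1) \*: id.
    by apply/funext => t; rewrite mulNr mulrC -mulNr.
  by apply: is_derive_eq; rewrite /GRing.scale/= mulr1.
have d2 := @is_derive1_comp R expR (fun r : R => - r / 4) r _ _ (is_derive_expR _) d1.
have -> : phi = c0^-1 \*: (expR \o (fun r : R => - r / 4)).
  by apply/funext => t; rewrite /phi mulrC.
by apply: is_derive_eq; rewrite /= /GRing.scale/=; ring.
Qed.

Let phi_ge0 r : 0 <= phi r. Proof. by rewrite divr_ge0 ?expR_ge0// ltW. Qed.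

Let extremalE : F = phi \o @sqnorm R n. Proof. by []. Qed.

Let grad_extremal x : grad F x = (2 * - (phi (sqnorm x) / 4)) *: x.
Proof. by rewrite extremalE (grad_radial x dphi). Qed.

Let phi_sqr (x : 'rV[R]_n) : phi (sqnorm x) ^+ 2 = (c0 ^+ 2)^-1 * expR (- 1 / 2 * sqnorm x).
Proof.
rewrite /phi expr_div_n mulrC -expRM_natl; congr (_ * expR _).
by field.
Qed.

Let sqrE : (fun x => `|F x| ^+ 2) = (fun x => (c0 ^+ 2)^-1 * expR (- 1 / 2 * sqnorm x)).
Proof. by apply/funext => x; rewrite real_normK ?num_real// -phi_sqr. Qed.

Let ig := gauss_integrable A0 (@ltr01 R).

Lemma extremal_mass : wint A (fun x => `|F x| ^+ 2) = 1%:E.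
Proof.
rewrite sqrE wint_rmean; last exact: integrable_weightZ.
by rewrite (rmeanZ _ ig) -c0sqr mulVf// expf_neq0// gt_eqF.
Qed.

Lemma sqnormZ (a : R) (x : 'rV[R]_n) : sqnorm (a *: x) = a ^+ 2 * sqnorm x.
Proof. by rewrite /sqnorm mulr_sumr; apply: eq_bigr => i _; rewrite !mxE exprMn. Qed.

Let igm := sqnorm_gauss_integrable A0.

Let moment_rmean (k : R) : wint A (fun x => k * (sqnorm x * ((c0 ^+ 2)^-1 * expR (- 1 / 2 * sqnorm x)))) =
  (k * hdim A)%:E.
Proof.
have -> : (fun x : 'rV[R]_n => k * (sqnorm x * ((c0 ^+ 2)^-1 * expR (- 1 / 2 * sqnorm x)))) =
    (fun x => (k / c0 ^+ 2) * (sqnorm x * expR (- 1 / 2 * sqnorm x))).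
  by apply/funext => x; ring.
rewrite wint_rmean; last exact: integrable_weightZ.
rewrite (rmeanZ _ igm) sqnorm_gauss_rmean// -c0sqr; congr EFin.
by field; rewrite gt_eqF.
Qed.

Lemma extremal_moment : wint A (fun x => sqnorm x * `|F x| ^+ 2) = (hdim A)%:E.
Proof.
rewrite -[hdim A]mul1r -moment_rmean; congr wint; apply/funext => x.
by rewrite mul1r real_normK ?num_real// -phi_sqr.
Qed.

Lemma extremal_energy : wint A (fun x => sqnorm (grad F x)) = (hdim A / 4)%:E.
Proof.
rewrite mulrC -moment_rmean; congr wint; apply/funext => x.
rewrite grad_extremal sqnormZ -phi_sqr; set p := phi _; set y := sqnorm _; by field.
Qed.

(** The logarithm of the square of the extremal function is affine in the squared
    norm, so the entropy is a combination of the mass and the second moment;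
    it agrees with the right side at the energy [D / 4]. *)
Lemma extremal_entropy :
  wint A (fun x => xlnx (`|F x| ^+ 2)) = logsob_rhs A (grad F).
Proof.
have D0 := hdim_gt0 A0 n1.
have cp : 0 < c0 ^+ 2 by rewrite exprn_gt0.
have E x : xlnx (`|F x| ^+ 2) = (- (1 / 2)) / c0 ^+ 2 * (sqnorm x * expR (- 1 / 2 * sqnorm x)) +
    (- ln (c0 ^+ 2)) / c0 ^+ 2 * expR (- 1 / 2 * sqnorm x).
  have -> : `|F x| ^+ 2 = (c0 ^+ 2)^-1 * expR (- 1 / 2 * sqnorm x) by rewrite -[LHS]/((fun x => `|F x| ^+ 2) x) sqrE.
  rewrite /xlnx lnM ?posrE ?expR_gt0 ?invr_gt0// lnV ?posrE// expRK; ring.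
have j1 := integrable_weightZ ((- (1 / 2)) / c0 ^+ 2) igm.
have j2 := integrable_weightZ ((- ln (c0 ^+ 2)) / c0 ^+ 2) ig.
rewrite (_ : (fun x => xlnx _) = (fun x => (- (1 / 2)) / c0 ^+ 2 * (sqnorm x * expR (- 1 / 2 * sqnorm x)) +
    (- ln (c0 ^+ 2)) / c0 ^+ 2 * expR (- 1 / 2 * sqnorm x))); last by apply/funext => x; exact: E.
rewrite wint_rmean; last exact: integrable_weightD.
rewrite (rmeanD j1 j2) (rmeanZ _ igm) (rmeanZ _ ig) sqnorm_gauss_rmean// -c0sqr.
have -> : ln (c0 ^+ 2) = hdim A / 2 * ln (2 * PiA A).
  by rewrite c0sqr gauss_rmean// divr1 ln_powR.
rewrite /logsob_rhs extremal_energy -EFinM.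
have Pp := PiA_gt0 A0; have E0 := expR_gt0 (1 : R).
have -> : 2 / (PiA A * expR 1 * hdim A) * (hdim A / 4) = (2 * PiA A * expR 1)^-1.
  by field; rewrite !gt_eqF.
have PE0 : 0 < 2 * PiA A * expR 1 by rewrite mulr_gt0.
rewrite lne_EFin; last by rewrite invr_gt0.
rewrite -EFinM; congr EFin; rewrite lnV ?posrE//.
have -> : ln (2 * PiA A * expR 1) = ln (2 * PiA A) + 1 by rewrite lnM ?posrE// expRK.
by field; rewrite gt_eqF.
Qed.

(* the extremal function times the cutoff, as a function of the squared norm *)
Let cut (k : nat) (r : R) := phi r * pos_sq (1 - r * k.+1%:R^-1).

Let dcut (k : nat) (r : R) := - (phi r / 4) * pos_sq (1 - r * k.+1%:R^-1) -
  phi r * (2 * Num.max 0 (1 - r * k.+1%:R^-1) * k.+1%:R^-1).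

Let cphi : continuous phi.
Proof. by move=> r; exact: is_derive_continuous (dphi r). Qed.

Let carg (k : nat) : continuous (fun r : R => 1 - r * k.+1%:R^-1).
Proof.
by move=> r; apply: cvgB; [exact: cvg_cst|apply: cvgM; [exact: cvg_id|exact: cvg_cst]].
Qed.

Let cpos : continuous (@pos_sq R).
Proof. by move=> r; exact: is_derive_continuous (is_derive_pos_sq r). Qed.

Let d_cut k r : is_derive r (1:R) (cut k) (dcut k r).
Proof.
have d1 : is_derive r (1:R) (fun r : R => 1 - r * k.+1%:R^-1) (- k.+1%:R^-1).
  have -> : (fun r : R => 1 - r * k.+1%:R^-1) = cst 1 + (- k.+1%:R^-1) \*: id.
    apply/funext => t; have -> : (cst 1 + (- k.+1%:R^-1) \*: id) t = 1 + (- k.+1%:R^-1) * t :> R by [].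
    ring.
  by apply: is_derive_eq; rewrite /GRing.scale/= add0r mulr1.
have d2 := @is_derive1_comp R (@pos_sq R) (fun r : R => 1 - r * k.+1%:R^-1) r _ _ (is_derive_pos_sq _) d1.
have d3 := dphi r.
have -> : cut k = phi * (@pos_sq R \o (fun r : R => 1 - r * k.+1%:R^-1)) by [].
by apply: is_derive_eq; rewrite /GRing.scale/= /dcut; ring.
Qed.

Let Cc1_cut k : Cc1 (cut k \o @sqnorm R n).
Proof.
apply: (@Cc1_radial R n (cut k) (dcut k) k.+1%:R); first exact: d_cut.
- move=> r; apply: cvgB.
    apply: cvgM.
      by apply: (@cvgN _ R^o); apply: cvgM; [exact: cphi|exact: cvg_cst].
    apply: (@continuous_comp _ _ _ (fun r : R => 1 - r * k.+1%:R^-1) (@pos_sq R)); first exact: carg.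
    exact: cpos.
  apply: cvgM; first exact: cphi.
  apply: cvgM; last exact: cvg_cst.
  apply: (@continuous_comp _ _ _ (fun r : R => 1 - r * k.+1%:R^-1) (fun r : R => 2 * Num.max 0 r)).
    exact: carg.
  exact: continuous_dpos_sq.
- move=> r kr; rewrite /cut /pos_sq max_l ?expr0n ?mulr0//=.
  by rewrite subr_le0 ler_pdivlMr ?ltr0n// mul1r ltW.
Qed.

(* a bound on the integrand of the Sobolev distance that is uniform in [k] *)
Let cut_defect k r : 0 <= r ->
  (cut k r - phi r) ^+ 2 + (2 * dcut k r - 2 * - (phi r / 4)) ^+ 2 * r <=
  (1 + 16 * r) * phi r ^+ 2.
Proof.
move=> r0; rewrite /cut /dcut /pos_sq; set t := k.+1%:R^-1.
have t0 : 0 <= t by rewrite /t invr_ge0.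
have t1 : t <= 1 by rewrite /t invf_le1// ler1n.
set m := Num.max 0 (1 - r * t).
have m0 : 0 <= m by rewrite /m le_max lexx.
have m1 : m <= 1 by rewrite /m ge_max ler01 lerBlDr lerDl mulr_ge0.
have p0 := phi_ge0 r; set p := phi r in p0 *.
have h1 : (p * m ^+ 2 - p) ^+ 2 <= p ^+ 2.
  have -> : (p * m ^+ 2 - p) ^+ 2 = p ^+ 2 * (1 - m ^+ 2) ^+ 2 by ring.
  rewrite ler_piMr ?sqr_ge0//.
  have : m ^+ 2 <= 1 by rewrite expr_le1.
  by have := sqr_ge0 m; nra.
have h2 : (2 * (- (p / 4) * m ^+ 2 - p * (2 * m * t)) - 2 * - (p / 4)) ^+ 2 <= 16 * p ^+ 2.
  have -> : (2 * (- (p / 4) * m ^+ 2 - p * (2 * m * t)) - 2 * - (p / 4)) ^+ 2 =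
    16 * p ^+ 2 * ((1 - m ^+ 2) / 8 - m * t) ^+ 2 by field.
  rewrite ler_piMr ?(mulr_ge0 _ (sqr_ge0 p))//.
  have m2 : m ^+ 2 <= 1 by rewrite expr_le1.
  have m3 := sqr_ge0 m.
  have mt : m * t <= 1 by rewrite mulr_ile1.
  have mt0 : 0 <= m * t by rewrite mulr_ge0.
  have e1 : (1 - m ^+ 2) / 8 - m * t <= 1 by lra.
  have e2 : -1 <= (1 - m ^+ 2) / 8 - m * t by lra.
  by move: e1 e2; set e := _ - m * t=> e1 e2; nra.
by have := ler_wpM2r r0 h2; lra.
Qed.

Let defectE k (x : 'rV[R]_n) : `|(cut k \o @sqnorm R n) x - F x| ^+ 2 +
    sqnorm (grad (cut k \o @sqnorm R n) x - grad F x) =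
  (cut k (sqnorm x) - phi (sqnorm x)) ^+ 2 +
  (2 * dcut k (sqnorm x) - 2 * - (phi (sqnorm x) / 4)) ^+ 2 * sqnorm x.
Proof.
rewrite real_normK ?num_real// (grad_radial x (d_cut k)) grad_extremal.
by rewrite -scalerBl sqnormZ.
Qed.

Let cut_cvg r : (cut k r - phi r) ^+ 2 + (2 * dcut k r - 2 * - (phi r / 4)) ^+ 2 * r
  @[k --> \oo] --> (0 : R).
Proof.
have tk : (k.+1%:R^-1 : R) @[k --> \oo] --> (0 : R) by exact: cvg_harmonic.
have ak : 1 - r * k.+1%:R^-1 @[k --> \oo] --> (1 : R).
  rewrite -[X in _ --> X]subr0 -[X in _ --> _ - X](mulr0 r).
  by apply: cvgB; [exact: cvg_cst|apply: cvgM; [exact: cvg_cst|exact: tk]].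
have pk : pos_sq (1 - r * k.+1%:R^-1) @[k --> \oo] --> (1 : R).
  have p1 : pos_sq 1 = 1 :> R by rewrite /pos_sq max_r// expr1n.
  rewrite -[X in _ --> X]p1.
  exact: (cvg_comp _ _ ak (@cpos 1)).
have mk : 2 * Num.max 0 (1 - r * k.+1%:R^-1) @[k --> \oo] --> (2 * Num.max 0 1 : R).
  exact: (cvg_comp _ _ ak (@continuous_dpos_sq R 1)).
have ck : cut k r - phi r @[k --> \oo] --> phi r * 1 - phi r.
  by apply: cvgB; [apply: cvgM; [exact: cvg_cst|exact: pk]|exact: cvg_cst].
have dk : 2 * dcut k r - 2 * - (phi r / 4) @[k --> \oo] -->
    2 * (- (phi r / 4) * 1 - phi r * (2 * Num.max 0 1 * 0)) - 2 * - (phi r / 4).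
  apply: cvgB; last exact: cvg_cst.
  apply: cvgM; first exact: cvg_cst.
  apply: cvgB; first by apply: cvgM; [exact: cvg_cst|exact: pk].
  by apply: cvgM; [exact: cvg_cst|apply: cvgM; [exact: mk|exact: tk]].
have := cvgD (cvgM ck ck) (cvgM (cvgM dk dk) (cvg_cst r)).
rewrite (_ : _ + _ * r = 0); last by ring.
exact.
Qed.

(** The cutoffs converge pointwise, with their gradients, and dominated
    convergence gives the convergence of the Sobolev distance. *)
Lemma extremal_H10 : H10 A F (grad F).
Proof.
have mF : measurable_fun setT F.
  apply: continuous_measurable_rV => x; rewrite extremalE.
  apply: differentiable_continuous; exact: differentiable_radial dphi.
have mgF i : measurable_fun setT (fun x => grad F x 0 i).
  rewrite (_ : (fun x => grad F x 0 i) = fun x => 2 * - (F x / 4) * x 0 i).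
    apply: measurable_funM; last exact: measurable_coord.
    apply: measurable_funM => //; apply: measurable_funN.
    exact: measurable_funM.
  by apply/funext => x; rewrite grad_extremal mxE.
split => //; exists (fun k => cut k \o @sqnorm R n); split; first exact: Cc1_cut.
have s0 : 0 < 1 / 2 :> R by lra.
have cp : 0 < c0 ^+ 2 by rewrite exprn_gt0.
(* [1 + 16 r] times the Gaussian is at most [1 + 16 * 4] times the wider one *)
pose B x := 65 / c0 ^+ 2 * (expR (- (1 / 2) / 2 * sqnorm x) * monomial A x).
have iB : mu.-integrable setT (EFin \o B).
  by have := @integrableZl _ _ R mu setT measurableT (65 / c0 ^+ 2) _ (integrable_gauss_monomial A0 s0); exact.
have mono0 x : 0 <= monomial A x by exact: le_trans (orthant_weight_ge0 A x) (orthant_weight_le A x).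
pose G k x := (`|(cut k \o @sqnorm R n) x - F x| ^+ 2 +
    sqnorm (grad (cut k \o @sqnorm R n) x - grad F x)) * monomial A x.
have [|||_ _ cG] := @dominated_convergence _ _ R mu setT measurableT (fun k => EFin \o G k)
  (cst 0%E) _ _ (measurable_cst _) _ iB _.
- by move=> k; apply/measurable_EFinP; apply: measurable_H1_integrand.
- apply: aeW => x _.
  suff cg : G k x @[k --> \oo] --> (0 : R) by apply: cvg_EFin; [exact: nearW|exact: cg].
  have -> : G^~ x = fun k => ((cut k (sqnorm x) - phi (sqnorm x)) ^+ 2 +
      (2 * dcut k (sqnorm x) - 2 * - (phi (sqnorm x) / 4)) ^+ 2 * sqnorm x) * monomial A x.
    by apply/funext => k; rewrite /G defectE.
  rewrite -[X in _ --> X](mul0r (monomial A x)).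
  by apply: cvgM; [exact: cut_cvg|exact: cvg_cst].
- apply: aeW => x k _; rewrite /= lee_fin ger0_norm; last first.
    by rewrite /G mulr_ge0// addr_ge0 ?sqr_ge0 ?sqnorm_ge0.
  rewrite /G /B mulrA ler_wpM2r// defectE.
  apply: le_trans (cut_defect k (sqnorm_ge0 x)) _; rewrite phi_sqr.
  have h := sqnorm_gauss_le x; set q := expR (- (1 / 2) / 2 * sqnorm x) in h *.
  have h2 : expR (- 1 / 2 * sqnorm x) <= q.
    by rewrite ler_expR; have := sqnorm_ge0 x; lra.
  rewrite mulrCA [leRHS]mulrAC [leRHS]mulrC ler_wpM2l ?invr_ge0 ?(ltW cp)//; lra.
move: cG; rewrite integral0; exact.
Qed.

End extremal.

(** * The logarithmic Sobolev inequality with monomial weight *)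

Theorem theorem1p2 (R : realType) (n : nat) (A : 'rV[R]_n)
    (hn : (1 <= n)%N) (hA : forall i, 0 <= A 0 i) :
  (forall (f : 'rV[R]_n -> R) (g : 'rV[R]_n -> 'rV[R]_n),
     H10 A f g ->
     wint A (fun x => `|f x| ^+ 2) = 1%:E ->
     (* the positive part is integrable, so that the integral on the left is
        well defined in [-oo, +oo[ *)
     (wint A (fun x => Num.max (xlnx (`|f x| ^+ 2)) 0)%R < +oo)%E /\
     (wint A (fun x => xlnx (`|f x| ^+ 2))%R <= logsob_rhs A g)%E) /\
  [/\ H10 A (extremal A) (grad (extremal A)),
      wint A (fun x => `|extremal A x| ^+ 2) = 1%:E,
      wint A (fun x => sqnorm x * `|extremal A x| ^+ 2) = (hdim A)%:E &
      wint A (fun x => xlnx (`|extremal A x| ^+ 2)) =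
        logsob_rhs A (grad (extremal A))].
Proof.
split.
  move=> f g Hf f1; split; first exact: logsob_positive_part Hf f1.
  exact: logsob_sharp Hf f1.
split; [exact: extremal_H10|exact: extremal_mass|exact: extremal_moment|].
exact: extremal_entropy.
Qed.
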